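(* Let $\Gamma$ be a finite connected metric graph with $V$ vertices, let $q:\Gamma\to\mathbb{R}$ be measurable and bounded with $q(x)\ge0$ for almost all $x\in\Gamma$, and let $\widetilde\Gamma$ be the graph formed by gluing precisely $k+1$ vertices of $\Gamma$ into one vertex (the potential $q$ being unchanged). Write $\lambda_j,\lambda_j^+$ for the eigenvalues and positive eigenvalues of $-\Delta_{{\rm K},\Gamma,q}$, and $\widetilde\lambda_j,\widetilde\lambda_j^+$ for those of $-\Delta_{{\rm K},\widetilde\Gamma,q}$. Then: (a) the positive eigenvalues satisfy the interlacing inequalities $$\widetilde\lambda_j^+\le\lambda_j^+\le\widetilde\lambda_{j+k}^+\le\lambda_{j+k}^+,\qquad j\in\mathbb{N};$$ (b) the eigenvalues (counting ground states) satisfy the interlacing inequalities $$\lambda_j\le\widetilde\lambda_j\le\lambda_{j+k}\le\widetilde\lambda_{j+k},\qquad j\in\mathbb{N}.$$ In particular, $0=\lambda_V<\widetilde\lambda_{V-k+1}$.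
   Context: A finite metric graph $\Gamma$ consists of a finite vertex set $\mathcal{V}$, a finite nonempty edge set $\mathcal{E}$ (loops and multiple edges allowed) and a length function $\ell:\mathcal{E}\to(0,\infty)$; $V=|\mathcal{V}|$. Each edge $e$ is identified with $[0,\ell(e)]$, its two endpoints corresponding to the (possibly equal) vertices incident with $e$. A function $f$ on $\Gamma$ is a collection $(f_e)_{e\in\mathcal{E}}$ of functions $f_e:(0,\ell(e))\to\mathbb{C}$; $f\in L^2(\Gamma)$ means $f_e\in L^2(0,\ell(e))$ for all $e$. $\widetilde H^k(\Gamma)$ is the set of $f\in L^2(\Gamma)$ with $f_e\in H^k(0,\ell(e))$ for all $e$; $H^1(\Gamma)$ is the set of $f\in\widetilde H^1(\Gamma)$ that are continuous at each vertex (all traces at endpoints corresponding to the same vertex $v$ coincide; the common value is $f(v)$). For $f\in\widetilde H^2(\Gamma)$ and $v\in\mathcal{V}$, $\partial_\nu f(v)$ is the sum, over all edge endpoints located at $v$ (both endpoints of a loop at $v$ are counted), of the derivative of $f_e$ at that endpoint taken in the direction pointing towards $v$ (i.e. $f_e'(\ell(e))$ for the endpoint $\ell(e)$ and $-f_e'(0)$ for the endpoint $0$). Let $S$ be the operator in $L^2(\Gamma)$ with $(Sf)_e=-f_e''+q_ef_e$ on each edge and $\operatorname{dom}S=\{f\in\widetilde H^2(\Gamma)\cap H^1(\Gamma): f(v)=\partial_\nu f(v)=0\text{ for each }v\in\mathcal{V}\}$. It is closed, symmetric, densely defined with a positive lower bound; its adjoint $S^*$ acts in the same way on $\operatorname{dom}S^*=\widetilde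 H^2(\Gamma)\cap H^1(\Gamma)$. The perturbed Krein Laplacian $-\Delta_{{\rm K},\Gamma,q}$ is the Krein–von Neumann extension of $S$: the self-adjoint restriction of $S^*$ to $\operatorname{dom}S\dotplus\ker S^*$. Its spectrum is purely discrete and nonnegative; eigenvalues (resp. positive eigenvalues) are listed in nondecreasing order as $\lambda_1\le\lambda_2\le\dots$ (resp. $\lambda_1^+\le\lambda_2^+\le\dots$), counted with multiplicities. Gluing vertices: $\widetilde\Gamma$ is obtained from $\Gamma$ by identifying $k+1$ distinct vertices $v_1,\dots,v_{k+1}$ to form a single new vertex $v_0$, keeping all edges and their lengths; $\widetilde\Gamma$ has $V-k$ vertices and $q$ is regarded as a potential on $\widetilde\Gamma$. *)

(* Defs.v *)
From mathcomp Require Import all_boot all_order all_algebra.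
From mathcomp Require Import complex.
From mathcomp Require Import all_classical all_reals all_analysis.
From mathcomp Require Import measurable_realfun.

Set Implicit Arguments.
Unset Strict Implicit.
Unset Printing Implicit Defensive.

Import Order.TTheory GRing.Theory Num.Theory.
Import numFieldNormedType.Exports.

Local Open Scope classical_set_scope.
Local Open Scope ring_scope.
Local Open Scope complex_scope.
Local Open Scope card_scope.

Section Interval.
Context {R : realType}.
Implicit Types (l : R) (f g F : R -> R[i]) (phi : R -> R).

Local Notation mu := (@lebesgue_measure R).

Definition aeq l f g : Prop :=
  {ae mu, forall x, x \in `]0, l[ -> f x = g x}.

Definition cintegral l f : R[i] :=
  (\int[mu]_(x in `]0%R, l[) complex.Re (f x))%R +i*
  (\int[mu]_(x in `]0%R, l[) complex.Im (f x))%R.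

(* [measurable_fun] means Borel here: every class of L^2(0, l) has a Borel
   representative, and functions are always compared through [aeq]. *)
Definition in_L2 l f : Prop :=
  [/\ measurable_fun `]0, l[ (fun x => complex.Re (f x)),
      measurable_fun `]0, l[ (fun x => complex.Im (f x)) &
      (\int[mu]_(x in `]0%R, l[)
         (complex.Re (f x) ^+ 2 + complex.Im (f x) ^+ 2)%:E < +oo)%E].

Definition test_function l phi : Prop :=
  [/\ forall x, derivable phi x 1, continuous (phi^`())%classic &
      exists a b, [/\ 0 < a, b < l &
        forall x, phi x != 0 -> x \in `[a, b]]].

(* Test functions are C^1 with compact support in (0, l), as in Brezis,
   "Functional Analysis, Sobolev Spaces and PDE", section 8.2; real-valued
   ones suffice by linearity. *)
Definition is_weak_derivative l f g : Prop :=
  forall phi, test_function l phi ->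
    cintegral l (fun x => ((phi^`())%classic x)%:C * f x)
    = - cintegral l (fun x => (phi x)%:C * g x).

Definition in_H1 l f : Prop :=
  in_L2 l f /\ exists g, in_L2 l g /\ is_weak_derivative l f g.

(* Determined up to [aeq] when f is in H^1(0, l); a junk value otherwise. *)
Definition weak_derivative l f : R -> R[i] :=
  xget (fun=> 0) [set g | in_L2 l g /\ is_weak_derivative l f g].

Definition in_H2 l f : Prop := in_H1 l f /\ in_H1 l (weak_derivative l f).

Definition continuous_representative l f F : Prop :=
  [/\ {within `[0, l], continuous (fun x => complex.Re (F x))},
      {within `[0, l], continuous (fun x => complex.Im (F x))} &
      aeq l F f].

(* Value at x in [0, l], endpoints included, of the continuous representative
   of f, which exists when f is in H^1(0, l). *)
Definition trace l f (x : R) : R[i] :=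
  xget 0 [set c | exists2 F, continuous_representative l f F & F x = c].

End Interval.

(* The edge e is [0, len e]; its endpoint 0 lies at [src e] and its endpoint
   [len e] at [tgt e]. The orientation is only a parametrization. *)
Record metric_graph (R : realType) := MetricGraph {
  vertex : finType;
  edge : finType;
  src : edge -> vertex;
  tgt : edge -> vertex;
  len : edge -> R;
  len_gt0 : forall e, 0 < len e;
  edge_gt0 : (0 < #|edge|)%N
}.

Section Graph.
Context {R : realType}.
Implicit Type G : metric_graph R.

Local Notation mu := (@lebesgue_measure R).

Definition adjacent G : rel (vertex G) := fun v w =>
  [exists e : edge G, ((src e == v) && (tgt e == w))
                   || ((src e == w) && (tgt e == v))].

Definition connected_graph G : Prop :=
  forall v w : vertex G, connect (@adjacent G) v w.

(* [insub v] is [None], the new vertex, when v is in A, and the old vertex v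
   otherwise. *)
Definition glue_vertices G (A : {set vertex G}) : metric_graph R :=
  @MetricGraph R (option {v : vertex G | v \notin A}) (edge G)
    (fun e => insub (src e)) (fun e => insub (tgt e))
    (@len R G) (@len_gt0 R G) (@edge_gt0 R G).

(* Measurability with respect to the Lebesgue (i.e. completed Borel)
   sigma-algebra. *)
Definition measurable_potential G (q : edge G -> R -> R) : Prop :=
  forall e, measurable_fun
    (`]0, len e[ : set (g_sigma_algebraType (completed_algebra_gen mu)))
    (q e : g_sigma_algebraType (completed_algebra_gen mu) -> R).

Definition bounded_potential G (q : edge G -> R -> R) : Prop :=
  exists M, forall e x, x \in `]0, len e[ -> `|q e x| <= M.

Definition ae_nonneg_potential G (q : edge G -> R -> R) : Prop :=
  forall e, {ae mu, forall x, x \in `]0, len e[ -> 0 <= q e x}.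

Definition gfun G := edge G -> R -> R[i].

Definition gaeq G (f g : gfun G) : Prop := forall e, aeq (len e) (f e) (g e).

Definition L2_graph G (f : gfun G) : Prop := forall e, in_L2 (len e) (f e).

Definition inner G (f g : gfun G) : R[i] :=
  \sum_(e : edge G) cintegral (len e) (fun x => f e x * (g e x)^*).

Definition H1_edgewise G (f : gfun G) : Prop := forall e, in_H1 (len e) (f e).
Definition H2_edgewise G (f : gfun G) : Prop := forall e, in_H2 (len e) (f e).

Definition vertex_value G (f : gfun G) (v : vertex G) (c : R[i]) : Prop :=
  forall e, (src e = v -> trace (len e) (f e) 0 = c) /\
            (tgt e = v -> trace (len e) (f e) (len e) = c).

Definition H1_graph G (f : gfun G) : Prop :=
  H1_edgewise f /\ forall v, exists c, vertex_value f v c.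

Definition normal_derivative G (f : gfun G) (v : vertex G) : R[i] :=
  \sum_(e | tgt e == v)
     trace (len e) (weak_derivative (len e) (f e)) (len e)
  - \sum_(e | src e == v)
     trace (len e) (weak_derivative (len e) (f e)) 0.

(* An operator in L^2 is given by its graph: [T f h] reads "f belongs to
   dom T and T f = h", where f and h represent classes in L^2. *)
Definition operator G := gfun G -> gfun G -> Prop.

Definition dom G (T : operator G) : set (gfun G) := [set f | exists h, T f h].

Definition ker G (T : operator G) : set (gfun G) := [set f | T f (fun _ _ => 0)].

Definition adjoint G (T : operator G) : operator G := fun g h =>
  [/\ L2_graph g, L2_graph h &
      forall f k, T f k -> inner k g = inner f h].

Definition krein_von_neumann G (T : operator G) : operator G := fun f h =>
  adjoint T f h /\
  exists f0 g, [/\ dom T f0, ker (adjoint T) g &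
                   gaeq f (fun e x => f0 e x + g e x)].

Definition eigenspace G (T : operator G) (t : R) : set (gfun G) :=
  [set f | T f (fun e x => t%:C * f e x)].

(* Dimension over the complex numbers, modulo almost everywhere equality. *)
Definition has_dim G (P : set (gfun G)) (n : nat) : Prop :=
  exists b : 'I_n -> gfun G,
  [/\ forall i, P (b i),
      forall c : 'I_n -> R[i],
        gaeq (fun e x => \sum_i c i * b i e x) (fun _ _ => 0) ->
        forall i, c i = 0 &
      forall f, P f -> exists c : 'I_n -> R[i],
        gaeq f (fun e x => \sum_i c i * b i e x)].

(* lam 1 <= lam 2 <= ... enumerates the eigenvalues of T belonging to I, each
   repeated according to its multiplicity; lam 0 is unused. *)
Definition lists_eigenvalues_in G (T : operator G) (I : set R) (lam : nat -> R) :
    Prop :=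
  [/\ forall i j, (0 < i <= j)%N -> lam i <= lam j,
      forall j, (0 < j)%N -> I (lam j) &
      forall t, I t -> exists n,
        has_dim (eigenspace T t) n /\
        [set j | (0 < j)%N /\ lam j = t] #= `I_n].

Definition lists_eigenvalues G (T : operator G) : (nat -> R) -> Prop :=
  lists_eigenvalues_in T setT.

Definition lists_positive_eigenvalues G (T : operator G) : (nat -> R) -> Prop :=
  lists_eigenvalues_in T [set t | 0 < t].

Definition minimal_operator G (q : edge G -> R -> R) : operator G := fun f h =>
  [/\ H2_edgewise f, H1_graph f,
      forall v, vertex_value f v 0 /\ normal_derivative f v = 0,
      L2_graph h &
      gaeq h (fun e x =>
        - weak_derivative (len e) (weak_derivative (len e) (f e)) x
        + (q e x)%:C * f e x)].

Definition krein_laplacian G (q : edge G -> R -> R) : operator G :=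
  krein_von_neumann (minimal_operator q).

End Graph.

(* Main.v *)
From HB Require Import structures.
From mathcomp Require Import all_boot all_order all_algebra.
From mathcomp Require Import ring lra zify.
From mathcomp Require Import complex.
From mathcomp Require Import all_classical all_reals all_analysis.
From mathcomp Require Import measurable_realfun.
Require Import Defs.

(** Let S be the minimal operator. An eigenfunction f of its Krein-von Neumann
extension for an eigenvalue t <> 0 is u + g with u in dom S and S* g = 0, so
t f = S* f = S u: the eigenfunction is determined by u. Pairing with S v for v
in dom S gives <S u, S v> = t <f, S v> = t <S* f, v> = t <S u, v>. Hence the
nonzero eigenvalues are those of the pencil formed by the two forms
b(u, v) = <S u, S v> and a(u, v) = <S u, v> on dom S, the buckling problem
([eigenspaceP]). Both forms are the same for a graph and for the glued graph;
only dom S changes. A function of dom S vanishes at every vertex, so gluing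
does not affect its continuity: dom S is cut out of the functions that vanish
at all edge ends by one Kirchhoff functional per vertex, and gluing replaces
the k + 1 functionals of the glued vertices by their sum ([clamped_glue]).
Therefore dom S has codimension at most k in the domain for the glued graph,
and Courant-Fischer comparison of the pencil on the two spaces gives the
interlacing of the positive eigenvalues ([eigenvalue_interlacing],
[positive_interlacing]).

The comparison needs the minimum of b/a on a subspace of finite codimension to
be attained ([minimum_attained]). This holds because b is complete
([bform_complete]) and a is bounded by a small multiple of b plus finitely
many squares of bounded functionals ([aform_compact]): the derivative of u is
Hoelder continuous, hence controlled by its values at the points of a mesh.

The eigenvalue 0 is handled by dimension. The kernel of S* consists of the
solutions of g'' = q g on the edges that are continuous at the vertices. Since
q >= 0, such a solution exists and is unique for every choice of vertex values,
so the kernel has dimension V ([kernel_dim]). There are no negative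
eigenvalues, so listing all eigenvalues amounts to putting V zeros in front of
the positive ones, and V - k zeros for the glued graph; the second chain of
inequalities is the first one after these shifts ([interlacing]).

Three reductions support this. A function u of dom S is represented by its
second derivative w, which ranges over a vector space of square-integrable
families, and u is recovered from w and its zero end values ([dir0]). As q is
real, all conditions separate into real and imaginary parts, and a complex
basis of an eigenspace yields a real one of the same size
([eigenspace_basis]). Finally q may be replaced by an almost everywhere equal
Borel function with values in a bounded interval ([borel_version]), since the
operators depend only on the class of q.

Sobolev functions enter through their representatives F(x) = F(0) + int_0^x f
with f square-integrable ([AC]); the lemmas [weak_deriv_AC] and
[du_bois_reymond2] provide them, from weak derivatives and from membership in
the domain of S*. *)

Set Implicit Arguments.
Unset Strict Implicit.
Unset Printing Implicit Defensive.

Import Order.TTheory GRing.Theory Num.Theory.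
Import numFieldNormedType.Exports.

Local Open Scope classical_set_scope.
Local Open Scope ring_scope.

(** * Minima of a quotient of quadratic forms *)

Section PsdForm.
Context {R : realType} {Y : lmodType R}.
Implicit Types (a b : Y -> Y -> R) (l : Y -> R) (u v w : Y).

Definition psd_form a : Prop :=
  [/\ forall u v, a u v = a v u, forall v, scalar (a ^~ v) &
      forall u, 0 <= a u u].

Lemma scalar_form0 l : scalar l -> l 0 = 0.
Proof. by move=> h; have := h 1 0 0; rewrite scaler0 addr0 mul1r; lra. Qed.

Lemma scalar_formD l : scalar l -> forall u v, l (u + v) = l u + l v.
Proof. by move=> h u v; rewrite -[u]scale1r h scale1r mul1r. Qed.

Lemma scalar_formZ l : scalar l -> forall k u, l (k *: u) = k * l u.
Proof. by move=> h k u; rewrite -[k *: u]addr0 h scalar_form0// addr0. Qed.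

Lemma scalar_formB l : scalar l -> forall u v, l (u - v) = l u - l v.
Proof.
by move=> h u v; rewrite scalar_formD// -scaleN1r scalar_formZ// mulN1r.
Qed.

Lemma scalar_form_sum l (I : finType) (F : I -> Y) :
  scalar l -> l (\sum_i F i) = \sum_i l (F i).
Proof.
move=> h; elim/big_ind2 : _ => [|x1 x2 y1 y2 <- <-|//].
  exact: scalar_form0.
exact: scalar_formD.
Qed.

Section OneForm.
Variable a : Y -> Y -> R.
Hypothesis pa : psd_form a.

Lemma psdC u v : a u v = a v u. Proof. by case: pa. Qed.
Lemma psd_scalarl v : scalar (a ^~ v). Proof. by case: pa. Qed.
Lemma psd_scalarr u : scalar (a u).
Proof. by move=> k x y; rewrite !(psdC u); apply: psd_scalarl. Qed.
Lemma psd_ge0 u : 0 <= a u u. Proof. by case: pa. Qed.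

Lemma psdDl u v w : a (u + v) w = a u w + a v w.
Proof. exact: (scalar_formD (psd_scalarl w)). Qed.
Lemma psdBl u v w : a (u - v) w = a u w - a v w.
Proof. exact: (scalar_formB (psd_scalarl w)). Qed.
Lemma psdZl k u w : a (k *: u) w = k * a u w.
Proof. exact: (scalar_formZ (psd_scalarl w)). Qed.
Lemma psdDr u v w : a u (v + w) = a u v + a u w.
Proof. exact: (scalar_formD (psd_scalarr u)). Qed.
Lemma psdBr u v w : a u (v - w) = a u v - a u w.
Proof. exact: (scalar_formB (psd_scalarr u)). Qed.
Lemma psdZr k u w : a u (k *: w) = k * a u w.
Proof. exact: (scalar_formZ (psd_scalarr u)). Qed.
Lemma psd_suml (I : finType) (F : I -> Y) v : a (\sum_i F i) v = \sum_i a (F i) v.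
Proof. exact: (scalar_form_sum _ (psd_scalarl v)). Qed.
Lemma psd_sumr (I : finType) (F : I -> Y) u : a u (\sum_i F i) = \sum_i a u (F i).
Proof. exact: (scalar_form_sum _ (psd_scalarr u)). Qed.

(** A null vector of a nonnegative form is orthogonal to everything: otherwise
the form would be negative far along the line through v in the direction of u. *)
Lemma psd_diag0l u v : a u u = 0 -> a u v = 0.
Proof.
move=> u0; apply/eqP; apply/negPn/negP => uv0.
have := psd_ge0 (v - ((a v v + 1) / (2 * a u v)) *: u).
rewrite psdBl !psdBr !psdZl !psdZr u0 (psdC v u).
rewrite [leRHS](_ : _ = -1); first by rewrite ler0N1.
by field; rewrite uv0.
Qed.

Lemma psd_diag0r u v : a v v = 0 -> a u v = 0.
Proof. by move=> v0; rewrite psdC psd_diag0l. Qed.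

Lemma psd_parallelogram u v : a (u - v) (u - v) <= 2 * a u u + 2 * a v v.
Proof.
have := psd_ge0 (u + v).
rewrite psdBl !psdBr psdDl !psdDr (psdC v u); lra.
Qed.

Lemma psd_split u v : a u u <= 2 * a v v + 2 * a (u - v) (u - v).
Proof.
have := psd_ge0 (u - v *+ 2); rewrite mulr2n.
rewrite !psdBl !psdBr !psdDl !psdDr (psdC v u); lra.
Qed.

Lemma psd_cauchy_schwarz u v : a u v ^+ 2 <= a u u * a v v.
Proof.
have [v0|v0] := eqVneq (a v v) 0; first by rewrite psd_diag0r// v0 expr0n/= mulr0.
have vp : 0 < a v v by rewrite lt_def v0 psd_ge0.
have := psd_ge0 (a v v *: u - a u v *: v).
rewrite psdBl !psdBr !psdZl !psdZr (psdC v u) => h.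
have {}h : 0 <= a v v * (a u u * a v v - a u v ^+ 2) by nra.
by rewrite pmulr_rge0// subr_ge0 in h.
Qed.

End OneForm.
End PsdForm.

Section AttainedMinimum.
Context {R : realType} {Y : lmodType R}.
Implicit Types (u v w : Y).

(** For a Hilbert norm b this says that the embedding of b into a is compact;
it is the only form of compactness that the minimization uses, and it can be
checked by sampling. *)
Definition compact_form (a b : Y -> Y -> R) : Prop :=
  forall eps : R, 0 < eps -> exists (I : finType) (l : I -> Y -> R) (K : R),
    [/\ forall i, scalar (l i), forall i u, l i u ^+ 2 <= K * b u u &
        forall u, a u u <= eps * b u u + \sum_i l i u ^+ 2].

(** Completeness along geometrically fast Cauchy sequences, which is what a
subsequence argument produces and what the Riesz-Fischer theorem handles
directly. *)
Definition complete_form (b : Y -> Y -> R) : Prop :=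
  forall u : nat -> Y,
    (forall k, b (u k.+1 - u k) (u k.+1 - u k) <= 4^-1 ^+ k) ->
    exists v, forall eps : R, 0 < eps ->
      exists N, forall k, (N <= k)%N -> b (u k - v) (u k - v) <= eps.

Lemma fmap_ultra_filter (T U : Type) (F : set_system T) (UF : UltraFilter F)
  (f : T -> U) : UltraFilter (f @ F).
Proof.
split=> [|G GF FG]; first exact: fmap_proper_filter.
rewrite eqEsubset; split => // A GA.
have [//|FA] := in_ultra_setVsetC (f @^-1` A) UF.
have GC : G (~` A) by apply: FG.
by have /filter_ex[? []] : G (A `&` ~` A) by apply: filterI.
Qed.

(** Along an ultrafilter every bounded real sequence converges. This replaces
the successive extraction of subsequences for finitely many functionals at
once. *)
Lemma ultra_bounded_cauchy (F : set_system nat) (UF : UltraFilter F)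
    (s : nat -> R) (M : R) :
  (forall n, s n ^+ 2 <= M) -> forall eps : R, 0 < eps ->
  exists2 A, F A & forall m n, A m -> A n -> (s m - s n) ^+ 2 <= eps.
Proof.
move=> sM eps eps0.
have M0 : 0 <= M by apply: le_trans (sM 0%N); rewrite sqr_ge0.
have := @segment_compact R (- (M + 1)) (M + 1).
rewrite compact_ultra => /(_ (s @ F) (fmap_ultra_filter UF s)).
case.
  have sb n : s n \in `[- (M + 1), M + 1].
    by have := sM n; rewrite in_itv/= => ?; apply/andP; split; nra.
    apply: (@filterS _ F _ setT); [by move=> n _; exact: sb|exact: filterT].
move=> p [_ sp].
have e1 : 0 < Num.min 1 (eps / 4).
  by rewrite lt_min ltr01/= divr_gt0.
set e := Num.min _ _ in e1.
exists (s @^-1` [set y | `|p - y| < e]).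
  by apply: sp; apply: nbhsx_ballx.
have e2 : e <= 1 by rewrite /e ge_min lexx.
have e4 : e <= eps / 4 by rewrite /e ge_min lexx orbT.
move=> m n /= /ltr_normlP[h1 h2] /ltr_normlP[h3 h4].
have : `|s m - s n| <= 2 * e by rewrite ler_norml; apply/andP; split; lra.
move=> h; rewrite -real_normK ?num_real//.
have : 0 <= `|s m - s n| by [].
nra.
Qed.

Variables a b : Y -> Y -> R.
Hypotheses (pa : psd_form a) (pb : psd_form b).
Hypothesis ab : exists2 C, 0 < C & forall u, a u u <= C * b u u.
Hypothesis cpt : compact_form a b.
Hypothesis cpl : complete_form b.

(** A bounded minimizing sequence has a fast Cauchy subsequence: the
hypothesis on b (u m - u n) bounds b by mu * a up to vanishing defects,
compactness bounds a by a small multiple of b plus finitely many functionals,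
and those converge along an ultrafilter. *)
Lemma rapid_subsequence (u : nat -> Y) (M : R) (c : nat -> R) :
  (forall n, b (u n) (u n) <= M) ->
  (forall eps : R, 0 < eps -> exists N, forall n, (N <= n)%N -> c n <= eps) ->
  forall mu : R, 0 <= mu ->
  (forall m n, b (u m - u n) (u m - u n)
     <= mu * a (u m - u n) (u m - u n) + 2 * c m + 2 * c n) ->
  exists f : nat -> nat, (forall k, (k <= f k)%N) /\
    forall k, b (u (f k.+1) - u (f k)) (u (f k.+1) - u (f k)) <= 4^-1 ^+ k.
Proof.
move=> uM c0 mu mu0 buv.
have [F [UF infF]] := ultraFilterLemma (@eventually_filter).
have step k : exists2 A, F A &
    forall m n, A m -> A n -> b (u m - u n) (u m - u n) <= 4^-1 ^+ k.
  have p4 : 0 < (4^-1 : R) ^+ k by rewrite exprn_gt0.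
  set e := _ ^+ k in p4 *.
  have [N Nc] := c0 (e / 16) ltac:(by rewrite divr_gt0).
  (* d and d2 are chosen so that the b-part and the functional part of
     mu * a each contribute at most e / 4. *)
  pose d := e / (16 * (mu + 1) * (M + 1)).
  have M0 : 0 <= M by apply: le_trans (uM 0%N); apply: psd_ge0.
  have d0 : 0 < d by rewrite divr_gt0// !mulr_gt0//; lra.
  have [J [l [K [ls lK al]]]] := cpt d0.
  pose n := #|J|.
  pose d2 := e / (4 * (mu + 1) * (n%:R + 1)).
  have n0 : 0 <= n%:R :> R by [].
  have d20 : 0 < d2 by rewrite divr_gt0// !mulr_gt0//; lra.
  have lim i : exists2 A, F A & forall p q, A p -> A q -> (l i (u p) - l i (u q)) ^+ 2 <= d2.
    apply: (@ultra_bounded_cauchy F UF (fun p => l i (u p)) (`|K| * M)) => // p.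
    apply: le_trans (lK _ _) _.
    apply: (le_trans (y := `|K| * b (u p) (u p))).
      by apply: ler_wpM2r; [apply: psd_ge0|apply: ler_norm].
    by apply: ler_wpM2l.
  have [A FA] := choice (fun i => let: ex_intro2 A p q := lim i in
     ex_intro (fun A => F A /\ forall p q, A p -> A q -> (l i (u p) - l i (u q)) ^+ 2 <= d2) A (conj p q)).
  exists ([set p | (N <= p)%N] `&` [set p | forall i, A i p]).
    apply: filterI; first by apply: infF; exists N.
    by apply: filter_forall => i; case: (FA i).
  move=> p q [Np Ap] [Nq Aq]; apply: le_trans (buv _ _) _.
  have ha : a (u p - u q) (u p - u q) <= d * (4 * M) + n%:R * d2.
    apply: le_trans (al _) _; apply: lerD.
      apply: ler_wpM2l; first exact: ltW.
      apply: le_trans (psd_parallelogram pb _ _) _.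
      have := uM p; have := uM q; lra.
    apply: (le_trans (y := \sum_(i : J) d2)).
      apply: ler_sum => i _; rewrite scalar_formB//.
      by case: (FA i) => _ h; apply: h.
    by rewrite sumr_const mulr_natl.
  have h1 : mu * (d * (4 * M)) <= e / 4.
    have -> : mu * (d * (4 * M)) = e / 4 * ((mu / (mu + 1)) * (M / (M + 1))).
      rewrite /d; field; apply/andP; split; apply: lt0r_neq0; lra.
    rewrite -[leRHS]mulr1; apply: ler_wpM2l; first lra.
    apply: mulr_ile1.
    - by rewrite divr_ge0//; lra.
    - by rewrite divr_ge0//; lra.
    - by rewrite ler_pdivrMr; lra.
    - by rewrite ler_pdivrMr; lra.
  have h2 : mu * (n%:R * d2) <= e / 4.
    have -> : mu * (n%:R * d2) = e / 4 * ((mu / (mu + 1)) * (n%:R / (n%:R + 1))).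
      rewrite /d2; field; apply/andP; split; apply: lt0r_neq0; lra.
    rewrite -[leRHS]mulr1; apply: ler_wpM2l; first lra.
    apply: mulr_ile1.
    - by rewrite divr_ge0//; lra.
    - by rewrite divr_ge0//; lra.
    - by rewrite ler_pdivrMr; lra.
    - by rewrite ler_pdivrMr; lra.
  have h3 := ler_wpM2l mu0 ha; rewrite mulrDr in h3.
  have := Nc _ Np; have := Nc _ Nq; lra.
have [A FA] := choice (fun i => let: ex_intro2 A p q := step i in
     ex_intro (fun A => F A /\ forall m n, A m -> A n -> b (u m - u n) (u m - u n) <= 4^-1 ^+ i) A (conj p q)).
have ne k : exists m, [/\ (k <= m)%N & forall i, (i <= k)%N -> A i m].
  have : F ([set p | (k <= p)%N] `&` [set p | forall i : 'I_k.+1, A i p]).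
    apply: filterI; first by apply: infF; exists k.
    by apply: filter_forall => i; case: (FA i).
  move=> /filter_ex[m [km Am]]; exists m; split => // i ik.
  exact: (Am (Ordinal (ik : (i < k.+1)%N))).
have [f fP] := choice ne.
exists f; split => [k|k]; first by case: (fP k).
have [_ h] := FA k; apply: h; first by case: (fP k.+1) => _; apply.
by case: (fP k) => _; apply.
Qed.

(** The minimum of b/a under finitely many bounded constraints is attained,
and a minimizer is an eigenvector: the form b - mu * a is nonnegative on the
constrained space and vanishes at y, so y is a null vector of it. *)
Lemma minimum_attained (I : finType) (l : I -> Y -> R) (K L : R) (u0 : Y) :
  (forall i, scalar (l i)) -> (forall i u, l i u ^+ 2 <= K * b u u) ->
  (forall i, l i u0 = 0) -> 0 < a u0 u0 -> b u0 u0 <= L * a u0 u0 ->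
  exists mu y, [/\ 0 < mu <= L, forall i, l i y = 0, 0 < a y y &
    forall v, (forall i, l i v = 0) -> b y v = mu * a y v].
Proof.
move=> ls lK lu0 au0 bu0.
pose D u := forall i, l i u = 0.
have Ea := (psdBl pa, psdBr pa, psdDl pa, psdDr pa, psdZl pa, psdZr pa).
have Eb := (psdBl pb, psdBr pb, psdDl pb, psdDr pb, psdZl pb, psdZr pb).
have DB u v : D u -> D v -> D (u - v).
  by move=> Du Dv i; rewrite scalar_formB// Du Dv subrr.
have DZ k u : D u -> D (k *: u) by move=> Du i; rewrite scalar_formZ// Du mulr0.
have DD u v : D u -> D v -> D (u + v).
  by move=> Du Dv i; rewrite scalar_formD// Du Dv addr0.
pose Q := [set b u u / a u u | u in [set u | D u /\ 0 < a u u]].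
have Q0 : Q (b u0 u0 / a u0 u0) by exists u0.
have [C C0 aC] := ab.
have Qlb : lbound Q C^-1.
  move=> _ [u [_ au] <-]; rewrite ler_pdivlMr// mulrC ler_pdivrMr// mulrC.
  exact: aC.
have hQ : has_inf Q by split; [exists (b u0 u0 / a u0 u0)|exists C^-1].
pose mu := inf Q.
have muC : C^-1 <= mu by apply: lb_le_inf; [exists (b u0 u0 / a u0 u0)|].
have mu0 : 0 < mu by apply: lt_le_trans muC; rewrite invr_gt0.
have muL : mu <= L.
  apply: (le_trans (y := b u0 u0 / a u0 u0)).
    by apply: ge_inf => //; case: hQ.
  by rewrite ler_pdivrMr.
have muD u : D u -> mu * a u u <= b u u.
  move=> Du; have := psd_ge0 pa u; rewrite le_eqVlt => /orP[/eqP<-|au].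
    by rewrite mulr0; apply: psd_ge0.
  rewrite -ler_pdivlMr//; apply: ge_inf; first by case: hQ.
  by exists u.
have seq (n0 : nat) : exists u, [/\ D u, a u u = 1 & b u u <= mu + n0.+1%:R^-1].
  have [||_ [u [Du au] <-] uQ] := @inf_adherent _ Q (n0.+1%:R^-1) => //.
  have s2 : Num.sqrt (a u u) ^+ 2 = a u u by rewrite sqr_sqrtr// ltW.
  have s0 : Num.sqrt (a u u) != 0 by rewrite gt_eqF// sqrtr_gt0.
  exists ((Num.sqrt (a u u))^-1 *: u); split; first exact: DZ.
    by rewrite !Ea -{3}s2; field.
  rewrite !Eb; apply/ltW; apply: le_lt_trans uQ.
  rewrite le_eqVlt; apply/orP; left; apply/eqP.
  by rewrite -{3}s2; field.
have [u uP] := choice seq.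
have uD m : D (u m) by case: (uP m).
pose c (v : Y) := b v v - mu * a v v.
have cn m : c (u m) <= m.+1%:R^-1.
  by rewrite /c; case: (uP m) => _ -> h; rewrite mulr1 lerBlDl.
have c0 eps : 0 < eps -> exists N, forall m, (N <= m)%N -> c (u m) <= eps.
  move=> e0; exists (Num.truncn eps^-1) => m Nm; apply: le_trans (cn m) _.
  rewrite invf_ple ?posrE//.
  apply: le_trans (ltW (truncnS_gt _)) _.
  by rewrite ler_nat.
(* parallelogram law for the nonnegative form b - mu * a *)
have cpar v w : D v -> D w -> c (v - w) <= 2 * c v + 2 * c w.
  move=> Dv Dw; have := muD (v + w) (DD _ _ Dv Dw); rewrite /c.
  rewrite !Ea !Eb (psdC pa w v) (psdC pb w v); lra.
have bM m : b (u m) (u m) <= mu + 1.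
  case: (uP m) => _ _ h; apply: le_trans h _.
  rewrite lerD2l invf_le1//; first by rewrite ler1n.
have [|f [fk fb]] := @rapid_subsequence u (mu + 1) (fun m => c (u m)) bM c0 mu (ltW mu0).
  move=> p q; have := cpar (u p) (u q) (uD p) (uD q); rewrite {1}/c; lra.
have [y yP] := cpl fb.
have Dy : D y.
  move=> i; apply/eqP; rewrite -sqrf_eq0; apply/eqP.
  apply: le_anti; rewrite sqr_ge0 andbT; apply/ler_addgt0Pr => z z0; rewrite add0r.
  have Kp : 0 < `|K| + 1 by rewrite ltr_wpDl.
  have [N NP] := yP (z / (`|K| + 1)) ltac:(by rewrite divr_gt0).
  have := lK i (u (f N) - y); rewrite scalar_formB// uD sub0r sqrrN => h.
  apply: le_trans h _.
  have Kb w : K * b w w <= (`|K| + 1) * b w w.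
    apply: ler_wpM2r; first exact: psd_ge0.
    by have := ler_norm K; lra.
  apply: le_trans (Kb _) _; rewrite -ler_pdivlMl// mulrC; exact: NP.
have cy eps : 0 < eps -> c y <= eps.
  move=> e0; have [N1 N1P] := c0 (eps / 4) ltac:(by rewrite divr_gt0).
  have [N2 N2P] := yP (eps / 4) ltac:(by rewrite divr_gt0).
  pose m := maxn N1 N2.
  have := N1P (f m) ltac:(by apply: leq_trans (fk _); rewrite leq_maxl).
  have := N2P m ltac:(by rewrite leq_maxr).
  have := cpar (u (f m)) (u (f m) - y) (uD _) (DB _ _ (uD _) Dy).
  rewrite subKr; have := psd_ge0 pa (u (f m) - y).
  rewrite {3}/c; nra.
have {}cy : c y = 0.
  apply: le_anti; rewrite /c subr_ge0 muD// andbT.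
  by apply/ler_addgt0Pr => z z0; rewrite add0r; exact: cy.
have ay : 0 < a y y.
  have [N NP] := yP ((4 * C)^-1) ltac:(by rewrite invr_gt0 mulr_gt0).
  have := psd_split pa (u (f N)) y; case: (uP (f N)) => _ -> _.
  have := aC (u (f N) - y); have := NP N (leqnn N).
  move=> h1 h2; have := ler_wpM2l (ltW C0) h1.
  have -> : C * (4 * C)^-1 = 4^-1 by field; exact: lt0r_neq0.
  lra.
exists mu, y; split => // [|v Dv]; first by rewrite mu0.
apply/eqP; rewrite -subr_eq0; apply/negPn/negP => d0.
set d := b y v - mu * a y v in d0.
pose s := (c v + 1) / (2 * d).
have := muD (v - s *: y) (DB _ _ Dv (DZ _ _ Dy)).
rewrite !Ea !Eb (psdC pa v) (psdC pb v) => h.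
have : 0 <= c v - 2 * (s * d) + s ^+ 2 * c y by move: h; rewrite /c /d; nra.
rewrite cy mulr0 addr0.
have -> : 2 * (s * d) = c v + 1 by rewrite /s; field.
by rewrite opprD addrA subrr sub0r ler0N1.
Qed.
End AttainedMinimum.

(** * Min-max and interlacing for a pencil of forms *)

Section Annihilation.
Context {F : fieldType}.

Lemma exists_annihilating_combination m p (M : 'I_m -> 'I_p -> F) :
  (p < m)%N ->
  exists2 c : 'I_m -> F, exists i, c i != 0 &
    forall j, \sum_i c i * M i j = 0.
Proof.
move=> pm; pose A := \matrix_(i, j) M i j.
have /rowV0Pn[x xA x0] : kermx A != 0.
  rewrite -mxrank_eq0 mxrank_ker subn_eq0 -ltnNge.
  by apply: leq_ltn_trans (rank_leq_col _) pm.
exists (fun i => x ord0 i).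
  by move/rV0Pn: x0.
move=> j; have /sub_kermxP/matrixP/(_ ord0 j) := xA.
rewrite !mxE => h; rewrite -[RHS]h; apply: eq_bigr => i _.
by rewrite !mxE.
Qed.

(** The left kernel of a matrix with m + k rows and k columns has dimension at
least m; the rows of K are m independent vectors in it. *)
Lemma exists_annihilating_space m k (M : 'I_(m + k) -> 'I_k -> F) :
  exists2 K : 'I_m -> 'I_(m + k) -> F,
    forall c : 'I_m -> F, (forall j, \sum_i c i * K i j = 0) -> forall i, c i = 0 &
    forall i j, \sum_l K i l * M l j = 0.
Proof.
pose A := \matrix_(i, j) M i j.
set B := row_base (kermx A).
have mr : (m <= \rank (kermx A))%N.
  rewrite mxrank_ker leq_subRL; last first.
    by apply: leq_trans (rank_leq_col _) (leq_addl _ _).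
  by rewrite addnC leq_add2l rank_leq_col.
pose K : 'M[F]_(m, m + k) := pid_mx m *m B.
have BA : B *m A = 0 by apply/sub_kermxP; rewrite eq_row_base.
exists (fun i j => K i j) => [c cK|i j].
  have Kf : row_free K.
    by rewrite /row_free mxrankMfree ?row_base_free// rank_pid_mx.
  have /eqP : (\row_i c i) *m K = 0 *m K.
    rewrite mul0mx; apply/rowP => j; rewrite !mxE -[RHS](cK j).
    by apply: eq_bigr => i _; rewrite !mxE.
  rewrite -subr_eq0 -mulmxBl subr0 mulmx_free_eq0// => /eqP/rowP + i => /(_ i).
  by rewrite !mxE.
have /matrixP/(_ i j) : K *m A = 0 by rewrite -mulmxA BA mulmx0.
rewrite !mxE => h; rewrite -[RHS]h; apply: eq_bigr => l _.
by rewrite !mxE.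
Qed.

End Annihilation.

Section Pencil.
Context {R : realType} {Y : lmodType R}.
Variables a b : Y -> Y -> R.
Hypotheses (pa : psd_form a) (pb : psd_form b).
Implicit Types (D : set Y).

(** Weak form on D, so that eigenvectors of a constrained pencil need no
operator. *)
Definition eigenvector D (t : R) (y : Y) : Prop :=
  D y /\ forall v, D v -> b y v = t * a y v.

(** Linear independence modulo the null vectors of a. The forms are defined on
functions, and functions equal almost everywhere are not identified. *)
Definition independent_mod (m : nat) (W : 'I_m -> Y) : Prop :=
  forall c : 'I_m -> R,
    a (\sum_i c i *: W i) (\sum_i c i *: W i) = 0 -> forall i, c i = 0.

(** The subspaces of the min-max principle: dimension m, with b/a at most L. *)
Definition test_space D (m : nat) (L : R) : Prop :=
  exists W : 'I_m -> Y, [/\ forall i, D (W i), independent_mod W &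
    forall c : 'I_m -> R, b (\sum_i c i *: W i) (\sum_i c i *: W i)
                        <= L * a (\sum_i c i *: W i) (\sum_i c i *: W i)].

(** A sequence of eigenvectors that misses none: an eigenvector for a positive
eigenvalue orthogonal to all of them is null. *)
Definition eigen_enumeration D (lam : nat -> R) (phi : nat -> Y) : Prop :=
  [/\ forall j, (0 < j)%N -> eigenvector D (lam j) (phi j),
      forall m, independent_mod (fun i : 'I_m => phi i.+1) &
      forall t y, 0 < t -> eigenvector D t y ->
        (forall j, (0 < j)%N -> a y (phi j) = 0) -> a y y = 0].

Lemma eigenvectors_orthogonal D s t x y : s != t ->
  eigenvector D s x -> eigenvector D t y -> a x y = 0.
Proof.
move=> st [Dx hx] [Dy hy]; apply/eqP.
have /eqP : (s - t) * a x y = 0.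
  by rewrite mulrBl -hx// (psdC pa x y) -hy// (psdC pb) subrr.
by rewrite mulf_eq0 subr_eq0 (negbTE st).
Qed.

(** The span of the first m eigenvectors: L * a - b is the square of the
a-norm after weighting the components by the roots of L - lam i, because
components with different eigenvalues are a-orthogonal and those with equal
eigenvalues get equal weights. *)
Lemma eigen_enumeration_test_space D lam phi m L :
  (forall i j, (0 < i <= j)%N -> lam i <= lam j) -> (0 < m)%N ->
  eigen_enumeration D lam phi -> lam m <= L -> test_space D m L.
Proof.
move=> mono m0 [ev ind _] lamL.
exists (fun i : 'I_m => phi i.+1); split => //.
  by move=> i; case: (ev i.+1 isT).
move=> c; set y := \sum_i _.
pose s (i : 'I_m) := Num.sqrt (L - lam i.+1).
have sE (i : 'I_m) : s i ^+ 2 = L - lam i.+1.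
  rewrite sqr_sqrtr// subr_ge0; apply: le_trans lamL.
  by apply: mono; rewrite /= ltn_ord.
pose z := \sum_i (c i * s i) *: phi i.+1.
suff <- : L * a y y - a z z = b y y by rewrite gerBl psd_ge0.
rewrite /y /z !(psd_suml pa) !(psd_suml pb) mulr_sumr -sumrB.
apply: eq_bigr => i _; rewrite !(psd_sumr pa) !(psd_sumr pb) mulr_sumr -sumrB.
apply: eq_bigr => j _.
rewrite !(psdZl pa, psdZr pa) !(psdZl pb, psdZr pb).
have -> : b (phi i.+1) (phi j.+1) = lam i.+1 * a (phi i.+1) (phi j.+1).
  by case: (ev i.+1 isT) => _ -> //; case: (ev j.+1 isT).
have [sij|sij] := eqVneq (lam i.+1) (lam j.+1).
  have -> : s j = s i by rewrite /s sij.
  have <- : L - s i ^+ 2 = lam i.+1 by rewrite sE; lra.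
  by ring.
rewrite (eigenvectors_orthogonal sij (ev i.+1 isT) (ev j.+1 isT)); ring.
Qed.

Hypothesis ab : exists2 C, 0 < C & forall u, a u u <= C * b u u.
Hypothesis cpt : compact_form a b.
Hypothesis cpl : complete_form b.

(** Projection onto the span of phi for a form that may be degenerate. The
Gram system is solvable because a vector annihilated by the Gram matrix gives
a null combination, orthogonal to v as well. *)
Lemma normal_equations m (phi : 'I_m -> Y) (v : Y) :
  exists c : 'I_m -> R,
    forall j, a (v - \sum_i c i *: phi i) (phi j) = 0.
Proof.
pose A := \matrix_(i, j) a (phi i) (phi j).
pose d := \row_j a v (phi j).
have /submxP[x xd] : (d <= A)%MS.
  rewrite submxE; apply/eqP/rowP => j; rewrite mxE [RHS]mxE.
  have := mulmx_coker A; move: (cokermx A) => B cA.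
  set z := \sum_i B i j *: phi i.
  have az i : a (phi i) z = 0.
    have /matrixP/(_ i j) := cA; rewrite !mxE => h; rewrite -[RHS]h.
    rewrite /z (psd_sumr pa); apply: eq_bigr => l _.
    by rewrite mxE (psdZr pa) mulrC.
  have zz : a z z = 0.
    by rewrite {1}/z (psd_suml pa) big1// => i _; rewrite (psdZl pa) az mulr0.
  rewrite -[RHS](psd_diag0r pa v zz) /z (psd_sumr pa).
  by apply: eq_bigr => i _; rewrite mxE (psdZr pa) mulrC.
exists (fun i => x ord0 i) => j.
rewrite (psdBl pa) (psd_suml pa); apply/eqP; rewrite subr_eq0; apply/eqP.
have /matrixP/(_ ord0 j) := xd; rewrite !mxE => ->.
by apply: eq_bigr => i _; rewrite mxE (psdZl pa).
Qed.

Section Constraints.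
Variables (I : finType) (l : I -> Y -> R).
Hypothesis ls : forall i, scalar (l i).
Hypothesis lb : exists K, forall i u, l i u ^+ 2 <= K * b u u.

Let D : set Y := [set y | forall i, l i y = 0].

Lemma constraint_comb m (W : 'I_m -> Y) (c : 'I_m -> R) :
  (forall i, D (W i)) -> D (\sum_i c i *: W i).
Proof.
move=> DW i; rewrite scalar_form_sum// big1// => j _.
by rewrite scalar_formZ// DW mulr0.
Qed.

(** If lam m were larger than L, a vector of the test space orthogonal to the
first m - 1 eigenvectors would have b/a at most L; minimizing b/a under these
orthogonality constraints would then yield an eigenvector for an eigenvalue
below lam m, orthogonal to every phi j, against completeness of the
enumeration. *)
Lemma test_space_eigenvalue_le lam phi m L :
  (forall i j, (0 < i <= j)%N -> lam i <= lam j) -> (0 < m)%N ->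
  eigen_enumeration D lam phi -> test_space D m L -> lam m <= L.
Proof.
move=> mono m0 [ev ind full] [W [DW Wind Wb]].
rewrite leNgt; apply/negP => Lm.
have [c [i0 ci0] c0] := @exists_annihilating_combination R m m.-1
  (fun i j => a (W i) (phi j.+1)) ltac:(by rewrite prednK).
pose u0 := \sum_i c i *: W i.
have Du0 : D u0 by apply: constraint_comb.
have au0 : 0 < a u0 u0.
  rewrite lt_def psd_ge0// andbT; apply/negP => /eqP/Wind/(_ i0) ci.
  by rewrite ci eqxx in ci0.
pose l' (i : (I + 'I_m.-1)%type) (u : Y) : R :=
  match i with inl i => l i u | inr j => a u (phi j.+1) end.
have [C C0 aC] := ab.
have [K lK] := lb.
pose K' := `|K| + \sum_(j < m.-1) C * a (phi j.+1) (phi j.+1).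
have S0 : 0 <= \sum_(j < m.-1) C * a (phi j.+1) (phi j.+1).
  by apply: sumr_ge0 => j _; rewrite mulr_ge0 ?psd_ge0// ltW.
have l's (i : (I + 'I_m.-1)%type) : scalar (l' i).
  by case: i => [i|j]; [exact: ls|exact: (psd_scalarl pa)].
have l'K (i : (I + 'I_m.-1)%type) u : l' i u ^+ 2 <= K' * b u u.
  case: i => [i|j] /=.
    apply: le_trans (lK _ _) _; apply: ler_wpM2r; first exact: psd_ge0.
    by rewrite /K'; have := ler_norm K; lra.
  apply: le_trans (psd_cauchy_schwarz pa _ _) _.
  apply: (le_trans (y := C * b u u * a (phi j.+1) (phi j.+1))).
    by apply: ler_wpM2r; [exact: psd_ge0|exact: aC].
  rewrite mulrAC; apply: ler_wpM2r; first exact: psd_ge0.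
  rewrite /K' (bigD1 j)//= addrCA lerDl addr_ge0// sumr_ge0// => k _.
  by rewrite mulr_ge0 ?psd_ge0// ltW.
have l'u0 (i : (I + 'I_m.-1)%type) : l' i u0 = 0.
  case: i => [i|j] /=; first exact: Du0.
  by rewrite /u0 (psd_suml pa) -[RHS](c0 j); apply: eq_bigr => k _; rewrite psdZl.
have [mu [y [/andP[mu0 muL] l'y ay yv]]] :=
  minimum_attained pa pb ab cpt cpl l's l'K l'u0 au0 (Wb c).
have Dy : D y by move=> i; exact: (l'y (inl i)).
have yphi j : (0 < j < m)%N -> a y (phi j) = 0.
  case/andP; case: j => // j _ jm.
  have jm1 : (j < m.-1)%N by rewrite -ltnS prednK.
  exact: (l'y (inr (Ordinal jm1))).
(* The minimizer is critical only against vectors orthogonal to the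
   phi j; the remaining component of v lies in their span. *)
have evy : eigenvector D mu y.
  split=> // v Dv.
  have [x xP] := normal_equations (fun j : 'I_m.-1 => phi j.+1) v.
  set s := \sum_i _ in xP.
  have ays : a y s = 0.
    rewrite /s (psd_sumr pa) big1// => j _.
    rewrite (psdZr pa) yphi ?mulr0//= -ltn_predRL//.
  have bys : b y s = 0.
    rewrite /s (psd_sumr pb) big1// => j _.
    rewrite (psdZr pb) (psdC pb); case: (ev j.+1 isT) => _ -> //.
    rewrite (psdC pa) yphi ?mulr0//= -ltn_predRL//.
  have Ds : D s by apply: constraint_comb => j; case: (ev j.+1 isT).
  have := yv (v - s); rewrite (psdBr pa) (psdBr pb) ays bys !subr0; apply.
  move=> [i|j] /=; first by rewrite scalar_formB// Dv Ds subrr.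
  exact: xP.
suff a0 : a y y = 0 by rewrite a0 ltxx in ay.
apply: (full mu) => // j j0.
have [jm|mj] := ltnP j m; first by apply: yphi; rewrite j0.
apply: (eigenvectors_orthogonal _ evy (ev _ j0)).
rewrite lt_eqF//; apply: le_lt_trans muL _; apply: lt_le_trans Lm _.
by apply: mono; rewrite m0.
Qed.

End Constraints.

Lemma test_spaceS (D D' : set Y) m L : D `<=` D' ->
  test_space D m L -> test_space D' m L.
Proof. by move=> DD [W [DW Wi Wb]]; exists W; split => // i; apply: DD. Qed.

Lemma test_space_codim (D' : set Y) (k : nat) (l : 'I_k -> Y -> R) m L :
  (forall i, scalar (l i)) ->
  (forall (c : 'I_(m + k) -> R) W, (forall i, D' (W i)) -> D' (\sum_i c i *: W i)) ->
  test_space D' (m + k) L ->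
  test_space [set y | D' y /\ forall i, l i y = 0] m L.
Proof.
move=> ls D'c [W [DW Wi Wb]].
have [K Kf K0] := exists_annihilating_space (fun i j => l j (W i)).
have comb (c : 'I_m -> R) : \sum_i c i *: (\sum_j K i j *: W j) =
    \sum_j (\sum_i c i * K i j) *: W j.
  under eq_bigr => i _ do rewrite scaler_sumr.
  rewrite exchange_big; apply: eq_bigr => j _; rewrite scaler_suml.
  by apply: eq_bigr => i _; rewrite scalerA.
exists (fun i => \sum_j K i j *: W j); split => [i|c|c].
- split=> [|j]; first exact: D'c.
  rewrite scalar_form_sum// -[RHS](K0 i j); apply: eq_bigr => q _.
  by rewrite scalar_formZ.
- by rewrite comb => /Wi h; apply: Kf.
- by rewrite comb.
Qed.

Section Interlacing.
Variables (I I' : finType) (l : I -> Y -> R) (l' : I' -> Y -> R).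
Hypothesis ls : forall i, scalar (l i).
Hypothesis lb : exists K, forall i u, l i u ^+ 2 <= K * b u u.
Hypothesis l's : forall i, scalar (l' i).
Hypothesis l'b : exists K, forall i u, l' i u ^+ 2 <= K * b u u.
Variables (k : nat) (h : 'I_k -> Y -> R).
Hypothesis hs : forall i, scalar (h i).

Let D : set Y := [set y | forall i, l i y = 0].
Let D' : set Y := [set y | forall i, l' i y = 0].

(** A test space for D is one for D', which gives the outer inequalities; a
test space of dimension j + k for D' meets the kernel of the k functionals h
in dimension at least j, which gives the middle one. *)
Theorem eigenvalue_interlacing (lam lam' : nat -> R) (phi phi' : nat -> Y) :
  D = [set y | D' y /\ forall i, h i y = 0] ->
  (forall i j, (0 < i <= j)%N -> lam i <= lam j) ->
  (forall i j, (0 < i <= j)%N -> lam' i <= lam' j) ->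
  eigen_enumeration D lam phi -> eigen_enumeration D' lam' phi' ->
  forall j, (0 < j)%N ->
    [/\ lam' j <= lam j, lam j <= lam' (j + k)%N
      & lam' (j + k)%N <= lam (j + k)%N].
Proof.
move=> DD' mono mono' en en' j j0.
have sub : D `<=` D' by rewrite DD' => y [].
have le m : (0 < m)%N -> lam' m <= lam m.
  move=> m0; apply: (test_space_eigenvalue_le l's l'b mono' m0 en').
  exact: test_spaceS sub (eigen_enumeration_test_space mono m0 en (lexx _)).
have jk0 : (0 < j + k)%N by rewrite addn_gt0 j0.
split; [exact: le| |exact: le].
apply: (test_space_eigenvalue_le ls lb mono j0 en).
rewrite -/D DD'; apply: test_space_codim => //.
  by move=> c W D'W; apply: constraint_comb.
exact: (eigen_enumeration_test_space mono' jk0 en' (lexx _)).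
Qed.

End Interlacing.

End Pencil.

(** * Square-integrable functions on an interval *)

Section Interval.
Context {R : realType}.
Local Notation mu := (@lebesgue_measure R).
Implicit Types (l x y : R) (f g h : R -> R).

Definition mfun_on l f : Prop := measurable_fun (`]0, l[%classic : set R) f.
Definition L1 l f : Prop := mu.-integrable `]0, l[ (EFin \o f).
Definition L2 l f : Prop := mfun_on l f /\ L1 l (fun x => f x ^+ 2).
Definition raeq l f g : Prop := {ae mu, forall x, x \in `]0, l[ -> f x = g x}.
Definition int l f : R := (\int[mu]_(x in `]0%R, l[) f x)%R.

Lemma mO l : measurable (`]0%R, l[%classic : set R).
Proof. exact: measurable_itv. Qed.
#[local] Hint Resolve mO : core.

Lemma L1_mfun l f : L1 l f -> mfun_on l f.
Proof. by move=> /integrableP[/measurable_EFinP]. Qed.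

Lemma L1_dom l f g : mfun_on l f -> (forall x, x \in `]0, l[ -> `|f x| <= g x) ->
  L1 l g -> L1 l f.
Proof.
move=> mf fg; apply: le_integrable => //; first exact/measurable_EFinP.
move=> x Dx /=; rewrite lee_fin; apply: le_trans (fg x Dx) _; exact: ler_norm.
Qed.

Lemma L1D l f g : L1 l f -> L1 l g -> L1 l (fun x => f x + g x).
Proof. by move=> hf hg; have := integrableD _ hf hg; apply. Qed.

Lemma L1Z l k f : L1 l f -> L1 l (fun x => k * f x).
Proof. by move=> hf; have := integrableZl _ k hf; apply. Qed.

Lemma L1_norm l f : L1 l f -> L1 l (fun x => `|f x|).
Proof. exact: integrable_norm. Qed.

Lemma mu_O_lty l : (mu `]0%R, l[%classic < +oo)%E.
Proof.
by rewrite lebesgue_measure_itv/=; case: ifPn => // _; rewrite -EFinB ltry.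
Qed.

Lemma mu_O l : 0 <= l -> fine (mu `]0%R, l[%classic) = l.
Proof.
rewrite le_eqVlt => /predU1P[<-|l0]; rewrite lebesgue_measure_itv/=.
  by rewrite lte_fin ltxx.
by rewrite lte_fin l0 -EFinB subr0.
Qed.

Lemma L1_bounded l f M : mfun_on l f ->
  (forall x, x \in `]0, l[ -> `|f x| <= M) -> L1 l f.
Proof.
move=> mf fM; apply: measurable_bounded_integrable => //; first exact: mu_O_lty.
exists M; split; rewrite ?num_real// => N MN x Dx /=.
exact: le_trans (fM x Dx) (ltW MN).
Qed.

Lemma mfun_cst l c : mfun_on l (fun _ => c).
Proof. exact: measurable_cst. Qed.
Lemma mfunD l f g : mfun_on l f -> mfun_on l g -> mfun_on l (fun x => f x + g x).
Proof. exact: measurable_funD. Qed.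
Lemma mfunB l f g : mfun_on l f -> mfun_on l g -> mfun_on l (fun x => f x - g x).
Proof. exact: measurable_funB. Qed.
Lemma mfunM l f g : mfun_on l f -> mfun_on l g -> mfun_on l (fun x => f x * g x).
Proof. exact: measurable_funM. Qed.
Lemma mfunX l f n : mfun_on l f -> mfun_on l (fun x => f x ^+ n).
Proof. exact: measurable_funX. Qed.

Lemma L1_cst l c : L1 l (fun _ => c).
Proof. by apply: (@L1_bounded _ _ `|c|) => //; exact: mfun_cst. Qed.

Lemma intD l f g : L1 l f -> L1 l g ->
  int l (fun x => f x + g x) = int l f + int l g.
Proof. exact: RintegralD. Qed.
Lemma intB l f g : L1 l f -> L1 l g ->
  int l (fun x => f x - g x) = int l f - int l g.
Proof. exact: RintegralB. Qed.
Lemma intZ l k f : L1 l f -> int l (fun x => k * f x) = k * int l f.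
Proof. exact: RintegralZl. Qed.
Lemma int_cst l c : 0 <= l -> int l (fun _ => c) = c * l.
Proof. by move=> l0; rewrite /int Rintegral_cst// mu_O. Qed.
Lemma eq_int l f g : (forall x, x \in `]0, l[ -> f x = g x) -> int l f = int l g.
Proof. by move=> fg; apply: eq_Rintegral => x; rewrite inE => /fg. Qed.
Lemma int_ge0 l f : (forall x, x \in `]0, l[ -> 0 <= f x) -> 0 <= int l f.
Proof. by move=> f0; apply: Rintegral_ge0 => x /f0. Qed.
Lemma le_int l f g : L1 l f -> L1 l g ->
  (forall x, x \in `]0, l[ -> f x <= g x) -> int l f <= int l g.
Proof. exact: le_Rintegral. Qed.
Lemma le_norm_int l f : L1 l f -> `|int l f| <= int l (fun x => `|f x|).
Proof. exact: le_normr_Rintegral. Qed.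

Lemma ae_imp (P Q : R -> Prop) : (forall x, P x -> Q x) ->
  {ae mu, forall x, P x} -> {ae mu, forall x, Q x}.
Proof. by apply: filterS; exact: (ae_filter_ringOfSetsType mu). Qed.
Lemma ae_imp2 (P P' Q : R -> Prop) : (forall x, P x -> P' x -> Q x) ->
  {ae mu, forall x, P x} -> {ae mu, forall x, P' x} -> {ae mu, forall x, Q x}.
Proof. by apply: filterS2; exact: (ae_filter_ringOfSetsType mu). Qed.
Lemma raeq_refl l f : raeq l f f.
Proof. by apply: aeW => x. Qed.
Lemma raeq_eq l f g : (forall x, x \in `]0, l[ -> f x = g x) -> raeq l f g.
Proof. by move=> fg; apply: aeW => x; exact: fg. Qed.
Lemma raeq_sym l f g : raeq l f g -> raeq l g f.
Proof. by apply: ae_imp => x fg /fg. Qed.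
Lemma raeqM l f f' g g' : raeq l f f' -> raeq l g g' ->
  raeq l (fun x => f x * g x) (fun x => f' x * g' x).
Proof. by apply: ae_imp2 => x fg gh xl; rewrite fg// gh. Qed.

Lemma raeq_int l f g : mfun_on l f -> mfun_on l g -> raeq l f g ->
  int l f = int l g.
Proof.
move=> mf mg fg; congr fine; apply: ae_eq_integral => //.
- exact/measurable_EFinP.
- exact/measurable_EFinP.
- by apply: ae_imp fg => x fg /= /fg ->.
Qed.

Lemma raeq_L1 l f g : mfun_on l g -> raeq l f g -> L1 l f -> L1 l g.
Proof.
move=> mg fg /integrableP[mf fi]; apply/integrableP; split.
  exact/measurable_EFinP.
rewrite (ae_eq_integral _ _ _ _ _ (_ : ae_eq mu _ _ (fun x => `|(EFin \o f) x|%E)))//.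
- by apply: measurableT_comp => //; exact/measurable_EFinP.
- exact: measurableT_comp.
- by apply: ae_imp fg => x fg /= /fg ->.
Qed.

Lemma int_eq0_ae l f : L1 l f -> (forall x, x \in `]0, l[ -> 0 <= f x) ->
  int l f = 0 -> raeq l f (fun _ => 0).
Proof.
move=> hf f0 i0; have mf := L1_mfun hf.
have h : (\int[mu]_(x in `]0%R, l[) `|(EFin \o f) x| = 0)%E.
  transitivity (\int[mu]_(x in `]0%R, l[) (EFin \o f) x)%E.
    by apply: eq_integral => x; rewrite inE => /f0 ?/=; rewrite ger0_norm.
  by rewrite -[LHS]fineK; [rewrite -[fine _]/(int l f) i0|exact: integrable_fin_num].
have /ae_eq_integral_abs := h.
move=> /(_ (mO l)) H; have : ae_eq mu `]0%R, l[%classic (EFin \o f) (cst 0%E).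
  by apply: H; exact/measurable_EFinP.
by apply: ae_imp => x fx /fx [].
Qed.

Lemma L2M l f g : L2 l f -> L2 l g -> L1 l (fun x => f x * g x).
Proof.
move=> [mf f2] [mg g2]; apply: L1_dom (L1D f2 g2); first exact: mfunM.
move=> x _; rewrite normrM -[f x ^+ 2]real_normK ?num_real//.
rewrite -[g x ^+ 2]real_normK ?num_real//.
have := sqr_ge0 (`|f x| - `|g x|); nra.
Qed.

Lemma L2_cst l c : L2 l (fun _ => c).
Proof. by split; [exact: mfun_cst|exact: L1_cst]. Qed.

Lemma L2_L1 l f : L2 l f -> L1 l f.
Proof.
move=> hf; have := L2M hf (L2_cst l 1).
by under eq_fun do rewrite mulr1.
Qed.

Lemma L2Z l k f : L2 l f -> L2 l (fun x => k * f x).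
Proof.
move=> [mf hf]; split; first by apply: mfunM => //; exact: mfun_cst.
by have := L1Z (k ^+ 2) hf; under eq_fun do rewrite -exprMn.
Qed.

Lemma L2D l f g : L2 l f -> L2 l g -> L2 l (fun x => f x + g x).
Proof.
move=> hf hg; have [mf f2] := hf; have [mg g2] := hg; split; first exact: mfunD.
have := L1D (L1D f2 g2) (L1Z 2 (L2M hf hg)).
rewrite (_ : (fun x => _) = (fun x => (f x + g x) ^+ 2))//.
by apply/funext => x; ring.
Qed.

Lemma L2N l f : L2 l f -> L2 l (fun x => - f x).
Proof. by move=> /(L2Z (-1)); under eq_fun do rewrite mulN1r. Qed.

Lemma L2B l f g : L2 l f -> L2 l g -> L2 l (fun x => f x - g x).
Proof. by move=> hf /L2N; apply: L2D. Qed.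

Lemma L2_bounded l f M : mfun_on l f ->
  (forall x, x \in `]0, l[ -> `|f x| <= M) -> L2 l f.
Proof.
move=> mf fM; split=> //; apply: (@L1_bounded _ _ (M ^+ 2)); first exact: mfunX.
by move=> x /fM h; rewrite normrX lerXn2r// ?nnegrE// (le_trans _ h).
Qed.

Lemma L2_mulb l f g M : mfun_on l f ->
  (forall x, x \in `]0, l[ -> `|f x| <= M) -> L2 l g -> L2 l (fun x => f x * g x).
Proof.
move=> mf fM hg; have [mg g2] := hg; split; first exact: mfunM.
apply: L1_dom (L1Z (M ^+ 2) g2); first by apply: mfunX; exact: mfunM.
move=> x /fM h; rewrite normrX normrM exprMn -[g x ^+ 2]real_normK ?num_real//.
by apply: ler_wpM2r; [exact: sqr_ge0|rewrite lerXn2r// ?nnegrE// (le_trans _ h)].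
Qed.

Lemma raeq_L2 l f g : mfun_on l g -> raeq l f g -> L2 l f -> L2 l g.
Proof.
move=> mg fg [mf f2]; split=> //; apply: raeq_L1 f2; first exact: mfunX.
by apply: ae_imp fg => x fg /fg ->.
Qed.

Lemma L2_int_sqr_eq0 l f : L2 l f -> int l (fun x => f x ^+ 2) = 0 ->
  raeq l f (fun _ => 0).
Proof.
move=> [mf f2] /int_eq0_ae-/(_ f2 (fun x _ => sqr_ge0 _)).
by apply: ae_imp => x h /h/eqP; rewrite sqrf_eq0 => /eqP.
Qed.

(** From the nonnegativity of the integral of (s f + t g)^2, quadratic in (s,
t). *)
Lemma L2_cauchy_schwarz l f g : L2 l f -> L2 l g ->
  int l (fun x => f x * g x) ^+ 2
  <= int l (fun x => f x ^+ 2) * int l (fun x => g x ^+ 2).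
Proof.
move=> hf hg.
have q s t : 0 <= s ^+ 2 * int l (fun x => f x ^+ 2)
   + 2 * s * t * int l (fun x => f x * g x) + t ^+ 2 * int l (fun x => g x ^+ 2).
  have h1 := L1Z (s ^+ 2) hf.2; have h2 := L1Z (2 * s * t) (L2M hf hg).
  have h3 := L1Z (t ^+ 2) hg.2.
  rewrite -(intZ (s ^+ 2) hf.2) -(intZ (2 * s * t) (L2M hf hg)) -(intZ (t ^+ 2) hg.2).
  rewrite -intD// -intD//; last exact: L1D.
  apply: int_ge0 => x _.
  by have := sqr_ge0 (s * f x + t * g x); nra.
set F := int l (fun x => f x ^+ 2) in q *; set G := int l (fun x => g x ^+ 2) in q *.
set H := int l _ in q *.
have G0 : 0 <= G by apply: int_ge0 => x _; exact: sqr_ge0.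
have [Gz|Gn] := eqVneq G 0.
  rewrite Gz mulr0; have := q 1 (- (F + 1) / (2 * H)); rewrite Gz mulr0 addr0.
  have [->|Hn] := eqVneq H 0; first by rewrite expr0n.
  rewrite expr1n mul1r mulr1.
  have -> : 2 * (- (F + 1) / (2 * H)) * H = - (F + 1) by field.
  lra.
have Gp : 0 < G by rewrite lt_def Gn.
have := q G (- H); nra.
Qed.

End Interval.
#[export] Hint Resolve mO : core.

(** * Primitives of square-integrable functions *)

Section AbsolutelyContinuous.
Context {R : realType}.
Local Notation mu := (@lebesgue_measure R).
Implicit Types (l x y : R) (f g h F G : R -> R).

(** The functions of H^1 with derivative f, through their continuous
representatives. *)
Definition AC l F f : Prop :=
  L2 l f /\ forall x, x \in `[0, l] -> F x = F 0 + int x f.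

Lemma int0 f : int 0 f = 0.
Proof. by rewrite /int set_itvoo0 Rintegral_set0. Qed.

Lemma int_indic l x f : x <= l -> int x f = int l (fun t => (t < x)%R%:R * f t).
Proof.
move=> xl; rewrite /int.
have -> : `]0%R, x[%classic = `]0%R, l[%classic `&` [set t | t < x].
  apply/seteqP; split => t /=; rewrite !in_itv/=.
    by move=> /andP[-> tx]; rewrite (lt_le_trans tx xl).
  by move=> [/andP[-> _] ->].
rewrite Rintegral_mkcondr; apply: eq_Rintegral => t _.
rewrite patchE; have -> : (t \in [set t0 | t0 < x]) = (t < x) by apply/idP/idP; rewrite inE.
by case: ifP; rewrite ?mul1r ?mul0r.
Qed.

Lemma mfun_indic l x : mfun_on l (fun t => (t < x)%R%:R : R).
Proof.
have -> : (fun t : R => (t < x)%R%:R) = \1_([set` `]-oo, x[]) :> (R -> R).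
  by apply/funext => t; rewrite indicE mem_setE/= in_itv.
apply: measurable_indic; exact: measurable_itv.
Qed.

Lemma L1_indic l x f : L1 l f -> L1 l (fun t => (t < x)%R%:R * f t).
Proof.
move=> hf; apply: L1_dom (L1_norm hf).
  exact: (mfunM (@mfun_indic l x) (L1_mfun hf)).
by move=> t _; rewrite normrM; case: (_ < _); rewrite ?normr1 ?normr0 ?mul1r ?mul0r.
Qed.

Lemma L2_indicB l x y : L2 l (fun t => (t < y)%R%:R - (t < x)%R%:R).
Proof.
apply: (@L2_bounded _ _ _ 1); first by apply: mfunB; apply: mfun_indic.
by move=> t _; do 2 case: (_ < _); rewrite ?subrr ?subr0 ?sub0r ?normrN ?normr1 ?normr0.
Qed.

Lemma L1S l x f : x <= l -> L1 l f -> L1 x f.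
Proof.
move=> xl hf; apply: (integrableS _ _ _ hf); [exact: mO..|].
by move=> t /=; rewrite !in_itv/= => /andP[-> tx]; rewrite (lt_le_trans tx xl).
Qed.

Lemma L2S l x f : x <= l -> L2 l f -> L2 x f.
Proof.
move=> xl [mf f2]; split; last exact: L1S f2.
apply: (measurable_funS _ _ mf); first exact: mO.
by move=> t /=; rewrite !in_itv/= => /andP[-> tx]; rewrite (lt_le_trans tx xl).
Qed.

(** Cauchy-Schwarz against the indicator of the interval between x and y. *)
Lemma int_holder l f x y : L2 l f -> 0 <= x -> x <= y -> y <= l ->
  (int y f - int x f) ^+ 2 <= (y - x) * int l (fun t => f t ^+ 2).
Proof.
move=> hf x0 xy yl; have xl := le_trans xy yl; have l0 := le_trans x0 xl.
rewrite !(int_indic _ yl) (int_indic _ xl).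
rewrite -intB; [|exact/L1_indic/L2_L1..].
under eq_int do rewrite -mulrBl.
apply: le_trans (L2_cauchy_schwarz (L2_indicB l x y) hf) _.
rewrite le_eqVlt; apply/orP; left; apply/eqP; congr (_ * _).
transitivity (int y (fun _ => 1) - int x (fun _ => 1)).
  rewrite (int_indic _ yl) (int_indic _ xl) -intB; [|exact/L1_indic/L1_cst..].
  apply: eq_int => t _; rewrite !mulr1.
  have [tx|tx] := ltP t x; first by rewrite (lt_le_trans tx xy) subrr expr0n.
  by case: (_ < _); rewrite !subr0 ?expr1n ?expr0n.
by rewrite !int_cst ?mul1r// (le_trans x0).
Qed.

Lemma AC_L2 l F f : AC l F f -> L2 l f. Proof. by case. Qed.

Lemma AC_holder l F f x y : AC l F f -> x \in `[0, l] -> y \in `[0, l] ->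
  (F y - F x) ^+ 2 <= `|y - x| * int l (fun t => f t ^+ 2).
Proof.
move=> [hf hF].
wlog xy : x y / x <= y.
  move=> H xl yl; have [xy|/ltW xy] := leP x y; first exact: H.
  by rewrite -sqrrN opprB distrC; apply: H.
move=> xl yl; rewrite (hF x)// (hF y)// ger0_norm ?subr_ge0//.
rewrite opprD addrACA subrr add0r.
move: xl yl; rewrite !in_itv/= => /andP[x0 _] /andP[_ yl].
exact: int_holder.
Qed.

Lemma AC_continuous l F f : AC l F f -> {within `[0, l], continuous F}.
Proof.
move=> hF; apply/subspace_continuousP => x xl.
apply/cvgrPdist_le => /= e e0.
set C := int l (fun t => f t ^+ 2).
have C0 : 0 <= C by apply: int_ge0 => t _; exact: sqr_ge0.
have d0 : 0 < e ^+ 2 / (C + 1) by rewrite divr_gt0 ?exprn_gt0//; lra.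
rewrite near_withinE; near=> y => yl.
have yx : `|x - y| <= e ^+ 2 / (C + 1).
  by near: y; apply: cvgr_dist_le.
rewrite -(@ler_pXn2r _ 2)// ?nnegrE ?(ltW e0)// real_normK ?num_real//.
apply: le_trans (AC_holder hF yl xl) _; rewrite -/C.
apply: le_trans (ler_wpM2r C0 yx) _.
rewrite -mulrA ler_piMr ?sqr_ge0// mulrC ler_pdivrMr; lra.
Unshelve. all: by end_near. Qed.

Lemma continuous_mfun l F : {within `[0, l], continuous F} -> mfun_on l F.
Proof.
move=> cF; apply: (@measurable_funS _ _ _ _ `[0, l]%classic).
- exact: measurable_itv.
- exact: subset_itv_oo_cc.
- by apply: subspace_continuous_measurable_fun => //; exact: measurable_itv.
Qed.

Lemma AC_mfun l F f : AC l F f -> mfun_on l F.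
Proof. by move=> /AC_continuous/continuous_mfun. Qed.

Lemma AC_bound l F f x : AC l F f -> x \in `[0, l] ->
  `|F x| <= `|F 0| + (1 + l * int l (fun t => f t ^+ 2)).
Proof.
move=> hF xl; have l0 : 0 <= l by move: xl; rewrite in_itv/= => /andP[]; exact: le_trans.
have z0 : 0 \in `[0, l] by rewrite in_itv/= lexx.
have := AC_holder hF z0 xl; rewrite subr0.
set C := int l _ => h.
have C0 : 0 <= C by apply: int_ge0 => t _; exact: sqr_ge0.
have {}h : (F x - F 0) ^+ 2 <= l * C.
  apply: le_trans h _; apply: ler_wpM2r => //.
  by move: xl; rewrite in_itv/= => /andP[x0 xl]; rewrite ger0_norm.
have h2 : `|F x - F 0| <= 1 + l * C.
  move: h; rewrite -real_normK ?num_real//; have := normr_ge0 (F x - F 0); nra.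
have := ler_normD (F 0) (F x - F 0); rewrite subrKC; lra.
Qed.

Lemma AC_L2F l F f : AC l F f -> L2 l F.
Proof.
move=> hF; apply: L2_bounded; first exact: AC_mfun hF.
by move=> x xl; apply: (AC_bound hF); exact: subset_itv_oo_cc.
Qed.

Lemma AC_int l f c : L2 l f -> AC l (fun x => c + int x f) f.
Proof. by move=> hf; split => // x _; rewrite int0 addr0. Qed.

Lemma AC_eq l F G f : (forall x, x \in `[0, l] -> F x = G x) -> 0 <= l ->
  AC l F f -> AC l G f.
Proof.
move=> FG l0 [hf hF]; split => // x xl.
have z0 : 0 \in `[0, l] by rewrite in_itv/= lexx.
by rewrite -(FG x xl) -(FG 0 z0); exact: hF.
Qed.

Lemma AC_raeq l F f g : mfun_on l g -> raeq l f g -> AC l F f -> AC l F g.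
Proof.
move=> mg fg [hf hF]; split; first exact: raeq_L2 hf.
move=> x xl; rewrite hF//; congr (_ + _); apply: raeq_int.
- by move: xl; rewrite in_itv/= => /andP[_ xl]; case: (L2S xl hf).
- by move: xl; rewrite in_itv/= => /andP[_ xl]; case: (L2S xl (raeq_L2 mg fg hf)).
- apply: ae_imp fg => t h; rewrite in_itv/= => /andP[t0 tx]; apply: h.
  by move: xl; rewrite !in_itv/= t0 => /andP[_ xl]; rewrite (lt_le_trans tx xl).
Qed.

Lemma AC_cst l c : AC l (fun _ => c) (fun _ => 0).
Proof.
split; first exact: L2_cst.
move=> x; rewrite in_itv/= => /andP[x0 _]; by rewrite int_cst// mul0r addr0.
Qed.

Lemma ACZ l k F f : AC l F f -> AC l (fun x => k * F x) (fun x => k * f x).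
Proof.
move=> [hf hF]; split; first exact: L2Z.
move=> x xl; rewrite hF//; move: xl; rewrite in_itv/= => /andP[_ xl].
by rewrite (intZ k (L2_L1 (L2S xl hf))) mulrDr.
Qed.

Lemma ACD l F f G g : AC l F f -> AC l G g ->
  AC l (fun x => F x + G x) (fun x => f x + g x).
Proof.
move=> [hf hF] [hg hG]; split; first exact: L2D.
move=> x xl; rewrite hF// hG//; move: xl; rewrite in_itv/= => /andP[_ xl].
rewrite (intD (L2_L1 (L2S xl hf)) (L2_L1 (L2S xl hg))); ring.
Qed.

Lemma ACB l F f G g : AC l F f -> AC l G g ->
  AC l (fun x => F x - G x) (fun x => f x - g x).
Proof.
move=> hF /(ACZ (-1)) hG; have := ACD hF hG.
by congr AC; apply/funext => x; rewrite mulN1r.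
Qed.

End AbsolutelyContinuous.

(** * Integration by parts *)

Section Kernel.
Context d1 d2 (T1 : measurableType d1) (T2 : measurableType d2) (R : realType).
Variables (m1 : {sigma_finite_measure set T1 -> \bar R})
          (m2 : {sigma_finite_measure set T2 -> \bar R}).

Lemma integrable_tensor (f : T1 -> R) (g : T2 -> R) :
  m1.-integrable setT (EFin \o f) -> m2.-integrable setT (EFin \o g) ->
  (m1 \x m2)%E.-integrable setT (fun z : T1 * T2 => (f z.1 * g z.2)%:E).
Proof.
move=> hf hg.
have mf : measurable_fun setT f by case/integrableP : hf => /measurable_EFinP.
have mg : measurable_fun setT g by case/integrableP : hg => /measurable_EFinP.
have mfg : measurable_fun setT (fun z : T1 * T2 => (f z.1 * g z.2)%:E).
  apply/measurable_EFinP; apply: measurable_funM.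
    by apply: measurableT_comp mf _; exact: measurable_fst.
  by apply: measurableT_comp mg _; exact: measurable_snd.
apply: (integrable12ltyP _ _ mfg).2.
have nf := integrable_norm hf.
have ng := integrable_norm hg.
have gfin := integrable_fin_num measurableT ng.
rewrite (_ : (fun x => _) =
    (fun x => \int[m2]_y (EFin \o (Num.norm \o g)) y * `|f x|%:E)%E); last first.
  apply/funext => x.
  under eq_integral do rewrite /= normrM EFinM.
  by rewrite ge0_integralZl//= 1?muleC//; apply/measurable_EFinP; exact: measurableT_comp.
move: gfin; set c := integral _ _ _ => gfin.
have /integrableP[_] := integrableZl measurableT (fine c) nf.
rewrite fineK//; apply: le_lt_trans; rewrite le_eqVlt; apply/orP; left; apply/eqP.
apply: eq_integral => x _ /=; rewrite gee0_abs// mule_ge0//.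
by apply: integral_ge0 => y _; rewrite lee_fin normr_ge0.
Qed.

(** Stated for a bounded kernel k so that it applies to the indicator of a
triangle, which turns an iterated integral with variable upper limit into a
double integral. *)
Lemma Rfubini_kernel (f : T1 -> R) (g : T2 -> R) (k : T1 * T2 -> R) :
  m1.-integrable setT (EFin \o f) -> m2.-integrable setT (EFin \o g) ->
  measurable_fun setT k -> (forall z, `|k z| <= 1) ->
  (\int[m1]_x (f x * \int[m2]_y (k (x, y) * g y)) =
   \int[m2]_y ((\int[m1]_x (k (x, y) * f x)) * g y))%R.
Proof.
move=> hf hg mk k1.
have mf : measurable_fun setT f by case/integrableP : hf => /measurable_EFinP.
have mg : measurable_fun setT g by case/integrableP : hg => /measurable_EFinP.
pose H (z : T1 * T2) := (f z.1 * g z.2 * k z)%:E.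
have iH : (m1 \x m2)%E.-integrable setT H.
  have ifg := integrable_tensor hf hg.
  apply: (le_integrable _ _ _ ifg) => //.
    apply/measurable_EFinP; apply: measurable_funM => //.
    by case/integrableP : ifg => /measurable_EFinP.
  by move=> z _; rewrite /H /= lee_fin normrM ler_piMr.
have kg x : m2.-integrable setT (fun y => (k (x, y) * g y)%:E).
  apply: (le_integrable _ _ _ hg) => //.
    apply/measurable_EFinP; apply: measurable_funM => //.
    by apply: (measurableT_comp mk); exact: measurable_pair1.
  by move=> y _; rewrite /= lee_fin normrM ler_piMl.
have kf y : m1.-integrable setT (fun x => (k (x, y) * f x)%:E).
  apply: (le_integrable _ _ _ hf) => //.
    apply/measurable_EFinP; apply: measurable_funM => //.
    by apply: (measurableT_comp mk); exact: measurable_pair2.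
  by move=> x _; rewrite /= lee_fin normrM ler_piMl.
have := Fubini iH; rewrite /Rintegral => fub.
transitivity (fine (\int[m1]_x \int[m2]_y H (x, y))%E).
  congr fine; apply: eq_integral => x _.
  rewrite EFinM fineK; last exact: integrable_fin_num.
  rewrite -integralZl//; apply: eq_integral => y _; rewrite /H/= -EFinM.
  by congr EFin; ring.
rewrite fub; congr fine; apply: eq_integral => y _.
rewrite EFinM fineK; last exact: integrable_fin_num.
rewrite muleC -integralZl//; apply: eq_integral => x _; rewrite /H/= -EFinM.
by congr EFin; ring.
Qed.

End Kernel.

Section IntegrationByParts.
Context {R : realType}.
Local Notation mu := (@lebesgue_measure R).
Implicit Types (l x y : R) (f g h F G : R -> R).

Lemma L1_restrict l f : L1 l f ->
  mu.-integrable setT (EFin \o (f \_ `]0%R, l[%classic)).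
Proof.
move=> hf; rewrite -restrict_EFin.
by have [H _] := @integrable_mkcond _ _ _ mu `]0%R, l[%classic (EFin \o f)
  (measurable_itv _); exact: H.
Qed.

Lemma int_restrict l f : int l f = \int[mu]_x (f \_ `]0%R, l[%classic) x.
Proof. exact: Rintegral_mkcond. Qed.

Lemma ae_neq x : {ae mu, forall t, t != x}.
Proof.
exists [set x]; split; [exact: measurable_set1|exact: lebesgue_measure_set1|].
by move=> t /= /negP; rewrite negbK => /eqP.
Qed.

(** Fubini on the square, split along the diagonal. *)
Lemma int_fubini l f g : L2 l f -> L2 l g ->
  int l (fun x => f x * int x g) + int l (fun x => int x f * g x)
  = int l f * int l g.
Proof.
move=> hf2 hg2; have hf := L2_L1 hf2; have hg := L2_L1 hg2.
pose O : set R := `]0%R, l[%classic.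
pose f0 := f \_ O; pose g0 := g \_ O.
have if0 := L1_restrict hf; have ig0 := L1_restrict hg.
pose k (z : R * R) : R := (z.2 < z.1)%R%:R.
have k1 z : `|k z| <= 1.
  by rewrite /k; case: (_ < _); rewrite ?normr1// normr0.
have mk : measurable_fun setT k.
  rewrite (_ : k = fun z => if z.2 < z.1 then 1 else 0); last first.
    by apply/funext => z; rewrite /k; case: (_ < _).
  apply: measurable_fun_ifT; [|exact: measurable_cst..].
  exact: (measurable_fun_ltr measurable_snd measurable_fst).
have fub := Rfubini_kernel if0 ig0 mk k1.
have patchO (u v : R -> R) : (fun x => u x * (v \_ O) x) = (fun x => u x * v x) \_ O.
  by apply/funext => x; rewrite !patchE; case: ifP; rewrite ?mulr0.
have L : \int[mu]_x (f0 x * \int[mu]_y (k (x, y) * g0 y)) = int l (fun x => f x * int x g).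
  rewrite [RHS]int_restrict; apply: eq_Rintegral => x _.
  rewrite /f0 !patchE; case: ifPn => [|_]; last by rewrite mul0r.
  rewrite inE => xO.
  have xl : x <= l by move: xO; rewrite /O/= in_itv/= => /andP[_ /ltW].
  congr (_ * _).
  by rewrite /g0 patchO -int_restrict (int_indic _ xl).
have Rr : \int[mu]_y (\int[mu]_x (k (x, y) * f0 x) * g0 y)
    = int l (fun x => (int l f - int x f) * g x).
  rewrite [RHS]int_restrict; apply: eq_Rintegral => x _.
  rewrite /g0 !patchE; case: ifPn => [|_]; last by rewrite mulr0.
  rewrite inE => xO.
  have xl : x <= l by move: xO; rewrite /O/= in_itv/= => /andP[_ /ltW].
  congr (_ * _).
  rewrite /f0 patchO -int_restrict (int_indic _ xl).
  have i1 := L1_indic x hf; rewrite -intB//; apply: raeq_int.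
  - apply: (mfunM _ (L1_mfun hf)); rewrite /k/=.
    rewrite (_ : (fun t : R => _) = \1_([set` `]x, +oo[]) :> (R -> R)); last first.
      by apply/funext => t; rewrite indicE mem_setE/= in_itv/= andbT.
    by apply: measurable_indic; exact: measurable_itv.
  - exact: (mfunB (L1_mfun hf) (L1_mfun i1)).
  - apply: ae_imp (ae_neq x) => t tx _; rewrite /k/=.
    by case: ltgtP tx => //= _ _; rewrite ?mul1r ?mul0r ?subrr ?subr0.
rewrite -L fub Rr -intD.
- rewrite (@eq_int _ _ _ (fun x => int l f * g x)) ?intZ// => x _; ring.
- apply: (L2M _ hg2); apply: L2B; first exact: L2_cst.
  by have := AC_L2F (AC_int 0 hf2); under eq_fun do rewrite add0r.
- apply: (L2M _ hg2).
  by have := AC_L2F (AC_int 0 hf2); under eq_fun do rewrite add0r.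
Qed.

Lemma AC_parts l F f G g : 0 <= l -> AC l F f -> AC l G g ->
  int l (fun x => f x * G x) + int l (fun x => F x * g x)
  = F l * G l - F 0 * G 0.
Proof.
move=> l0 hF hG; have [hf Fe] := hF; have [hg Ge] := hG.
have ll : l \in `[0, l] by rewrite in_itv/= l0 lexx.
have hf' := AC_L2F (AC_int 0 hf); have hg' := AC_L2F (AC_int 0 hg).
have E1 : int l (fun x => f x * G x) = G 0 * int l f + int l (fun x => f x * int x g).
  rewrite -(intZ _ (L2_L1 hf)) -intD; last 2 first.
  - exact/L1Z/L2_L1.
  - by apply: (L2M hf); move: hg'; under eq_fun do rewrite add0r.
  apply: eq_int => x xl; rewrite Ge; [ring|exact: subset_itv_oo_cc].
have E2 : int l (fun x => F x * g x) = F 0 * int l g + int l (fun x => int x f * g x).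
  rewrite -(intZ _ (L2_L1 hg)) -intD; last 2 first.
  - exact/L1Z/L2_L1.
  - by apply: (L2M _ hg); move: hf'; under eq_fun do rewrite add0r.
  apply: eq_int => x xl; rewrite Fe; [ring|exact: subset_itv_oo_cc].
have := int_fubini hf hg; rewrite E1 E2 (Fe l ll) (Ge l ll); lra.
Qed.

End IntegrationByParts.

(** * Uniqueness of primitives *)

Section Uniqueness.
Context {R : realType}.
Local Notation mu := (@lebesgue_measure R).
Implicit Types (l x y : R) (f g h F G : R -> R).

(** Rewrites [int] as a primitive in the form used by the Lebesgue
differentiation theorem. *)
Lemma int_itvNyc l x f : L1 l f -> 0 <= x -> x <= l ->
  \int[mu]_(t in `]-oo, x]) (f \_ `]0%R, l[%classic) t = int x f.
Proof.
move=> hf x0 xl; rewrite -Rintegral_mkcondr.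
rewrite /int; have [xl'|lx] := ltP x l; last first.
  have -> : x = l by apply/eqP; rewrite eq_le xl.
  congr (Rintegral _ _ _); apply/seteqP; split => t /=; rewrite !in_itv/=.
    by case.
  by move=> /andP[t0 tl]; rewrite t0 tl ltW.
rewrite (_ : _ `&` _ = `]0, x]%classic); last first.
  apply/seteqP; split => t /=; rewrite !in_itv/=.
    by move=> [-> /andP[-> _]].
  by move=> /andP[-> tx]; rewrite tx (le_lt_trans tx xl').
rewrite -Rintegral_itv_bndo_bndc//.
exact: (L1S xl).
Qed.

(** Lebesgue differentiation of the primitive. *)
Lemma int_eq0 l h : L1 l h -> (forall x, x \in `[0, l] -> int x h = 0) ->
  raeq l h (fun _ => 0).
Proof.
move=> hh h0; pose f := h \_ `]0%R, l[%classic.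
have if0 := L1_restrict hh.
have loc : locally_integrable [set: R] f.
  by apply: integrable_locally hh; exact: measurable_itv.
have [|] := FTC1Ny _ loc.
  move=> y; apply: integrableS if0 => //; exact: measurable_itv.
move=> N [mN N0 NP]; exists N; split => // x /= /not_implyP[xl hx].
apply: NP => /= H; apply: hx.
have [_] := H; rewrite /f patchE mem_set// => <-.
rewrite derive1E (@near_eq_derive _ _ _ _ (cst 0)) ?derive_cst//.
have yI := near_in_itvoo xl; near=> y.
have : y \in `]0, l[ by near: y.
rewrite in_itv/= => /andP[/ltW y0 /ltW yl].
by rewrite (int_itvNyc hh)// h0// in_itv/= y0 yl.
Unshelve. all: by end_near. Qed.

(** Two continuous functions that differ somewhere differ on an interval,
which has positive measure. The ends 0 and l are reached from inside. *)
Lemma continuous_raeq l F G : 0 < l ->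
  {within `[0, l], continuous F} -> {within `[0, l], continuous G} ->
  raeq l F G -> forall x, x \in `[0, l] -> F x = G x.
Proof.
move=> l0 cF cG [N [mN N0 NP]] x xl.
apply/eqP; rewrite -subr_eq0; apply/negPn/negP => d0.
have /subspace_continuousP/(_ x xl) := cF.
have /subspace_continuousP/(_ x xl) := cG.
set d := F x - G x in d0.
have d2 : 0 < `|d| / 2 by rewrite divr_gt0// normr_gt0.
move=> /cvgrPdist_lt/(_ _ d2) cG' /cvgrPdist_lt/(_ _ d2) cF'.
move: cF' cG'; rewrite !near_withinE => cF' cG'.
have FI : Filter (nbhs x) := @nbhs_filter R x.
have H := @filterI R (nbhs x) FI _ _ cF' cG'.
have [e /= e0 eP] := (@nbhs_ballP R R x _).1 H.
pose p := Num.max 0 (x - e); pose r := Num.min l (x + e).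
move: (xl); rewrite in_itv/= => /andP[x0 xl'].
have pr : p < r.
  by rewrite /p /r lt_min !gt_max; apply/andP; split; apply/andP; split; lra.
have sub : `]p, r[%classic `<=` N.
  move=> t /=; rewrite in_itv/= /p /r gt_max lt_min => /andP[/andP[t0 tx1] /andP[tl tx2]].
  apply: NP => /= /(_ _)/wrap[]; first by rewrite in_itv/= t0.
  move=> FG; have tb : ball x e t.
    by rewrite /ball/= ltr_norml; apply/andP; split; lra.
  have tl' : t \in `[0, l] by rewrite in_itv/= !ltW.
  have [/(_ tl') h1 /(_ tl') h2] := eP t tb.
  have {h1}/ltr_normlP[h1 h3] : `|F x - F t| < `|d| / 2 := h1.
  have {h2}/ltr_normlP[h2 h4] : `|G x - G t| < `|d| / 2 := h2.
  move: h1 h3; rewrite FG => h1 h3.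
  have : `|d| < `|d| by rewrite {1}/d ltr_norml; apply/andP; split; lra.
  by rewrite ltxx.
have : (mu `]p, r[%classic <= mu N)%E by apply: le_measure => //; rewrite inE; [exact: measurable_itv|].
by rewrite N0 lebesgue_measure_itv/= lte_fin pr -EFinB lee_fin subr_le0 leNgt pr.
Qed.

Lemma AC_unique l F f G g : 0 < l -> AC l F f -> AC l G g -> raeq l F G ->
  (forall x, x \in `[0, l] -> F x = G x) /\ raeq l f g.
Proof.
move=> l0 hF hG FG.
have FGe := continuous_raeq l0 (AC_continuous hF) (AC_continuous hG) FG.
split=> //.
have [hfg hB] := ACB hF hG.
have z0 : 0 \in `[0, l] by rewrite in_itv/= lexx ltW.
have := int_eq0 (L2_L1 hfg) _.
move=> /(_ _)/wrap[].
  move=> x xl; have := hB x xl; rewrite !FGe// !subrr; lra.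
by apply: ae_imp => x h xl; apply/eqP; rewrite -subr_eq0 h.
Qed.

Lemma AC_C1 l F : 0 <= l -> (forall x, derivable F x 1) -> continuous (derive1 F) ->
  AC l F (derive1 F).
Proof.
move=> l0 dF cF.
have cw (A : set R) : {within A, continuous (derive1 F)} by exact: continuous_subspaceT.
split.
  split; first by apply: continuous_mfun; exact: cw.
  have H : mu.-integrable `[0, l] (EFin \o (fun x => derive1 F x ^+ 2)).
    apply: continuous_compact_integrable; first exact: segment_compact.
    apply: continuous_subspaceT => x.
    by apply: (@continuousM _ _ (derive1 F) (derive1 F)); exact: cF.
  apply: integrableS H => //; [exact: measurable_itv..|exact: subset_itv_oo_cc].
move=> x; rewrite in_itv/= => /andP[]; rewrite le_eqVlt => /predU1P[<- _|x0 xl].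
  by rewrite int0 addr0.
have cx (y : R) : {for y, continuous F} by apply/differentiable_continuous/derivable1_diffP.
have := @continuous_FTC2 _ (derive1 F) F 0 x x0 (cw _) _ _.
move=> /(_ _ _)/wrap[].
- split => [y _| |]; [exact: dF| |].
    by apply: cvg_at_right_filter; exact: cx.
  by apply: cvg_at_left_filter; exact: cx.
- by move=> y _.
move=> E; have -> : int x (derive1 F) = \int[mu]_(x in `[0, x]) derive1 F x.
  have H (A : set R) : measurable A -> A `<=` `[0, x]%classic ->
      mu.-integrable A (EFin \o derive1 F).
    move=> mA Ax; apply: (@integrableS _ _ _ mu `[0, x]%classic _ _ _ mA Ax) => //.
    by apply: continuous_compact_integrable; [exact: segment_compact|exact: cw].
  rewrite /int Rintegral_itv_bndo_bndc; last first.
    by apply: H; [exact: measurable_itv|exact: subset_itv_oo_cc].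
  rewrite Rintegral_itv_obnd_cbnd//.
  by apply: H; [exact: measurable_itv|exact: subset_itv_oc_cc].
by rewrite /Rintegral E -EFinB /= subrKC.
Qed.

End Uniqueness.

(** * The second-order lemma of du Bois-Reymond *)

Section SecondOrder.
Context {R : realType}.
Local Notation mu := (@lebesgue_measure R).
Implicit Types (l x y : R) (f g h m w F G : R -> R).

Lemma AC_id l c : 0 <= l -> AC l (fun x => x - c) (fun _ => 1).
Proof.
move=> l0; apply: AC_eq l0 (AC_int (- c) (L2_cst l 1)) => x.
by rewrite in_itv/= => /andP[x0 _]; rewrite int_cst// mul1r addrC.
Qed.

(** Only test functions vanishing with their derivative at both ends are
available, so g is determined by m up to an affine function. Let J be the
double primitive of m; the part of g - J orthogonal to affine functions is
itself the second derivative of an admissible test function, and testing with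
it shows that it vanishes. *)
Lemma du_bois_reymond2 l g m : 0 < l -> L2 l g -> L2 l m ->
  (forall w u u1, AC l u u1 -> AC l u1 w ->
    u 0 = 0 -> u1 0 = 0 -> u l = 0 -> u1 l = 0 ->
    int l (fun x => w x * g x) = int l (fun x => u x * m x)) ->
  exists G G1, [/\ AC l G G1, AC l G1 m & raeq l G g].
Proof.
move=> l0 hg hm ort; have l0' := ltW l0.
pose J1 := fun x => 0 + int x m.
have hJ1 : AC l J1 m by exact: AC_int.
pose J := fun x => 0 + int x J1.
have hJ : AC l J J1 by apply: AC_int; exact: AC_L2F hJ1.
have J0 : J 0 = 0 by rewrite /J int0 addr0.
pose H := fun x => g x - J x.
have hH : L2 l H by apply: L2B hg _; exact: AC_L2F hJ.
pose p := int l (fun x => x - 0) / l.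
have hX := AC_id p l0'; have hX2 := AC_L2F hX; have hX1 := L2_L1 hX2.
have intX : int l (fun x => x - p) = 0.
  rewrite (@eq_int _ _ _ (fun x => (x - 0) - p)); last by move=> x _; rewrite subr0.
  rewrite (intB (L2_L1 (AC_L2F (AC_id 0 l0'))) (L1_cst l p)) int_cst// /p.
  by field; rewrite gt_eqF.
pose s := int l (fun x => (x - p) ^+ 2).
have s0 : s != 0.
  apply/negP => /eqP/(L2_int_sqr_eq0 hX2).
  move=> /(continuous_raeq l0 (AC_continuous hX) (AC_continuous (AC_cst l 0))) E.
  have := E l; have := E 0; rewrite !in_itv/= !lexx l0' => /(_ isT) h1 /(_ isT) h2.
  by move: l0; rewrite (_ : l = 0) ?ltxx//; lra.
pose al := int l H / l; pose be := int l (fun x => H x * (x - p)) / s.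
(* p is the mean of x, so that 1 and x - p are orthogonal, and al and be
   are the coefficients of the affine projection of H. *)
pose w := fun x => H x - (al + be * (x - p)).
have hA : L2 l (fun x => al + be * (x - p)).
  by apply: L2D; [exact: L2_cst|exact: L2Z].
have hw : L2 l w by exact: L2B.
have w1 : int l w = 0.
  rewrite (intB (L2_L1 hH) (L2_L1 hA)).
  rewrite (intD (L1_cst l al) (L1Z be hX1)) intZ// intX int_cst// /al.
  by field; rewrite gt_eqF.
have wX : int l (fun x => w x * (x - p)) = 0.
  have h1 := L2M hH hX2; have h2 := L1Z al hX1; have h3 := L1Z be (hX2.2).
  rewrite (@eq_int _ _ _ (fun x => H x * (x - p)
     - (al * (x - p) + be * (x - p) ^+ 2))); last by move=> x _; rewrite /w; ring.
  rewrite (intB h1 (L1D h2 h3)) (intD h2 h3) !intZ ?intX//; last exact: hX2.2.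
  by rewrite -/s /be; field.
pose u1 := fun x => 0 + int x w.
have hu1 : AC l u1 w by exact: AC_int.
pose u := fun x => 0 + int x u1.
have hu : AC l u u1 by apply: AC_int; exact: AC_L2F hu1.
have u10 : u1 0 = 0 by rewrite /u1 int0 addr0.
have u00 : u 0 = 0 by rewrite /u int0 addr0.
have u1l : u1 l = 0 by rewrite /u1 w1 addr0.
have ul : u l = 0.
  have := AC_parts l0' hu1 hX; rewrite wX u1l u10 !mul0r subr0 add0r.
  by under eq_int do rewrite mulr1; rewrite /u add0r.
have wH : int l (fun x => w x * H x) = 0.
  have E := ort w u u1 hu hu1 u00 u10 ul u1l.
  have P1 := AC_parts l0' hu hJ1; have P2 := AC_parts l0' hu1 hJ.
  rewrite u00 ul !mul0r subr0 in P1; rewrite u10 u1l !mul0r subr0 in P2.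
  rewrite (@eq_int _ _ _ (fun x => w x * g x - w x * J x)); last first.
    by move=> x _; rewrite /H; ring.
  rewrite (intB (L2M hw hg) (L2M hw (AC_L2F hJ))); lra.
have w0 : raeq l w (fun _ => 0).
  apply: (L2_int_sqr_eq0 hw).
  rewrite (@eq_int _ _ _ (fun x => w x * H x - (al * w x + be * (w x * (x - p))))); last first.
    move=> x _; rewrite (_ : w x ^+ 2 = w x * (H x - (al + be * (x - p))))//.
    by ring.
  have h1 := L2M hw hH; have h2 := L1Z al (L2_L1 hw); have h3 := L1Z be (L2M hw hX2).
  rewrite (intB h1 (L1D h2 h3)) (intD h2 h3) (intZ _ (L2_L1 hw)) (intZ _ (L2M hw hX2)).
  by rewrite wH w1 wX; ring.
exists (fun x => J x + (al + be * (x - p))), (fun x => J1 x + be); split.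
- have := ACD hJ (ACD (AC_cst l al) (ACZ be hX)).
  by congr AC; apply/funext => x; rewrite add0r mulr1.
- have := ACD hJ1 (AC_cst l be).
  by congr AC; apply/funext => x; rewrite addr0.
- apply: ae_imp w0 => x wx xl; have := wx xl; rewrite /w /H; lra.
Qed.

End SecondOrder.

(** * Weak derivatives are derivatives of primitives *)

Section WeakDerivative.
Context {R : realType}.
Local Notation mu := (@lebesgue_measure R).
Implicit Types (l x y : R) (f g h m w F G : R -> R).

Definition weak_deriv l f g : Prop := forall phi, test_function l phi ->
  int l (fun x => derive1 phi x * f x) = - int l (fun x => phi x * g x).

Lemma test_function_AC l phi : 0 <= l -> test_function l phi ->
  [/\ AC l phi (derive1 phi), phi 0 = 0 & phi l = 0].
Proof.
move=> l0 [dphi cphi [a [b [a0 bl ab]]]]; split; first exact: (AC_C1 l0 dphi cphi).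
- apply/eqP/negPn/negP => /ab; rewrite in_itv/= => /andP[]; lra.
- apply/eqP/negPn/negP => /ab; rewrite in_itv/= => /andP[]; lra.
Qed.

Lemma AC_weak_deriv l F f g : 0 <= l -> mfun_on l f -> AC l F g -> raeq l F f ->
  weak_deriv l f g.
Proof.
move=> l0 mf hF Ff phi tphi; have [hp p0 pl] := test_function_AC l0 tphi.
have := AC_parts l0 hp hF; rewrite p0 pl !mul0r subr0 => E.
rewrite (@raeq_int _ _ _ (fun x => derive1 phi x * F x)); first lra.
- exact: (mfunM (L1_mfun (L2_L1 (AC_L2 hp))) mf).
- exact: (mfunM (L1_mfun (L2_L1 (AC_L2 hp))) (AC_mfun hF)).
- by apply: ae_imp Ff => x h xl; rewrite h.
Qed.

(** A continuous function with compact support and zero mean is the derivative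
of a test function. *)
Lemma test_primitive l a b (psi : R -> R) : 0 < a -> a <= b -> b < l ->
  continuous psi -> (forall x, psi x != 0 -> x \in `[a, b]) -> int l psi = 0 ->
  exists2 phi, test_function l phi & derive1 phi = psi.
Proof.
move=> a0 ab bl cpsi supp i0.
pose phi x := \int[mu]_(t in `]-oo, x]) psi t.
have ipsi : mu.-integrable setT (EFin \o psi).
  have -> : psi = psi \_ `[a, b]%classic.
    apply/funext => x; rewrite patchE; case: ifPn => // /negP xab.
    apply/eqP/negPn/negP => /supp h; apply: xab; exact: mem_set.
  rewrite -restrict_EFin.
  have [H _] := @integrable_mkcond _ _ _ mu `[a, b]%classic (EFin \o psi)
     (measurable_itv _); apply: H.
  by apply: continuous_compact_integrable; [exact: segment_compact|exact: continuous_subspaceT].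
have dphi x : derivable phi x 1 /\ derive1 phi x = psi x.
  apply: (@continuous_FTC1 _ psi -oo%O x (x + 1)).
  - by rewrite ltrDl.
  - by apply: integrableS ipsi => //; exact: measurable_itv.
  - by rewrite ltNyr.
  - exact: cpsi.
have E : derive1 phi = psi by apply/funext => x; case: (dphi x).
exists phi => //; split; [by move=> x; case: (dphi x)|by rewrite E|].
exists a, b; split=> // x; apply: contraNT; rewrite in_itv/= negb_and -!ltNge.
have psi0 t : t \notin `[a, b] -> psi t = 0.
  by move=> h; apply/eqP/negPn/negP => /supp; rewrite (negbTE h).
move=> /orP[xa|bx]; apply/eqP.
  rewrite /phi (@eq_Rintegral _ _ _ _ _ (fun _ => 0)) ?Rintegral_cst ?mul0r//.
  move=> t; rewrite inE/= in_itv/= => tx; apply: psi0.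
  by rewrite in_itv/= negb_and -ltNge (le_lt_trans tx xa).
rewrite /phi Rintegral_mkcond -i0 int_restrict; apply: eq_Rintegral => t _.
rewrite !patchE; have [tab|/psi0->] := boolP (t \in `[a, b]); last by do 2 case: ifP.
move: tab; rewrite in_itv/= => /andP[at_ tb].
rewrite !mem_set//= in_itv/=; first by rewrite (lt_le_trans a0 at_) (le_lt_trans tb bl).
exact: le_trans tb (ltW bx).
Qed.

(** The truncation of t to [0, 1], written with absolute values so that
continuity is immediate. *)
Definition clamp (t : R) : R := (`|t| - `|t - 1| + 1) / 2.

Lemma clamp_le0 t : t <= 0 -> clamp t = 0.
Proof.
by move=> t0; rewrite /clamp !ler0_norm//; [field|lra].
Qed.
Lemma clamp_ge1 t : 1 <= t -> clamp t = 1.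
Proof.
by move=> t0; rewrite /clamp !ger0_norm//; [field|lra..].
Qed.
Lemma clamp01 t : 0 <= clamp t <= 1.
Proof.
have [t0|t0] := leP t 0; first by rewrite clamp_le0// lexx ler01.
have [t1|t1] := leP 1 t; first by rewrite clamp_ge1// lexx ler01.
rewrite /clamp ger0_norm ?ltr0_norm; [apply/andP; split|..]; lra.
Qed.
Lemma clamp_gt0 t : 0 < t -> 0 < clamp t.
Proof.
move=> t0; have [t1|t1] := leP 1 t; first by rewrite clamp_ge1.
by rewrite /clamp ger0_norm ?ltW// ltr0_norm; lra.
Qed.
Lemma continuous_clamp : continuous clamp.
Proof.
move=> t; rewrite /clamp; apply: cvgMl; apply: cvgD; last exact: cvg_cst.
apply: cvgB; first exact: norm_continuous.
apply: cvg_norm; apply: cvgB; [exact: cvg_id|exact: cvg_cst].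
Qed.

(** Continuous functions supported in [a, b] that increase to the indicator of
]a, b[ as n grows. *)
Definition plateau (a b n t : R) : R := clamp (n * (t - a)) * clamp (n * (b - t)).

Lemma continuous_plateau a b n : continuous (plateau a b n).
Proof.
move=> t; apply: cvgM.
- apply: continuous_cvg; first exact: continuous_clamp.
  by apply: cvgMr; apply: cvgB; [exact: cvg_id|exact: cvg_cst].
- apply: continuous_cvg; first exact: continuous_clamp.
  by apply: cvgMr; apply: cvgB; [exact: cvg_cst|exact: cvg_id].
Qed.

Lemma plateau01 a b n t : 0 <= plateau a b n t <= 1.
Proof.
have /andP[h1 h2] := clamp01 (n * (t - a)).
have /andP[h3 h4] := clamp01 (n * (b - t)).
by rewrite mulr_ge0// mulr_ile1.
Qed.

Lemma plateau_supp a b n t : 0 <= n -> plateau a b n t != 0 -> t \in `[a, b].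
Proof.
move=> n0; rewrite in_itv/=; apply: contraNT; rewrite negb_and -!ltNge.
by move=> /orP[h|h]; rewrite /plateau; [rewrite clamp_le0 ?mul0r//|
  rewrite [clamp (n * (b - t))]clamp_le0 ?mulr0//]; apply: mulr_ge0_le0 => //; lra.
Qed.

Lemma plateau_cvg a b t : t != a -> t != b ->
  plateau a b n%:R t @[n --> \oo] --> ((a < t < b)%R%:R : R).
Proof.
move=> ta tb.
have [/andP[at_ tb']|nab] := boolP (a < t < b); last first.
  apply: cvg_near_cst; near=> n; apply/eqP/negPn/negP => /plateau_supp.
  move=> /(_ (ler0n _ _)); rewrite in_itv/= => /andP[h1 h2].
  by move: nab; rewrite !lt_neqAle h1 h2 tb eq_sym ta.
apply: cvg_near_cst; near=> n.
have h c : 0 < c -> c^-1 <= n%:R -> clamp (n%:R * c) = 1.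
  by move=> c0 cn; rewrite clamp_ge1// -ler_pdivrMr// div1r.
rewrite /plateau !h ?mul1r ?subr_gt0//; near: n; exact: nbhs_infty_ger.
Unshelve. all: by end_near. Qed.

(** Subtracting a primitive of g leaves h with weak derivative 0, that is,
orthogonal to every continuous function of compact support and zero mean.
Correcting by a multiple of a fixed bump rho removes the zero mean condition
and turns h into k = h - c orthogonal to all plateaus, hence with vanishing
integral over every interval. *)
Lemma weak_deriv_AC l f g : 0 < l -> L2 l f -> L2 l g -> weak_deriv l f g ->
  exists2 F, AC l F g & raeq l F f.
Proof.
move=> l0 hf hg fg; have l0' := ltW l0.
pose G := fun x => 0 + int x g.
have hG : AC l G g by exact: AC_int.
pose h := fun x => f x - G x.
have hh : L2 l h by apply: L2B hf _; exact: AC_L2F hG.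
have ort psi a b : 0 < a -> a <= b -> b < l ->
  continuous psi -> (forall x, psi x != 0 -> x \in `[a, b]) -> int l psi = 0 ->
  int l (fun x => psi x * h x) = 0.
  move=> a0 ab bl cpsi supp /(test_primitive a0 ab bl cpsi supp)[phi tphi E].
  have := fg phi tphi; have [hp p0 pl] := test_function_AC l0' tphi.
  have := AC_parts l0' hp hG; rewrite p0 pl !mul0r subr0 E => P1 P2.
  have hpsi : L2 l psi by rewrite -E; exact: AC_L2 hp.
  rewrite (@eq_int _ _ _ (fun x => psi x * f x - psi x * G x)); last first.
    by move=> x _; rewrite /h; ring.
  rewrite (intB (L2M hpsi hf) (L2M hpsi (AC_L2F hG))); lra.
have L2p a b n : L2 l (plateau a b n).
  apply: (@L2_bounded _ _ _ 1).
    by apply: continuous_mfun; apply: continuous_subspaceT; exact: continuous_plateau.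
  by move=> x _; have /andP[p0 p1] := plateau01 a b n x; rewrite ger0_norm.
pose rho := plateau (l / 3) (2 * l / 3) 1.
pose s := int l rho.
have s0 : s != 0.
  apply/negP => /eqP s0.
  have := int_eq0_ae (L2_L1 (L2p _ _ _)) _ s0.
  move=> /(_ _)/wrap[]; first by move=> x _; case/andP: (plateau01 (l / 3) (2 * l / 3) 1 x).
  move=> /(continuous_raeq l0 (continuous_subspaceT (@continuous_plateau _ _ _)) (AC_continuous (AC_cst l 0)))/(_ (l / 2)).
  rewrite in_itv/= => /(_ _)/wrap[]; first by apply/andP; split; lra.
  by apply/eqP; rewrite mulf_neq0// gt_eqF// clamp_gt0//; lra.
pose c := int l (fun x => rho x * h x) / s.
pose k := fun x => h x - c.
have hk : L2 l k by apply: L2B => //; exact: L2_cst.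
have pk a b n : 0 < a -> a <= b -> b < l -> 0 <= n ->
    int l (fun x => plateau a b n x * k x) = 0.
  move=> a0 ab bl n0.
  pose K := int l (plateau a b n) / s.
  pose psi := fun x => plateau a b n x - K * rho x.
  have := ort psi (Num.min a (l / 3)) (Num.max b (2 * l / 3)).
  move=> /(_ _ _ _ _ _ _)/wrap[].
  - by rewrite lt_min a0/=; lra.
  - by rewrite le_max !ge_min ab.
  - by rewrite gt_max bl/=; lra.
  - move=> x; apply: cvgB; first exact: continuous_plateau.
    by apply: cvgMr; exact: continuous_plateau.
  - move=> x; rewrite /psi => px; rewrite in_itv/= ge_min le_max.
    have [p1|p1] := eqVneq (plateau a b n x) 0; last first.
      by have := plateau_supp n0 p1; rewrite in_itv/= => /andP[-> ->].
    have p2 : rho x != 0.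
      by apply: contra_neq px => p2; rewrite p1 p2 mulr0 subr0.
    by have := plateau_supp ler01 p2; rewrite in_itv/= => /andP[-> ->]; rewrite !orbT.
  - rewrite (intB (L2_L1 (L2p _ _ _)) (L1Z _ (L2_L1 (L2p _ _ _)))) intZ; last exact/L2_L1/L2p.
    by rewrite -/s /K; field.
  rewrite (@eq_int _ _ _ (fun x => plateau a b n x * h x - K * (rho x * h x))); last first.
    by move=> x _; rewrite /psi; ring.
  rewrite (intB (L2M (L2p _ _ _) hh) (L1Z _ (L2M (L2p _ _ _) hh))) intZ; last exact: (L2M (L2p _ _ _) hh).
  move=> E.
  rewrite (@eq_int _ _ _ (fun x => plateau a b n x * h x - c * plateau a b n x)); last first.
    by move=> x _; rewrite /k; ring.
  rewrite (intB (L2M (L2p _ _ _) hh) (L1Z _ (L2_L1 (L2p _ _ _)))) intZ; last exact/L2_L1/L2p.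
  move: E; rewrite /K /c.
  set A := int l (fun x => rho x * h x); set B := int l (plateau a b n) => E.
  rewrite -E; field.
  by [].
have kab a b : 0 < a -> a < b -> b < l -> int a k = int b k.
  move=> a0 ab bl.
  pose ind t : R := (a < t < b)%R%:R.
  have mind : mfun_on l ind.
    rewrite (_ : ind = \1_([set` `]a, b[]) :> (R -> R)); last first.
      by apply/funext => t; rewrite indicE mem_setE/= in_itv.
    by apply: measurable_indic; exact: measurable_itv.
  have mik : mfun_on l (fun x => ind x * k x) := mfunM mind (L1_mfun (L2_L1 hk)).
  have [|||||_ _] := @dominated_convergence _ _ _ mu `]0, l[%classic (measurable_itv _)
    (fun n x => (plateau a b n%:R x * k x)%:E) (fun x => (ind x * k x)%:E)
    (fun x => `|k x|%:E).
  - by move=> n; apply/measurable_EFinP; apply: mfunM (L1_mfun (L2_L1 hk)); case: (L2p a b n%:R).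
  - exact/measurable_EFinP.
  - apply: ae_imp2 (ae_neq a) (ae_neq b) => t ta tb _.
    apply: cvg_EFin; first by near=> n.
    by apply: cvgMl; exact: plateau_cvg.
  - exact: (L1_norm (L2_L1 hk)).
  - apply: aeW => t n _; rewrite /= lee_fin normrM ler_piMl//.
    by have /andP[p0 p1] := plateau01 a b n%:R t; rewrite ger0_norm.
  have i1 := L2_L1 hk.
  rewrite (_ : [sequence _]_n = cst 0%E); last first.
    apply/funext => n /=.
    have ip : L1 l (fun x => plateau a b n%:R x * k x) := L2M (L2p _ _ _) hk.
    rewrite -[LHS]fineK; last exact: integrable_fin_num.
    by rewrite -[fine _]/(int l _) pk// ltW.
  move=> /(cvg_unique _ (cvg_cst _)) => /(_ _)/wrap[]; first exact: ereal_hausdorff.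
  move=> E.
  have E2 : int l (fun x => ind x * k x) = 0 by rewrite /int /Rintegral -E.
  apply/eqP; rewrite eq_sym -subr_eq0; apply/eqP.
  have al : a <= l by lra. have bl' : b <= l by lra.
  rewrite (int_indic _ al) (int_indic _ bl') -intB; [|exact: L1_indic..].
  rewrite -E2; apply: raeq_int => //.
    exact: (mfunB (L1_mfun (L1_indic _ i1)) (L1_mfun (L1_indic _ i1))).
  apply: ae_imp (ae_neq a) => t ta _; rewrite /ind.
  case: (ltgtP t a) ta => //= ta _; rewrite ?mul0r ?subr0//.
  by rewrite (lt_trans ta ab) subrr.
have k0 : raeq l k (fun _ => 0).
  apply: int_eq0; first exact: L2_L1.
  pose C := int l (fun t => k t ^+ 2).
  have C0 : 0 <= C by apply: int_ge0 => t _; exact: sqr_ge0.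
  (* The integrals of k over [0, x] are reached from those over [e, x] by
     letting e tend to 0, and those up to l similarly. *)
  have small z : (forall e, 0 < e -> e < l -> z ^+ 2 <= e * C) -> z = 0.
    move=> ze; apply/eqP; rewrite -sqrf_eq0; apply/eqP/le_anti.
    rewrite sqr_ge0 andbT; apply/ler_addgt0Pr => e e0; rewrite add0r.
    pose d := Num.min (l / 2) (e / (C + 1)).
    have d0 : 0 < d by rewrite lt_min; apply/andP; split; rewrite divr_gt0//; lra.
    have d1 : d <= l / 2 by rewrite ge_min lexx.
    have d2 : d <= e / (C + 1) by rewrite ge_min lexx orbT.
    apply: le_trans (ze d d0 _) _; first lra.
    apply: le_trans (ler_wpM2r C0 d2) _.
    rewrite mulrAC ler_pdivrMr; [nra|lra].
  have in0 x : 0 < x -> x < l -> int x k = 0.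
    move=> x0 xl; apply: small => e e0 el.
    pose d := Num.min e (x / 2).
    have d0 : 0 < d by rewrite lt_min e0/=; lra.
    have d1 : d <= e by rewrite ge_min lexx.
    have d2 : d <= x / 2 by rewrite ge_min lexx orbT.
    rewrite -(kab d x)//; last lra.
    have := int_holder hk (lexx 0) (ltW d0) _; rewrite int0 !subr0 => /(_ _)/wrap[].
      lra.
    move=> H; apply: le_trans H _; exact: ler_wpM2r.
  move=> x; rewrite in_itv/= => /andP[]; rewrite le_eqVlt => /predU1P[<- _|x0].
    exact: int0.
  rewrite le_eqVlt => /predU1P[->|]; last exact: in0.
  apply: small => e e0 el.
  have := @int_holder _ l k (l - e) l hk; rewrite (in0 (l - e)); [|lra..].
  rewrite subr0 => /(_ _ _ _)/wrap[]; [lra..|].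
  by move=> H; apply: le_trans H _; rewrite subKr.
exists (fun x => G x + c).
  have := ACD hG (AC_cst l c); congr AC; apply/funext => x; by rewrite addr0.
by apply: ae_imp k0 => x kx xl; have := kx xl; rewrite /k /h; lra.
Unshelve. all: by end_near. Qed.

End WeakDerivative.

(** * Complex Sobolev functions and traces *)

Local Open Scope complex_scope.

Section Sobolev.
Context {R : realType}.
Local Notation mu := (@lebesgue_measure R).
Implicit Types (l x y : R) (f g F G w : R -> R[i]).

Definition re f : R -> R := fun x => complex.Re (f x).
Definition im f : R -> R := fun x => complex.Im (f x).

Lemma complexP (a b : R[i]) :
  complex.Re a = complex.Re b -> complex.Im a = complex.Im b -> a = b.
Proof. by case: a b => [? ?] [? ?] /= -> ->. Qed.

Lemma aeqP l f g : aeq l f g <-> raeq l (re f) (re g) /\ raeq l (im f) (im g).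
Proof.
split=> [fg|[h1 h2]].
  by split; apply: ae_imp fg => x fg xl; rewrite /re /im fg.
by apply: ae_imp2 h1 h2 => x h1 h2 xl; apply: complexP; [exact: h1|exact: h2].
Qed.

Lemma aeq_sym l f g : aeq l f g -> aeq l g f.
Proof. by apply: ae_imp => x h xl; rewrite h. Qed.
Lemma aeq_trans l f g F : aeq l f g -> aeq l g F -> aeq l f F.
Proof. by apply: ae_imp2 => x h1 h2 xl; rewrite h1// h2. Qed.
Lemma in_L2P l f : in_L2 l f <-> L2 l (re f) /\ L2 l (im f).
Proof.
split.
  move=> [mr mi h].
  have hi : L1 l (fun x => re f x ^+ 2 + im f x ^+ 2).
    apply/integrableP; split.
      by apply/measurable_EFinP; apply: mfunD; exact: mfunX.
    apply: le_lt_trans h; rewrite le_eqVlt; apply/orP; left; apply/eqP.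
    apply: eq_integral => x _ /=; rewrite ger0_norm// addr_ge0 ?sqr_ge0//.
  split; split=> //; apply: L1_dom hi.
  - exact: mfunX.
  - by move=> x _; rewrite ger0_norm ?sqr_ge0// lerDl sqr_ge0.
  - exact: mfunX.
  - by move=> x _; rewrite ger0_norm ?sqr_ge0// lerDr sqr_ge0.
move=> [[mr hr] [mi hi]]; split=> //.
have /integrableP[_] := L1D hr hi; apply: le_lt_trans.
rewrite le_eqVlt; apply/orP; left; apply/eqP.
by apply: eq_integral => x _ /=; rewrite ger0_norm// addr_ge0 ?sqr_ge0.
Qed.

Lemma ReM (a : R) (z : R[i]) : complex.Re (a%:C * z) = a * complex.Re z.
Proof. by case: z => x y /=; rewrite mul0r subr0. Qed.
Lemma ImM (a : R) (z : R[i]) : complex.Im (a%:C * z) = a * complex.Im z.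
Proof. by case: z => x y /=; rewrite mul0r addr0. Qed.

Lemma is_weak_derivativeP l f g : is_weak_derivative l f g <->
  weak_deriv l (re f) (re g) /\ weak_deriv l (im f) (im g).
Proof.
have E (h : R -> R) (k : R -> R[i]) :
    cintegral l (fun x => (h x)%:C * k x) =
    int l (fun x => h x * re k x) +i* int l (fun x => h x * im k x).
  by rewrite /cintegral; congr (_ +i* _); apply: eq_int => x _; rewrite (ReM, ImM).
split=> [h|[hr hi] phi tphi].
  by split=> phi tphi; have := h phi tphi; rewrite !E => -[].
by rewrite !E hr// hi//.
Qed.

Definition cAC l F f : Prop := AC l (re F) (re f) /\ AC l (im F) (im f).

Lemma cAC_L2 l F f : cAC l F f -> in_L2 l f.
Proof. by case=> h1 h2; apply/in_L2P; split; [exact: AC_L2 h1|exact: AC_L2 h2]. Qed.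

Lemma cAC_L2F l F f : cAC l F f -> in_L2 l F.
Proof. by case=> h1 h2; apply/in_L2P; split; [exact: AC_L2F h1|exact: AC_L2F h2]. Qed.

Lemma cAC_weak l F f g : 0 <= l -> in_L2 l f -> cAC l F g -> aeq l F f ->
  is_weak_derivative l f g.
Proof.
move=> l0 /in_L2P[[mr _] [mi _]] [h1 h2] /aeqP[e1 e2]; apply/is_weak_derivativeP.
by split; [exact: AC_weak_deriv h1 e1|exact: AC_weak_deriv h2 e2].
Qed.

Lemma weak_cAC l f g : 0 < l -> in_L2 l f -> in_L2 l g ->
  is_weak_derivative l f g -> exists2 F, cAC l F g & aeq l F f.
Proof.
move=> l0 /in_L2P[fr fi] /in_L2P[gr gi] /is_weak_derivativeP[hr hi].
have [Fr Fr1 Fr2] := weak_deriv_AC l0 fr gr hr.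
have [Fi Fi1 Fi2] := weak_deriv_AC l0 fi gi hi.
by exists (fun x => Fr x +i* Fi x) => //; apply/aeqP.
Qed.

Lemma cAC_unique l F f G g : 0 < l -> cAC l F f -> cAC l G g -> aeq l F G ->
  (forall x, x \in `[0, l] -> F x = G x) /\ aeq l f g.
Proof.
move=> l0 [h1 h2] [h3 h4] /aeqP[e1 e2].
have [d1 d2] := AC_unique l0 h1 h3 e1.
have [d3 d4] := AC_unique l0 h2 h4 e2.
split; last by apply/aeqP.
by move=> x xl; apply: complexP; [exact: d1|exact: d3].
Qed.

(** A weak derivative is a chosen witness; uniqueness of primitives identifies
the choice with any known one. *)
Lemma weak_derivative_cAC l F f g : 0 < l -> in_L2 l f -> cAC l F g ->
  aeq l F f -> aeq l (weak_derivative l f) g /\ in_L2 l (weak_derivative l f).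
Proof.
move=> l0 hf hF Ff.
have h : [set g | in_L2 l g /\ is_weak_derivative l f g] g.
  by split; [exact: cAC_L2 hF|exact: (cAC_weak (ltW l0) hf hF)].
have [h1 h2] := xgetPex (fun=> 0) (ex_intro _ g h).
rewrite -/(weak_derivative l f) in h1 h2; split=> //.
have [G hG Gf] := weak_cAC l0 hf h1 h2.
by case: (cAC_unique l0 hG hF (aeq_trans Gf (aeq_sym Ff))).
Qed.

Lemma trace_cAC l F f g x : 0 < l -> cAC l F g -> aeq l F f ->
  x \in `[0, l] -> trace l f x = F x.
Proof.
move=> l0 hF Ff xl; rewrite /trace; set P := [set c | _].
have PF : P (F x).
  exists F => //; split=> //.
    exact: (AC_continuous hF.1).
  exact: (AC_continuous hF.2).
have := xgetPex 0 (ex_intro _ _ PF) => -[G [cr ci Gf] <-].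
have /aeqP[e1 e2] := aeq_trans Gf (aeq_sym Ff).
apply: complexP.
  exact: (continuous_raeq l0 cr (AC_continuous hF.1) e1).
exact: (continuous_raeq l0 ci (AC_continuous hF.2) e2).
Qed.

(** F is the C^1 representative of f, F1 its derivative and w the second
derivative. *)
Definition H2rep l f F F1 w : Prop := [/\ cAC l F F1, cAC l F1 w & aeq l F f].

(** The primitive of f'' agrees almost everywhere with f', so it can replace
f' in the primitive that represents f. *)
Lemma in_H2_rep l f : 0 < l -> in_H2 l f ->
  in_L2 l f /\ exists F F1 w, H2rep l f F F1 w.
Proof.
move=> l0 [[hf [g [hg fg]]] [hd [w [hw dw]]]]; split=> //.
have [F hF Ff] := weak_cAC l0 hf hg fg.
have [gd _] := weak_derivative_cAC l0 hf hF Ff.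
have [F1 hF1 F1d] := weak_cAC l0 hd hw dw.
have e := aeq_sym (aeq_trans F1d gd); have /aeqP[e1 e2] := e.
exists F, F1, w; split=> //; case: hF => h1 h2; split.
  by apply: AC_raeq h1 => //; exact: AC_mfun hF1.1.
by apply: AC_raeq h2 => //; exact: AC_mfun hF1.2.
Qed.

(** Twice differentiable in the sense of primitives implies H^2, with the
expected derivatives. *)
Lemma H2rep_derivative l f F F1 w : 0 < l -> in_L2 l f -> H2rep l f F F1 w ->
  [/\ in_H2 l f, aeq l (weak_derivative l f) F1 &
      aeq l (weak_derivative l (weak_derivative l f)) w].
Proof.
move=> l0 hf [hF hF1 Ff].
have [d1 d2] := weak_derivative_cAC l0 hf hF Ff.
have [d3 d4] := weak_derivative_cAC l0 d2 hF1 (aeq_sym d1).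
split=> //; split.
  split=> //; exists F1; split; first exact: cAC_L2F hF1.
  exact: (cAC_weak (ltW l0) hf hF).
split=> //; exists w; split; first exact: cAC_L2 hF1.
exact: (cAC_weak (ltW l0) d2 hF1 (aeq_sym d1)).
Qed.

Lemma H2rep_trace l f F F1 w x : 0 < l -> in_L2 l f -> H2rep l f F F1 w ->
  x \in `[0, l] ->
  trace l f x = F x /\ trace l (weak_derivative l f) x = F1 x.
Proof.
move=> l0 hf hr xl; have [hF hF1 Ff] := hr.
have [_ d1 _] := H2rep_derivative l0 hf hr.
split; first exact: (trace_cAC l0 hF).
exact: (trace_cAC l0 hF1 (aeq_sym d1)).
Qed.

End Sobolev.

(** * A Volterra equation by monotone iteration *)

Section Ode.
Context {R : realType}.
Local Notation mu := (@lebesgue_measure R).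
Implicit Types (l x : R) (f g q y : R -> R).

Lemma int_dominated_cvg l (f_ : nat -> R -> R) f g :
  (forall n, mfun_on l (f_ n)) ->
  (forall t, t \in `]0, l[ -> f_ n t @[n --> \oo] --> f t) ->
  L1 l g -> (forall n t, t \in `]0, l[ -> `|f_ n t| <= g t) ->
  mfun_on l f /\ int l (f_ n) @[n --> \oo] --> int l f.
Proof.
move=> mf_ f_f hg fg.
have mf : mfun_on l f by apply: measurable_fun_cvg f_f.
split=> //.
have g0 t : t \in `]0, l[ -> 0 <= g t.
  by move=> tl; apply: le_trans (fg 0%N t tl).
have hf : L1 l f.
  apply: L1_dom hg => // t tl.
  have H : `|f_ n t| @[n --> \oo] --> `|f t| by apply: cvg_norm; exact: f_f.
  rewrite -(cvg_lim (@Rhausdorff _) H); apply: limr_le; first exact: cvgP H.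
  by near=> n; exact: fg.
have := @dominated_cvg _ _ _ mu `]0, l[%classic (measurable_itv _)
  (fun n t => (f_ n t)%:E) (EFin \o f) (EFin \o g).
move=> /(_ _ _ _ _ _)/wrap[].
- by move=> n; apply/measurable_EFinP; exact: mf_.
- by move=> t tl; apply: cvg_EFin; [near=> n|exact: f_f].
- by [].
- exact: hg.
- by move=> n t tl; rewrite /= lee_fin; exact: fg.
rewrite -[X in _ --> X -> _]fineK; last exact: integrable_fin_num.
by move/fine_cvg.
Unshelve. all: by end_near. Qed.

Lemma AC_expR l c : 0 <= l ->
  AC l (fun x => expR (c * x)) (fun x => c * expR (c * x)).
Proof.
move=> l0.
have d (x : R) : is_derive x (1 : R) (fun x => expR (c * x)) (c * expR (c * x)).
  rewrite mulrC; apply: (@is_derive1_comp _ expR (fun x => c * x)).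
  rewrite -[X in is_derive _ _ _ X]mulr1.
  exact: is_deriveZ.
have E : derive1 (fun x => expR (c * x)) = fun x => c * expR (c * x).
  by apply/funext => x; rewrite derive1E derive_val.
rewrite -E; apply: (AC_C1 l0) => [x|]; first exact: (@ex_derive _ _ _ _ _ _ _ (d x)).
rewrite E => x; apply: cvgMr.
apply: continuous_cvg; first exact: continuous_expR.
by apply: cvgMr; exact: cvg_id.
Qed.

Section MonotoneIteration.
Variables (l M B : R) (q y0 : R -> R).
Hypotheses (l0 : 0 <= l) (mq : mfun_on l q) (qb : forall x, 0 <= q x <= M).
Hypotheses (my0 : mfun_on l y0) (y0b : forall x, 0 <= y0 x <= B).

Let step y : R -> R := fun x => y0 x + int x (fun s => int s (fun t => q t * y t)).
Let K := B * expR ((M + 1) * l).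

Let E : R -> R := fun x => expR ((M + 1) * x).
Let good y := mfun_on l y /\ forall x, x \in `[0, l] -> 0 <= y x <= B * E x.

Let M0 : 0 <= M. Proof. by have /andP[h1 h2] := qb 0; lra. Qed.
Let B0 : 0 <= B. Proof. by have /andP[h1 h2] := y0b 0; lra. Qed.

Let E_ge1 x : 0 <= x -> 1 <= E x.
Proof.
move=> x0; have h : 0 <= (M + 1) * x by rewrite mulr_ge0// addr_ge0.
have := expR_ge1Dx ((M + 1) * x); rewrite /E; lra.
Qed.

Let goodK y x : good y -> x \in `[0, l] -> 0 <= y x <= K.
Proof.
move=> [_ gy] xl; have /andP[h1 h2] := gy x xl; rewrite h1/=.
apply: le_trans h2 _; apply: ler_wpM2l => //; rewrite ler_expR.
by move: xl; rewrite in_itv/= => /andP[_ xl]; apply: ler_wpM2l => //; rewrite addr_ge0.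
Qed.

Let good_L2 y : good y -> L2 l (fun t => q t * y t).
Proof.
move=> gy; apply: (@L2_bounded _ _ _ (M * K)); first exact: (mfunM mq gy.1).
move=> t tl; have /andP[q0 qM] := qb t.
have /andP[h1 h2] := goodK gy (subset_itv_oo_cc tl).
by rewrite ger0_norm ?mulr_ge0// ler_pM.
Qed.

Let good_AC y : good y ->
  AC l (fun s => 0 + int s (fun t => q t * y t)) (fun t => q t * y t) /\
  AC l (fun x => 0 + int x (fun s => 0 + int s (fun t => q t * y t)))
       (fun s => 0 + int s (fun t => q t * y t)).
Proof.
move=> gy; have h := AC_int 0 (good_L2 gy); split=> //.
by apply: AC_int; exact: AC_L2F h.
Qed.

Let stepE y x : step y x = y0 x + (0 + int x (fun s => 0 + int s (fun t => q t * y t))).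
Proof.
by rewrite /step add0r; under [in RHS]eq_int do rewrite add0r.
Qed.

Let int_mono x y z : x \in `[0, l] -> good y -> good z ->
  (forall t, t \in `[0, l] -> y t <= z t) ->
  step y x <= step z x.
Proof.
move=> xl gy gz yz; rewrite !stepE lerD2l !add0r.
have S s : s \in `]0, x[ -> s \in `[0, l].
  move: xl; rewrite !in_itv/= => /andP[x0 xl] /andP[s0 sx].
  by rewrite ltW// (le_trans (ltW sx)).
move: (xl); rewrite in_itv/= => /andP[x0 xl'].
apply: le_int.
- exact: (L1S xl' (L2_L1 (AC_L2F (good_AC gy).1))).
- exact: (L1S xl' (L2_L1 (AC_L2F (good_AC gz).1))).
move=> s /S sl; rewrite !add0r; move: (sl); rewrite in_itv/= => /andP[s0 sl'].
apply: le_int.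
- exact: (L1S sl' (L2_L1 (good_L2 gy))).
- exact: (L1S sl' (L2_L1 (good_L2 gz))).
move=> t; rewrite in_itv/= => /andP[t0 ts]; apply: ler_wpM2l.
  by case/andP: (qb t).
by apply: yz; rewrite in_itv/= ltW// (le_trans (ltW ts)).
Qed.

(** The exponential bound is preserved because the square of its rate, (M + 1)^2, exceeds q. *)
Let good_step y : good y -> good (step y).
Proof.
move=> gy; split.
  rewrite (_ : step y = fun x => y0 x + (0 + int x (fun s => 0 + int s (fun t => q t * y t)))).
    by apply: (mfunD my0); exact: AC_mfun (good_AC gy).2.
  by apply/funext => x; rewrite stepE.
move=> x xl; have /andP[a0 aB] := y0b x.
move: (xl); rewrite in_itv/= => /andP[x0 xl'].
have i0 : 0 <= int x (fun s => int s (fun t => q t * y t)).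
  apply: int_ge0 => s; rewrite in_itv/= => /andP[s0 sx]; apply: int_ge0 => t.
  rewrite in_itv/= => /andP[t0 ts]; apply: mulr_ge0; first by case/andP: (qb t).
  have tl : t \in `[0, l] by rewrite in_itv/= ltW//=; lra.
  by case/andP: (gy.2 t tl).
rewrite /step addr_ge0//=.
pose c := M + 1.
have c0 : 0 < c by rewrite /c ltr_wpDl.
have AE := AC_expR c l0.
have AE2 := ACZ (c^-1 * (M * B)) AE.
have i2 s : s \in `[0, l] -> int s (fun t => q t * y t) <= (c^-1 * (M * B)) * E s.
  move=> sl; move: (sl); rewrite in_itv/= => /andP[s0 sl'].
  have E1 := AE2.2 s sl; rewrite mulr0 expR0 in E1.
  apply: (le_trans (y := int s (fun t => c^-1 * (M * B) * (c * expR (c * t))))).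
    apply: le_int.
    - exact: (L1S sl' (L2_L1 (good_L2 gy))).
    - exact: (L1S sl' (L2_L1 AE2.1)).
    move=> t; rewrite in_itv/= => /andP[t0 ts].
    have tl : t \in `[0, l] by rewrite in_itv/= ltW//=; lra.
    rewrite [leRHS](_ : _ = M * (B * E t)); last by rewrite /E -/c; field; rewrite gt_eqF.
    have /andP[q0 qM] := qb t; have /andP[y1 y2] := gy.2 t tl.
    exact: ler_pM.
  have : 0 <= c^-1 * (M * B) by rewrite !mulr_ge0// invr_ge0 ltW.
  rewrite /E -/c; lra.
have AE3 := ACZ (c^-1 * (c^-1 * (M * B))) AE.
have E3 := AE3.2 x xl; rewrite mulr0 expR0 in E3.
have i3 : int x (fun s => int s (fun t => q t * y t)) <= c^-1 * (c^-1 * (M * B)) * (E x - 1).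
  rewrite [leRHS](_ : _ = int x (fun t => c^-1 * (c^-1 * (M * B)) * (c * expR (c * t)))); last first.
    by rewrite /E -/c; lra.
  apply: le_int.
  - have := (L1S xl' (L2_L1 (AC_L2F (good_AC gy).1))).
    by under eq_fun do rewrite add0r.
  - exact: (L1S xl' (L2_L1 AE3.1)).
  move=> t; rewrite in_itv/= => /andP[t0 tx].
  have tl : t \in `[0, l] by rewrite in_itv/= ltW//=; lra.
  apply: le_trans (i2 t tl) _.
  by rewrite le_eqVlt; apply/orP; left; apply/eqP; rewrite /E -/c; field; rewrite gt_eqF.
have h : c^-1 * (c^-1 * (M * B)) * (E x - 1) <= B * (E x - 1).
  apply: ler_wpM2r; first by rewrite subr_ge0 E_ge1.
  rewrite !mulrA ler_piMl// -invfM mulrC ler_pdivrMr ?mulr_gt0// mul1r /c; nra.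
lra.
Qed.

Let Y n := iter n step (fun _ => 0).

Let good_Y n : good (Y n).
Proof.
elim: n => [|n IHn]; last exact: good_step.
split; first exact: mfun_cst.
by move=> x xl; rewrite lexx/= mulr_ge0// expR_ge0.
Qed.

Let Y_mono x : x \in `[0, l] -> {homo Y^~ x : m n / (m <= n)%N >-> m <= n}.
Proof.
move=> xl; apply: (@homo_leq _ (Y^~ x) (fun a b => a <= b)) => //.
- by move=> a b c; exact: le_trans.
move=> n; elim: n x xl => [|n IHn] x xl.
  by case/andP: ((good_Y 1).2 x xl).
exact: (int_mono xl (good_Y n) (good_Y n.+1) IHn).
Qed.

(** Picard iteration started at 0. Since q and y0 are nonnegative, the
iterates increase, and they stay below B * expR ((M + 1) x); so they converge
to a nonnegative solution, by dominated convergence. *)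
Lemma volterra_solution : exists y,
  [/\ L2 l (fun t => q t * y t), forall x, x \in `[0, l] -> 0 <= y x &
    forall x, x \in `[0, l] ->
      y x = y0 x + int x (fun s => int s (fun t => q t * y t))].
Proof.
pose y x := limn (Y^~ x).
have Yy x : x \in `[0, l] -> Y n x @[n --> \oo] --> y x.
  move=> xl; apply: nondecreasing_is_cvgn; first exact: Y_mono.
  by exists K => _ [n _ <-]; case/andP: (goodK (good_Y n) xl).
have gy : good y.
  split.
    apply: (@measurable_fun_cvg _ _ _ _ Y); first by move=> n; case: (good_Y n).
    by move=> x xl; apply: Yy; exact: subset_itv_oo_cc.
  move=> x xl; apply/andP; split.
    apply: limr_ge; first exact: cvgP (Yy x xl).
    by near=> n; case/andP: ((good_Y n).2 x xl).
  apply: limr_le; first exact: cvgP (Yy x xl).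
  by near=> n; case/andP: ((good_Y n).2 x xl).
exists y; split; [exact: good_L2|by move=> x /gy.2/andP[]|].
move=> x xl.
have i1 s : s \in `[0, l] ->
   int s (fun t => q t * Y n t) @[n --> \oo] --> int s (fun t => q t * y t).
  rewrite in_itv/= => /andP[s0 sl].
  have S t : t \in `]0, s[ -> t \in `[0, l].
    by rewrite !in_itv/= => /andP[t0 ts]; rewrite ltW//=; lra.
  have [||||_ //] := @int_dominated_cvg s (fun n t => q t * Y n t) (fun t => q t * y t) (fun _ => M * K).
  - by move=> n; case: (L2S sl (good_L2 (good_Y n))).
  - by move=> t /S tl; apply: cvgMr; exact: Yy.
  - exact: L1_cst.
  move=> n t /S tl; have /andP[q0 qM] := qb t.
  have /andP[h1 h2] := goodK (good_Y n) tl.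
  by rewrite ger0_norm ?mulr_ge0// ler_pM.
have i2 : int x (fun s => int s (fun t => q t * Y n t)) @[n --> \oo] -->
          int x (fun s => int s (fun t => q t * y t)).
  move: (xl); rewrite in_itv/= => /andP[x0 xl'].
  have S t : t \in `]0, x[ -> t \in `[0, l].
    by rewrite !in_itv/= => /andP[t0 ts]; rewrite ltW//=; lra.
  have [||||_ //] := @int_dominated_cvg x (fun n s => int s (fun t => q t * Y n t))
    (fun s => int s (fun t => q t * y t)) (fun s => M * K * s).
  - move=> n; have [] := L2S xl' (AC_L2F (good_AC (good_Y n)).1).
    by under eq_fun do rewrite add0r.
  - by move=> s /S; exact: i1.
  - apply/L1Z; have := L2_L1 (AC_L2F (AC_id 0 x0)).
    by under eq_fun do rewrite subr0.
  move=> n s sx; have sl := S s sx; move: (sl); rewrite in_itv/= => /andP[s0 sl'].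
  have hL := L1S sl' (L2_L1 (good_L2 (good_Y n))).
  apply: le_trans (le_norm_int hL) _.
  rewrite -(int_cst (M * K) s0); apply: le_int; [exact: L1_norm|exact: L1_cst|].
  move=> t; rewrite in_itv/= => /andP[t0 ts].
  have tl : t \in `[0, l] by rewrite in_itv/= ltW//=; lra.
  have /andP[q0 qM] := qb t; have /andP[h1 h2] := goodK (good_Y n) tl.
  by rewrite ger0_norm ?mulr_ge0// ler_pM.
have H1 : Y n.+1 x @[n --> \oo] --> y x by have := Yy x xl; rewrite -(cvg_shiftS _).
have H2 : Y n.+1 x @[n --> \oo] --> y0 x + int x (fun s => int s (fun t => q t * y t)).
  by apply: cvgD; [exact: cvg_cst|exact: i2].
exact: (cvg_unique (@Rhausdorff _) H1 H2).
Unshelve. all: by end_near. Qed.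

End MonotoneIteration.
End Ode.

(** * Two-point boundary value problems *)

Section Boundary.
Context {R : realType}.
Implicit Types (l x : R) (f g q y : R -> R).
Variables (l M : R) (q : R -> R).
Hypotheses (l0 : 0 < l) (mq : mfun_on l q) (qb : forall x, 0 <= q x <= M).

(** The initial value problem y'' = q y as an integral equation. The lower
bound comes from the nonnegativity of the double integral. *)
Lemma volterra_ode (a b : R) : 0 <= a -> 0 <= b ->
  exists g g1, [/\ AC l g g1, AC l g1 (fun x => q x * g x), g 0 = a, g1 0 = b &
     forall x, x \in `[0, l] -> a + b * x <= g x].
Proof.
move=> a0 b0; have l0' := ltW l0.
(* the affine function a + b x on [0, l], made bounded on the line *)
pose y0 x := a + b * Num.max 0 (Num.min x l).
have y0b x : 0 <= y0 x <= a + b * l.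
  have h0 : 0 <= Num.max 0 (Num.min x l) by rewrite le_max lexx.
  have hl : Num.max 0 (Num.min x l) <= l by rewrite ge_max l0' ge_min lexx orbT.
  by rewrite addr_ge0 ?mulr_ge0//= lerD2l ler_wpM2l.
have y0E x : x \in `[0, l] -> y0 x = a + b * x.
  rewrite in_itv/= => /andP[x0 xl]; rewrite /y0.
  by rewrite (min_idPl xl) (max_idPr x0).
have A0 : AC l (fun x => a + b * (x - 0)) (fun x => 0 + b * 1).
  exact: (ACD (AC_cst l a) (ACZ b (AC_id 0 l0'))).
have my0 : mfun_on l y0.
  have A1 := AC_mfun A0; apply: AC_mfun (AC_eq _ l0' A0) => x xl.
  by rewrite y0E// subr0.
have [y [hy y_ge0 yE]] := volterra_solution l0' mq qb my0 y0b.
pose J1 s := 0 + int s (fun t => q t * y t).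
pose J x := 0 + int x J1.
have hJ1 : AC l J1 (fun t => q t * y t) by exact: AC_int.
have hJ : AC l J J1 by apply: AC_int; exact: AC_L2F hJ1.
pose g x := a + b * (x - 0) + J x.
have gy x : x \in `[0, l] -> g x = y x.
  move=> xl; rewrite yE// y0E// /g subr0 /J add0r; congr (_ + _).
  by apply: eq_int => t _; rewrite /J1 add0r.
exists g, (fun x => (0 + b * 1) + J1 x); split.
- exact: ACD.
- have H := ACD (AC_cst l (0 + b * 1)) hJ1.
  have qg t : t \in `]0, l[ -> 0 + q t * y t = q t * g t.
    by move=> tl; rewrite add0r gy//; exact: subset_itv_oo_cc.
  apply: AC_raeq H; last exact: raeq_eq.
  by apply: (mfunM mq); exact: AC_mfun (ACD A0 hJ).
- by rewrite /g /J int0 subrr mulr0 !addr0.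
- by rewrite /J1 int0 mulr1 !addr0 add0r.
move=> x xl; rewrite /g subr0 lerDl /J add0r; apply: int_ge0 => s.
move: xl; rewrite !in_itv/= => /andP[x0 xl] /andP[s0 sx]; rewrite /J1 add0r.
apply: int_ge0 => t; rewrite in_itv/= => /andP[t0 ts].
apply: mulr_ge0; first by case/andP: (qb t).
by apply: y_ge0; rewrite in_itv/= ltW//=; lra.
Qed.

(** Shooting: the solution k with k(0) = 0 and k'(0) = 1 satisfies k(l) >= l >
0, so a multiple of it corrects the value at l. *)
Lemma boundary_value_problem (a b : R) :
  exists g g1, [/\ AC l g g1, AC l g1 (fun x => q x * g x), g 0 = a & g l = b].
Proof.
have [g [g1 [hg hg1 g0 _ _]]] := volterra_ode ler01 (lexx 0).
have [k [k1 [hk hk1 k0 _ kx]]] := volterra_ode (lexx 0) ler01.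
have kl : 0 < k l.
  apply: lt_le_trans (kx l _); first by rewrite add0r mul1r.
  by rewrite in_itv/= lexx ltW.
pose c := (b - a * g l) / k l.
exists (fun x => a * g x + c * k x), (fun x => a * g1 x + c * k1 x); split.
- exact: (ACD (ACZ a hg) (ACZ c hk)).
- have := ACD (ACZ a hg1) (ACZ c hk1).
  by congr AC; apply/funext => x; ring.
- by rewrite g0 k0; ring.
- by rewrite /c; field; rewrite gt_eqF.
Qed.

(** Multiplying g'' = q g by g and integrating by parts shows that g'
vanishes; this uses q >= 0. *)
Lemma boundary_value_unique g g1 : AC l g g1 -> AC l g1 (fun x => q x * g x) ->
  g 0 = 0 -> g l = 0 -> forall x, x \in `[0, l] -> g x = 0.
Proof.
move=> hg hg1 g0 gl x xl.
have := AC_parts (ltW l0) hg hg1; rewrite g0 gl !mul0r subr0 => E.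
have h1 : 0 <= int l (fun x => g1 x * g1 x).
  by apply: int_ge0 => t _; rewrite -expr2 sqr_ge0.
have h2 : 0 <= int l (fun x => g x * (q x * g x)).
  apply: int_ge0 => t _; rewrite mulrCA mulr_ge0//; first by case/andP: (qb t).
  by rewrite -expr2 sqr_ge0.
have z : int l (fun x => g1 x ^+ 2) = 0.
  rewrite (@eq_int _ _ _ (fun x => g1 x * g1 x)); first lra.
  by move=> t _; rewrite expr2.
have g1z := L2_int_sqr_eq0 (AC_L2F hg1) z.
have := (AC_raeq (mfun_cst 0) g1z hg).2 x xl.
move: xl; rewrite in_itv/= => /andP[x0 _].
by rewrite g0 int_cst// mul0r addr0.
Qed.

End Boundary.

(** * Completeness of the space of square-integrable functions *)

Section RieszFischer.
Context {R : realType}.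
Local Notation mu := (@lebesgue_measure R).
Implicit Types (l x : R) (w : nat -> R -> R).

Lemma sum_half_pow_le n : \sum_(0 <= k < n) (2^-1 : R) ^+ k <= 2.
Proof.
suff -> : \sum_(0 <= k < n) (2^-1 : R) ^+ k = 2 - 2 * 2^-1 ^+ n.
  by rewrite gerBl mulr_ge0// exprn_ge0// invr_ge0.
elim: n => [|n IHn]; first by rewrite big_nil expr0; lra.
by rewrite big_nat_recr//= IHn exprS; lra.
Qed.

Lemma rapid_tail l w (C : R) : (forall k, L2 l (w k)) ->
  (forall k, int l (fun x => (w k.+1 x - w k x) ^+ 2) <= C * 4^-1 ^+ k) ->
  forall n k, int l (fun x => (w (k + n)%N x - w k x) ^+ 2) <= 4 * C * 4^-1 ^+ k.
Proof.
move=> hw rapid; elim=> [|n IHn] k.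
  rewrite addn0 (@eq_int _ _ _ (fun _ => 0 * 1)); last first.
    by move=> x _; rewrite subrr expr0n/= mul0r.
  rewrite (intZ _ (L1_cst l 1)) mul0r -mulrA; have := rapid k.
  have := @int_ge0 _ l (fun x => (w k.+1 x - w k x) ^+ 2) (fun x _ => sqr_ge0 _).
  lra.
have h1 := L2B (hw k.+1) (hw k); have h2 := L2B (hw (k.+1 + n)%N) (hw k.+1).
apply: (le_trans (y := int l (fun x => 2 * (w k.+1 x - w k x) ^+ 2
    + 2 * (w (k.+1 + n)%N x - w k.+1 x) ^+ 2))).
  rewrite addnS -addSn; apply: le_int.
  - exact: (L2B (hw (k.+1 + n)%N) (hw k)).2.
  - by apply: L1D; apply: L1Z; [exact: h1.2|exact: h2.2].
  move=> x _.
  have := sqr_ge0 (w k.+1 x - w k x - (w (k.+1 + n)%N x - w k.+1 x)); nra.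
rewrite (intD (L1Z 2 h1.2) (L1Z 2 h2.2)) (intZ _ h1.2) (intZ _ h2.2).
have := rapid k; have := IHn k.+1; rewrite exprS; lra.
Qed.

(** The sum of the norms of the increments is integrable, hence finite almost
everywhere, so the telescoping series converges absolutely there. *)
Lemma rapid_ae_cvg l w (C : R) : 0 <= l -> (forall k, L2 l (w k)) ->
  (forall k, int l (fun x => (w k.+1 x - w k x) ^+ 2) <= C * 4^-1 ^+ k) ->
  {ae mu, forall x, x \in `]0, l[ -> cvgn (w^~ x)}.
Proof.
move=> l0 hw rapid.
have C0 : 0 <= C.
  have := rapid 0%N; rewrite expr0 mulr1; apply: le_trans.
  by apply: int_ge0 => x _; exact: sqr_ge0.
have hd k : L2 l (fun x => w k.+1 x - w k x) by exact: L2B.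
have hd1 k : L1 l (fun x => `|w k.+1 x - w k x|) by exact/L1_norm/L2_L1.
pose c := 1 + l * C.
have intd k : int l (fun x => `|w k.+1 x - w k x|) <= c * 2^-1 ^+ k.
  have hn : L2 l (fun x => `|w k.+1 x - w k x|).
    by split; [exact: L1_mfun (hd1 k)|under eq_fun do rewrite real_normK ?num_real//; exact: (hd k).2].
  have := L2_cauchy_schwarz hn (L2_cst l 1).
  under eq_int do rewrite mulr1.
  under [X in _ * X]eq_int do rewrite expr1n.
  rewrite int_cst// mul1r; under [X in _ <= X * _]eq_int do rewrite real_normK ?num_real//.
  move=> h.
  have p2 : 0 <= (2^-1 : R) ^+ k by rewrite exprn_ge0// invr_ge0.
  have h2 : int l (fun x => `|w k.+1 x - w k x|) ^+ 2 <= (c * 2^-1 ^+ k) ^+ 2.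
    apply: le_trans h _; apply: le_trans (ler_wpM2r l0 (rapid k)) _.
    have -> : (4^-1 : R) ^+ k = 2^-1 ^+ k * 2^-1 ^+ k.
      by rewrite -exprMn; congr (_ ^+ _); field.
    rewrite [leLHS](_ : _ = (l * C) * (2^-1 ^+ k) ^+ 2); last by ring.
    rewrite exprMn; apply: ler_wpM2r; first exact: sqr_ge0.
    have := mulr_ge0 l0 C0; rewrite /c; nra.
  move: h2; rewrite ler_pXn2r// nnegrE; last by rewrite mulr_ge0// /c addr_ge0// mulr_ge0.
  by apply: int_ge0.
pose d k x : \bar R := (`|w k.+1 x - w k x|)%:E.
have md k : measurable_fun (`]0, l[%classic : set R) (d k).
  by apply/measurable_EFinP; exact: L1_mfun (hd1 k).
have d0 k x : (`]0, l[%classic : set R) x -> (0 <= d k x)%E by rewrite lee_fin.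
pose D x := (\sum_(0 <= k <oo) d k x)%E.
have iD : mu.-integrable `]0%R, l[%classic D.
  apply/integrableP; split.
    apply: (@ge0_emeasurable_sum _ _ _ _ d xpredT) => k; last by move=> _; exact: md.
    by move=> x xl ?; exact: (d0 k x xl).
  have -> : (\int[mu]_(x in `]0%R, l[) `|D x| = \int[mu]_(x in `]0%R, l[) D x)%E.
    by apply: eq_integral => x _; rewrite gee0_abs// nneseries_ge0// => k _ _; rewrite lee_fin.
  rewrite integral_nneseries//.
  apply: (@le_lt_trans _ _ (c * 2)%:E); last exact: ltry.
  apply: lime_le; first by apply: is_cvg_nneseries => k _ _; apply: integral_ge0 => x _; rewrite lee_fin.
  apply: nearW => n.
  have E k : (\int[mu]_(x in `]0%R, l[) d k x)%E = (int l (fun x => `|w k.+1 x - w k x|))%:E.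
    by rewrite /int /Rintegral fineK//; exact: integrable_fin_num (hd1 k).
  under eq_bigr do rewrite E.
  rewrite sumEFin lee_fin.
  apply: le_trans (ler_sum _ (fun k _ => intd k)) _.
  rewrite -mulr_sumr; apply: ler_wpM2l; last exact: sum_half_pow_le.
  by rewrite /c addr_ge0// mulr_ge0.
have := integrable_ae _ iD; move=> /(_ (measurable_itv _)).
apply: ae_imp => x Dx xl; have {}Dx := Dx xl.
have : cvgn (series (telescope (w^~ x))).
  apply: normed_cvg; apply: nondecreasing_is_cvgn.
    by apply: nondecreasing_series => n _ _; exact: normr_ge0.
  exists (fine (D x)) => _ [n _ <-].
  rewrite -lee_fin fineK//.
  rewrite /series/= -sumEFin.
  by apply: (@nneseries_lim_ge _ (fun k => d k x) xpredT 0 n) => k _ _; exact: d0.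
rewrite telescopeK => /cvg_ex[z zP].
apply/cvg_ex; exists (z + w 0%N x).
have -> : w^~ x = (fun n => (w n x - w 0%N x) + w 0%N x) by apply/funext => n; rewrite subrK.
by apply: cvgD => //; exact: cvg_cst.
Qed.

(** The upper limit is a measurable candidate, equal almost everywhere to the
limit; Fatou's lemma gives the rate. *)
Theorem riesz_fischer l w (C : R) : 0 <= l -> (forall k, L2 l (w k)) ->
  (forall k, int l (fun x => (w k.+1 x - w k x) ^+ 2) <= C * 4^-1 ^+ k) ->
  exists2 v, L2 l v &
    forall k, int l (fun x => (w k x - v x) ^+ 2) <= 4 * C * 4^-1 ^+ k.
Proof.
move=> l0 hw rapid.
pose v x := fine (limn_esup (fun k => (w k x)%:E)).
have mv : mfun_on l v.
  have H : measurable_fun (`]0%R, l[%classic : set R) (fun x => limn_esup (fun k => (w k x)%:E)).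
    apply: measurable_fun_limn_esup => k; apply/measurable_EFinP; by case: (hw k).
  by apply: (measurableT_comp _ H); exact: fine_measurable.
have cv : {ae mu, forall x, x \in `]0, l[ -> w k x @[k --> \oo] --> v x}.
  apply: ae_imp (rapid_ae_cvg l0 hw rapid) => x cx xl.
  have /cvg_ex[z zP] := cx xl.
  suff -> : v x = z by [].
  rewrite /v is_cvg_limn_esupE; last by apply/cvg_ex; exists z%:E; apply: cvg_EFin => //; near=> n.
  by rewrite (@cvg_lim _ _ _ _ _ _ z%:E)//; apply: cvg_EFin => //; near=> n.
have fat k : (\int[mu]_(x in `]0%R, l[) ((w k x - v x) ^+ 2)%:E <= (4 * C * 4^-1 ^+ k)%:E)%E.
  have mk n : measurable_fun (`]0%R, l[%classic : set R) (fun x => ((w k x - w n x) ^+ 2)%:E).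
    by apply/measurable_EFinP; case: (L2B (hw k) (hw n)) => H _; exact: mfunX.
  have := fatou mu (measurable_itv `]0%R, l[) mk _.
  move=> /(_ _)/wrap[]; first by move=> n x _; rewrite lee_fin sqr_ge0.
  move=> F; apply: le_trans (le_trans F _).
    rewrite le_eqVlt; apply/orP; left; apply/eqP; apply: ae_eq_integral => //.
    - by apply/measurable_EFinP; apply: mfunX; apply: mfunB => //; case: (hw k).
    - rewrite /limn_einf; apply: measurableT_comp => //.
      by apply: measurable_fun_limn_esup => n; apply: measurableT_comp => //; exact: mk.
    apply: ae_imp cv => x cx xl /=.
    have H : ((w k x - w n x) ^+ 2)%:E @[n --> \oo] --> ((w k x - v x) ^+ 2)%:E.
      apply: cvg_EFin; first by near=> n.
      have H1 : w k x - w n x @[n --> \oo] --> w k x - v x.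
        by apply: cvgB; [exact: cvg_cst|exact: cx].
      exact: (cvgM H1 H1).
    by rewrite is_cvg_limn_einfE; [rewrite (cvg_lim _ H)|apply/cvg_ex; eexists; exact: H].
  rewrite limn_einf_lim; apply: lime_le; first exact: is_cvg_einfs.
  near=> n; apply: (@le_trans _ _ (\int[mu]_(x in `]0%R, l[) ((w k x - w n x) ^+ 2)%:E)%E).
    by apply: ereal_inf_lbound; exists n => //=.
  have kn : (k <= n)%N by near: n; exists k.
  have hkn := L2B (hw k) (hw n).
  rewrite -[leLHS]fineK; last exact: integrable_fin_num hkn.2.
  rewrite lee_fin -(subnKC kn).
  have := rapid_tail hw rapid (n - k) k; apply: le_trans.
  apply: le_int; [exact: (L2B (hw k) (hw (k + (n - k))%N)).2| |].
    exact: (L2B (hw (k + (n - k))%N) (hw k)).2.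
  by move=> x _; rewrite -sqrrN opprB.
have Lk k : L2 l (fun x => w k x - v x).
  have mkv : mfun_on l (fun x => w k x - v x) by apply: mfunB => //; case: (hw k).
  split=> //; apply/integrableP; split.
    by apply/measurable_EFinP; exact: mfunX.
  apply: le_lt_trans (ltry (4 * C * 4^-1 ^+ k)); apply: le_trans (fat k).
  by rewrite le_eqVlt; apply/orP; left; apply/eqP; apply: eq_integral => x _ /=;
    rewrite ger0_norm// sqr_ge0.
exists v.
  have := L2B (hw 0%N) (Lk 0%N).
  by congr L2; apply/funext => x; rewrite subKr.
move=> k; rewrite -lee_fin; apply: le_trans (fat k).
rewrite le_eqVlt; apply/orP; left; apply/eqP; rewrite fineK//.
exact: integrable_fin_num (Lk k).2.
Unshelve. all: by end_near. Qed.

End RieszFischer.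

(** * Borel versions of Lebesgue measurable potentials *)

Section BorelVersion.
Context {R : realType}.
Local Notation mu := (@lebesgue_measure R).
Local Notation lebesgueType := (g_sigma_algebraType (completed_algebra_gen mu)).

Lemma lebesgue_measurable_decomp (A : set R) :
  measurable (A : set lebesgueType) ->
  exists B N : set R, [/\ measurable B, mu.-negligible N & A = B `|` N].
Proof.
rewrite /measurable/= => mA.
have : (completed_algebra_gen mu).-sigma.-measurable A by exact: mA.
rewrite g_sigma_completed_algebra_genE => -[B mB [N nN <-]].
by exists B, N.
Qed.

Lemma borel_lebesgue_measurable (B : set R) : measurable B ->
  measurable (B : set lebesgueType).
Proof.
move=> mB; apply: sub_sigma_algebra.
by exists B => //; exists set0; [exact: negligible_set0|rewrite setU0].
Qed.

(** Each superlevel set {q > c} agrees with a Borel set up to a null set. The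
function q' is the supremum, over truncated rational levels c, of c times the
indicator of the Borel set; off a countable union of null sets it equals q. *)
Lemma borel_version (l M : R) (q : R -> R) :
  measurable_fun (`]0, l[ : set lebesgueType) (q : lebesgueType -> R) ->
  (forall x, x \in `]0, l[ -> `|q x| <= M) ->
  {ae mu, forall x, x \in `]0, l[ -> 0 <= q x} ->
  0 <= M ->
  exists2 q' : R -> R, measurable_fun setT q' /\ (forall x, 0 <= q' x <= M) & raeq l q q'.
Proof.
move=> mq qM q0 M0.
pose O : set R := `]0, l[%classic.
have mOl : measurable (O : set lebesgueType).
  by apply: borel_lebesgue_measurable; exact: measurable_itv.
(* Levels are truncated to [0, M] so that q' takes values there everywhere,
   and not only almost everywhere. *)
pose c n : R := Num.max 0 (Num.min M (ratr (odflt 0 (@unpickle rat n)))).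
have c0 n : 0 <= c n by rewrite le_max lexx.
have cM n : c n <= M by rewrite ge_max M0 ge_min lexx.
have dec n : exists BN : set R * set R, [/\ measurable BN.1, mu.-negligible BN.2 &
    O `&` q @^-1` `]c n, +oo[ = BN.1 `|` BN.2].
  have := lebesgue_measurable_decomp (mq mOl `]c n, +oo[%classic (measurable_itv _)).
  by move=> [B [N [h1 h2 h3]]]; exists (B, N).
have [BN BNP] := choice dec.
pose h n (x : R) : R := c n * \1_((BN n).1) x.
have h0 n x : 0 <= h n x by rewrite mulr_ge0// indicE.
have hM n x : h n x <= M.
  by apply: le_trans (cM n); rewrite /h indicE; case: (_ \in _); rewrite ?mulr1 ?mulr0.
have hub x : has_ubound (range (h^~ x)) by exists M => _ [n _ <-].
pose q' x := sups (h^~ x) 0.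
have q'ge n x : h n x <= q' x.
  apply: ub_le_sup; first by exists M => _ [m _ <-].
  by exists n.
have q'le x y : (forall n, h n x <= y) -> q' x <= y.
  by move=> hy; apply: ge_sup; [exists (h 0%N x); exists 0%N|move=> _ [n _ <-]].
exists q'; first split.
- apply: measurable_fun_sups => // n.
  apply: measurable_funM; first exact: measurable_cst.
  by apply: measurable_indic; case: (BNP n).
- move=> x; apply/andP; split; first exact: le_trans (h0 0%N x) (q'ge 0%N x).
  exact: q'le.
have nN : mu.-negligible (\bigcup_n (BN n).2).
  by apply: negligible_bigcup => n; case: (BNP n).
have aN : {ae mu, forall x, ~ (\bigcup_n (BN n).2) x}.
  by apply: negligibleS nN => x /= /contrapT.
apply: ae_imp2 q0 aN => x q0 xN xl; have {}q0 := q0 xl.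
have BE n : (BN n).1 x <-> c n < q x.
  case: (BNP n) => _ _ E; split=> [Bx|cq].
    have : ((BN n).1 `|` (BN n).2) x by left.
    by rewrite -E => -[_] /=; rewrite in_itv/= andbT.
  have : (O `&` q @^-1` `]c n, +oo[) x by split => //=; rewrite in_itv/= andbT.
  by rewrite E => -[//|Nx]; case: xN; exists n.
apply/le_anti/andP; split.
  rewrite leNgt; apply/negP => lt.
  have q'0 : 0 <= q' x by exact: le_trans (h0 0%N x) (q'ge 0%N x).
  have /rat_in_itvoo[r] := lt; rewrite in_itv/= => /andP[r1 r2].
  have cr : c (pickle r) = ratr r.
    rewrite /c pickleK/= (min_idPr _); last first.
      by apply: ltW; apply: lt_le_trans r2 _; apply: le_trans (qM x xl); exact: ler_norm.
    by rewrite (max_idPr _)//; exact: le_trans q'0 (ltW r1).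
  have := q'ge (pickle r) x; rewrite /h indicE mem_set; last by apply/BE; rewrite cr.
  by rewrite mulr1 cr leNgt r1.
apply: q'le => n; rewrite /h indicE.
case: (boolP (x \in (BN n).1)) => [|_]; last by rewrite mulr0.
by rewrite inE => /BE/ltW; rewrite mulr1.
Qed.

End BorelVersion.

(** * Edgewise square-integrable families as a vector space *)

Section L2Space.
Context {R : realType} (E : finType) (len : E -> R).

(** Families of functions, not classes: all forms on this space only depend on
classes, and null vectors are dealt with by [independent_mod]. *)
Definition L2fam : {pred E -> R -> R} := mem [set w | forall e, L2 (len e) (w e)].

Lemma L2fam_submod_closed : submod_closed L2fam.
Proof.
split; first by rewrite inE => e; exact: L2_cst.
move=> k u v; rewrite !inE => hu hv e; apply: L2D; last exact: hv.
by apply: (L2Z k).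
Qed.

HB.instance Definition _ := GRing.isSubmodClosed.Build R (E -> R -> R) L2fam L2fam_submod_closed.

Record L2space := MkL2space { L2val :> E -> R -> R ; L2valP : L2val \in L2fam }.
HB.instance Definition _ := [isSub for L2val].
HB.instance Definition _ := [Choice of L2space by <:].
HB.instance Definition _ := [SubChoice_isSubLmodule of L2space by <:].

Lemma L2spaceP (w : L2space) e : L2 (len e) (w e).
Proof. by have := L2valP w; rewrite inE; apply. Qed.

Lemma L2valE k (u v : L2space) e x : (k *: u + v) e x = k * u e x + v e x.
Proof. by []. Qed.

End L2Space.

(** * Inverting the second derivative with zero end values *)

Section Dirichlet.
Context {R : realType}.
Implicit Types (l x : R) (u w : R -> R).

(** The derivative of the function with second derivative w and zero values at
0 and l; [dir0] is this function. *)
Definition dir1 l w x : R := - (int l (fun t => int t w) / l) + int x w.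
Definition dir0 l w x : R := 0 + int x (dir1 l w).

Lemma dir1_AC l w : L2 l w -> AC l (dir1 l w) w.
Proof. exact: AC_int. Qed.

Lemma dir0_AC l w : L2 l w -> AC l (dir0 l w) (dir1 l w).
Proof. by move=> hw; apply: AC_int; exact: AC_L2F (dir1_AC hw). Qed.

Lemma dir0E l w x : dir0 l w x = int x (dir1 l w).
Proof. exact: add0r. Qed.

Lemma dir0_0 l w : dir0 l w 0 = 0.
Proof. by rewrite /dir0 int0 addr0. Qed.

Lemma dir0_l l w : 0 < l -> L2 l w -> dir0 l w l = 0.
Proof.
move=> l0 hw; rewrite /dir0 add0r /dir1.
have h := AC_L2F (AC_int 0 hw).
have h' : L1 l (fun x => int x w).
  by apply: L2_L1; move: h; under eq_fun do rewrite add0r.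
rewrite (intD (L1_cst l _) h') int_cst ?ltW//.
by field; rewrite gt_eqF.
Qed.

Lemma dir_unique l w u u1 : 0 < l -> AC l u u1 -> AC l u1 w ->
  u 0 = 0 -> u l = 0 ->
  forall x, x \in `[0, l] -> u x = dir0 l w x /\ u1 x = dir1 l w x.
Proof.
move=> l0 hu hu1 u0 ul; have hw := AC_L2 hu1.
have z0 : 0 \in `[0, l] by rewrite in_itv/= lexx ltW.
have ll : l \in `[0, l] by rewrite in_itv/= lexx ltW.
have d := ACB hu1 (dir1_AC hw).
pose c := u1 0 - dir1 l w 0.
have dc x : x \in `[0, l] -> u1 x - dir1 l w x = c.
  move=> xl; rewrite d.2// (@eq_int _ _ _ (fun _ => 0)); last by move=> t _; rewrite subrr.
  by move: xl; rewrite in_itv/= => /andP[x0 _]; rewrite int_cst// mul0r addr0.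
have d0 := ACB hu (dir0_AC hw).
have d0c x : x \in `[0, l] -> u x - dir0 l w x = c * x.
  move=> xl; rewrite d0.2// u0 dir0_0 subrr add0r.
  move: xl; rewrite in_itv/= => /andP[x0 xl].
  rewrite (@eq_int _ _ _ (fun _ => c)) ?int_cst// => t; rewrite in_itv/= => /andP[t0 tx].
  by apply: dc; rewrite in_itv/= ltW//=; lra.
have cz : c = 0.
  have := d0c l ll; rewrite ul dir0_l// subrr => /esym/eqP.
  by rewrite mulf_eq0 (gt_eqF l0) orbF => /eqP.
move=> x xl; have := d0c x xl; have := dc x xl; rewrite cz mul0r.
by move=> /eqP; rewrite subr_eq0 => /eqP-> /eqP; rewrite subr_eq0 => /eqP->.
Qed.

Lemma dir1_linear l k w w' x : x <= l -> L2 l w -> L2 l w' ->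
  dir1 l (fun t => k * w t + w' t) x = k * dir1 l w x + dir1 l w' x.
Proof.
move=> xl hw hw'.
have E s : s <= l -> int s (fun t => k * w t + w' t) = k * int s w + int s w'.
  move=> sl; have h1 := L2_L1 (L2S sl hw); have h2 := L2_L1 (L2S sl hw').
  by rewrite (intD (L1Z k h1) h2) intZ.
have P v : L2 l v -> L1 l (fun t => int t v).
  move=> hv; apply: L2_L1; have := AC_L2F (AC_int 0 hv).
  by under eq_fun do rewrite add0r.
rewrite /dir1 E//.
rewrite (@eq_int _ _ _ (fun t => k * int t w + int t w')); last first.
  by move=> t; rewrite in_itv/= => /andP[_ /ltW tl]; exact: E.
rewrite (intD (L1Z k (P _ hw)) (P _ hw')) (intZ _ (P _ hw)).
move: (int l _) (int l _) (int x w) (int x w') => *; ring.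
Qed.

Lemma dir0_linear l k w w' x : x <= l -> L2 l w -> L2 l w' ->
  dir0 l (fun t => k * w t + w' t) x = k * dir0 l w x + dir0 l w' x.
Proof.
move=> xl hw hw'; rewrite !dir0E.
rewrite (@eq_int _ _ _ (fun t => k * dir1 l w t + dir1 l w' t)); last first.
  by move=> t; rewrite in_itv/= => /andP[_ tx]; apply: dir1_linear => //; lra.
have h1 := L2_L1 (L2S xl (AC_L2F (dir1_AC hw))).
have h2 := L2_L1 (L2S xl (AC_L2F (dir1_AC hw'))).
by rewrite (intD (L1Z k h1) h2) intZ.
Qed.

(** Poincare inequality, from u(0) = 0. *)
Lemma dir0_bound l w x : x \in `[0, l] -> L2 l w ->
  dir0 l w x ^+ 2 <= l * int l (fun t => dir1 l w t ^+ 2).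
Proof.
move=> xl hw; move: (xl); rewrite in_itv/= => /andP[x0 xl'].
have z0 : 0 \in `[0, l] by rewrite in_itv/= lexx (le_trans x0 xl').
have := AC_holder (dir0_AC hw) z0 xl; rewrite dir0_0 !subr0 ger0_norm// => h.
apply: le_trans h _; apply: ler_wpM2r => //.
by apply: int_ge0 => t _; exact: sqr_ge0.
Qed.

(** The mean of the derivative of dir0 is zero, so the derivative is bounded
by the variation of its primitive. *)
Lemma dir1_bound l w x : 0 < l -> x \in `[0, l] -> L2 l w ->
  dir1 l w x ^+ 2 <= 4 * l * int l (fun t => w t ^+ 2).
Proof.
move=> l0 xl hw; have l0' := ltW l0.
set W := int l (fun t => w t ^+ 2).
have W0 : 0 <= W by apply: int_ge0 => t _; exact: sqr_ge0.
have b s : s \in `[0, l] -> int s w ^+ 2 <= l * W.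
  rewrite in_itv/= => /andP[s0 sl].
  have := int_holder hw (lexx 0) s0 sl; rewrite int0 !subr0 => h.
  by apply: le_trans h _; exact: ler_wpM2r.
have hI : L2 l (fun t => int t w).
  by have := AC_L2F (AC_int 0 hw); under eq_fun do rewrite add0r.
have m : (int l (fun t => int t w) / l) ^+ 2 <= l * W.
  rewrite expr_div_n ler_pdivrMr ?exprn_gt0//.
  have := L2_cauchy_schwarz hI (L2_cst l 1).
  under eq_int do rewrite mulr1.
  under [X in _ * X]eq_int do rewrite expr1n.
  rewrite int_cst// mul1r => h; apply: le_trans h _.
  have : int l (fun t => int t w ^+ 2) <= (l * W) * l.
    rewrite -int_cst//; apply: le_int; [exact: hI.2|exact: L1_cst|].
    by move=> t tl; apply: b; exact: subset_itv_oo_cc.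
  move=> h; apply: le_trans (ler_wpM2r l0' h) _.
  by rewrite expr2 !mulrA.
rewrite /dir1; have := b x xl.
set p := int x w; set r := _ / l in m *.
have := sqr_ge0 (p + r); nra.
Qed.

End Dirichlet.

(** * The two quadratic forms of the graph *)

Section Forms.
Context {R : realType} (E : finType) (len : E -> R).
Hypothesis len_gt0 : forall e, 0 < len e.
Variables (q : E -> R -> R) (M : R).
Hypothesis mq : forall e, measurable_fun setT (q e).
Hypothesis qb : forall e x, 0 <= q e x <= M.
Local Notation Y := (L2space len).
Implicit Types (u v w : Y) (e : E) (x : R).

Definition d0 w e : R -> R := dir0 (len e) (w e).
Definition d1 w e : R -> R := dir1 (len e) (w e).
(** S u, where u = d0 w is the function with second derivative w and zero end
values. *)
Definition opS w e x : R := - w e x + q e x * d0 w e x.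

(** The form <S u, S v> in terms of second derivatives. *)
Definition bform w v : R := \sum_e int (len e) (fun x => opS w e x * opS v e x).
(** The form <S u, v>, integrated by parts ([aformE]); written so that it is
visibly nonnegative. *)
Definition aform w v : R := \sum_e int (len e)
  (fun x => d1 w e x * d1 v e x + q e x * d0 w e x * d0 v e x).

Let len_ge0 e : 0 <= len e. Proof. exact: ltW. Qed.

Lemma d0_AC w e : AC (len e) (d0 w e) (d1 w e).
Proof. exact/dir0_AC/L2spaceP. Qed.
Lemma d1_AC w e : AC (len e) (d1 w e) (w e).
Proof. exact/dir1_AC/L2spaceP. Qed.
Lemma d0_L2 w e : L2 (len e) (d0 w e). Proof. exact: AC_L2F (d0_AC w e). Qed.
Lemma d1_L2 w e : L2 (len e) (d1 w e). Proof. exact: AC_L2F (d1_AC w e). Qed.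

Lemma mfun_q e : mfun_on (len e) (q e).
Proof. exact: measurable_funTS. Qed.

Lemma L2_mulq e (f : R -> R) : L2 (len e) f -> L2 (len e) (fun x => q e x * f x).
Proof.
apply: (@L2_mulb _ _ _ _ M (@mfun_q e)) => x _.
by have /andP[q0 qM] := qb e x; rewrite ger0_norm//; exact: qM.
Qed.

Lemma qd0_L2 w e : L2 (len e) (fun x => q e x * d0 w e x).
Proof. exact/L2_mulq/d0_L2. Qed.

Lemma opS_L2 w e : L2 (len e) (opS w e).
Proof. by apply: L2D; [exact/L2N/L2spaceP|exact: qd0_L2]. Qed.

Lemma d1_linear k u v e x : x <= len e ->
  d1 (k *: u + v) e x = k * d1 u e x + d1 v e x.
Proof. by move=> xl; exact: (dir1_linear k xl (L2spaceP u e) (L2spaceP v e)). Qed.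

Lemma d0_linear k u v e x : x <= len e ->
  d0 (k *: u + v) e x = k * d0 u e x + d0 v e x.
Proof. by move=> xl; exact: (dir0_linear k xl (L2spaceP u e) (L2spaceP v e)). Qed.

Lemma opS_linear k u v e x : x <= len e ->
  opS (k *: u + v) e x = k * opS u e x + opS v e x.
Proof.
move=> xl; rewrite /opS d0_linear// L2valE.
by move: (d0 u e x) (d0 v e x) (u e x) (v e x) (q e x) => *; ring.
Qed.

Lemma itv_le e x : x \in `]0, len e[ -> x <= len e.
Proof. by rewrite in_itv/= => /andP[_ /ltW]. Qed.

Lemma bform_psd : psd_form bform.
Proof.
split=> [u v|v k u u'|u].
- by apply: eq_bigr => e _; apply: eq_int => x _; exact: mulrC.
- rewrite /= mulr_sumr -big_split/=; apply: eq_bigr => e _.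
  have h1 := L2M (opS_L2 u e) (opS_L2 v e); have h2 := L2M (opS_L2 u' e) (opS_L2 v e).
  rewrite -(intZ k h1) -(intD (L1Z k h1) h2); apply: eq_int => x xl.
  by rewrite opS_linear ?itv_le// mulrDl mulrA.
- by apply: sumr_ge0 => e _; apply: int_ge0 => x _; rewrite -expr2 sqr_ge0.
Qed.

Lemma aform_psd : psd_form aform.
Proof.
have L u v e : L1 (len e) (fun x => d1 u e x * d1 v e x + q e x * d0 u e x * d0 v e x).
  exact: (L1D (L2M (d1_L2 u e) (d1_L2 v e)) (L2M (qd0_L2 u e) (d0_L2 v e))).
split=> [u v|v k u u'|u].
- apply: eq_bigr => e _; apply: eq_int => x _.
  by move: (d0 u e x) (d0 v e x) (d1 u e x) (d1 v e x) (q e x) => *; ring.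
- rewrite /= mulr_sumr -big_split/=; apply: eq_bigr => e _.
  rewrite -(intZ k (L u v e)) -(intD (L1Z k (L u v e)) (L u' v e)); apply: eq_int => x xl.
  rewrite (d0_linear k u u' (itv_le xl)) (d1_linear k u u' (itv_le xl)).
  move: (d0 u e x) (d0 u' e x) (d1 u e x) (d1 u' e x) => *.
  by move: (d0 v e x) (d1 v e x) (q e x) => *; ring.
- apply: sumr_ge0 => e _; apply: int_ge0 => x _.
  have /andP[q0 _] := qb e x.
  apply: addr_ge0; first by rewrite -expr2 sqr_ge0.
  by rewrite -mulrA mulr_ge0// -expr2 sqr_ge0.
Qed.

Lemma aformE u v : aform u v = \sum_e int (len e) (fun x => opS u e x * d0 v e x).
Proof.
apply: eq_bigr => e _.
have h1 := L2M (d1_L2 u e) (d1_L2 v e); have h2 := L2M (qd0_L2 u e) (d0_L2 v e).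
have h3 := L2M (L2spaceP u e) (d0_L2 v e).
have := AC_parts (len_ge0 e) (d1_AC u e) (d0_AC v e).
rewrite /d0 dir0_0 (dir0_l (len_gt0 e) (L2spaceP v e)) !mulr0 subr0 -/(d0 v e) => P.
rewrite (intD h1 h2).
rewrite (@eq_int _ _ (fun x => opS u e x * d0 v e x)
  (fun x => q e x * d0 u e x * d0 v e x - u e x * d0 v e x)); last first.
  move=> x _; rewrite /opS.
  by move: (u e x) (q e x) (d0 u e x) (d0 v e x) => *; ring.
rewrite (intB h2 h3); move: P; move: (int _ _) (int _ _) (int _ _) => *; lra.
Qed.

Let L : R := 1 + \sum_e len e.

Let L_gt0 : 0 < L.
Proof. by rewrite /L ltr_pwDl// sumr_ge0. Qed.
Let len_L e : len e <= L.
Proof.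
by rewrite /L (bigD1 e)//= addrCA lerDl addr_ge0// sumr_ge0.
Qed.

Lemma d0_sqr_le u e : int (len e) (fun x => d0 u e x ^+ 2)
  <= L ^+ 2 * int (len e) (fun x => d1 u e x ^+ 2).
Proof.
set D := int (len e) (fun x => d1 u e x ^+ 2).
have D0 : 0 <= D by apply: int_ge0 => t _; exact: sqr_ge0.
apply: (le_trans (y := int (len e) (fun _ => len e * D))).
  apply: le_int; [exact: (d0_L2 u e).2|exact: L1_cst|].
  move=> x xl; apply: dir0_bound; [exact: subset_itv_oo_cc|exact: L2spaceP].
rewrite int_cst// mulrAC -expr2; apply: ler_wpM2r => //.
by rewrite lerXn2r// nnegrE// ltW.
Qed.

Lemma sum_d0_le u : \sum_e int (len e) (fun x => d0 u e x ^+ 2) <= L ^+ 2 * aform u u.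
Proof.
rewrite mulr_sumr; apply: ler_sum => e _; apply: le_trans (d0_sqr_le u e) _.
apply: ler_wpM2l; first exact: sqr_ge0.
apply: le_int; first exact: (d1_L2 u e).2.
  exact: (L1D (L2M (d1_L2 u e) (d1_L2 u e)) (L2M (qd0_L2 u e) (d0_L2 u e))).
move=> x _; have /andP[q0 _] := qb e x.
by rewrite -mulrA -!expr2 lerDl mulr_ge0// sqr_ge0.
Qed.

(** Young's inequality for <S u, u>, the norm of u being absorbed by the
Poincare inequality. *)
Lemma aform_le_bform u : aform u u <= L ^+ 2 * bform u u.
Proof.
have a0 := psd_ge0 aform_psd u; have b0 := psd_ge0 bform_psd u.
pose t := 2 * L ^+ 2 ; have t0 : 0 < L ^+ 2 by rewrite exprn_gt0.
have : 2 * aform u u <= L ^+ 2 * bform u u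
    + (L ^+ 2)^-1 * \sum_e int (len e) (fun x => d0 u e x ^+ 2).
  rewrite {1}aformE /bform !mulr_sumr -big_split/=; apply: ler_sum => e _.
  have h1 := L2M (opS_L2 u e) (opS_L2 u e).
  have h2 := (d0_L2 u e).2; have h3 := L2M (opS_L2 u e) (d0_L2 u e).
  rewrite -(intZ _ h1) -(intZ _ h2) -(intZ _ h3) -(intD (L1Z _ h1) (L1Z _ h2)).
  apply: le_int; [exact: L1Z|exact: (L1D (L1Z _ h1) (L1Z _ h2))|].
  move=> x _; set s := opS u e x; set d := d0 u e x.
  have -> : L ^+ 2 * (s * s) + (L ^+ 2)^-1 * d ^+ 2 = (L * s - d / L) ^+ 2 + 2 * (s * d).
    by field; rewrite gt_eqF.
  by rewrite lerDr sqr_ge0.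
have : (L ^+ 2)^-1 * \sum_e int (len e) (fun x => d0 u e x ^+ 2) <= aform u u.
  by rewrite ler_pdivrMl//; exact: sum_d0_le.
lra.
Qed.

Definition nform u : R := \sum_e int (len e) (fun x => u e x ^+ 2).

(** The second derivative is q u - S u, and u is bounded by [sum_d0_le] and
[aform_le_bform]. *)
Lemma nform_le_bform : exists2 K, 0 < K & forall u, nform u <= K * bform u u.
Proof.
exists (2 + 2 * M ^+ 2 * L ^+ 4).
  rewrite ltr_pwDl// -[4%N]/(2 * 2)%N exprM.
  by apply: mulr_ge0 (sqr_ge0 _); apply: mulr_ge0 (sqr_ge0 _).
move=> u.
have h : nform u <= 2 * bform u u + 2 * M ^+ 2 * \sum_e int (len e) (fun x => d0 u e x ^+ 2).
  rewrite /bform !mulr_sumr -big_split/=; apply: ler_sum => e _.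
  have h1 := L2M (opS_L2 u e) (opS_L2 u e); have h2 := (d0_L2 u e).2.
  rewrite -(intZ _ h1) -(intZ _ h2) -(intD (L1Z _ h1) (L1Z _ h2)).
  apply: le_int; [exact: (L2spaceP u e).2|exact: (L1D (L1Z _ h1) (L1Z _ h2))|].
  move=> x _; rewrite /opS; set s := u e x; set d := d0 u e x.
  have /andP[q0 qM] := qb e x.
  have hq : (q e x * d) ^+ 2 <= M ^+ 2 * d ^+ 2.
    by rewrite exprMn; apply: ler_wpM2r; [exact: sqr_ge0|rewrite lerXn2r// ?nnegrE// (le_trans q0)].
  have := sqr_ge0 (- s + 2 * (q e x * d)); nra.
have h2 := sum_d0_le u; have h3 := aform_le_bform u.
have h4 := le_trans h2 (ler_wpM2l (sqr_ge0 L) h3).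
have h5 : 0 <= 2 * M ^+ 2 by rewrite mulr_ge0// sqr_ge0.
have h6 := ler_wpM2l h5 h4.
apply: le_trans h _; apply: le_trans (lerD (lexx _) h6) _.
by rewrite le_eqVlt; apply/orP; left; apply/eqP; ring.
Qed.

Lemma edge_le_nform u e : int (len e) (fun x => u e x ^+ 2) <= nform u.
Proof.
rewrite /nform (bigD1 e)//= lerDl sumr_ge0// => e' _.
by apply: int_ge0 => x _; exact: sqr_ge0.
Qed.

End Forms.

(** * Completeness and compactness of the forms *)

Section FormsCompact.
Context {R : realType} (E : finType) (len : E -> R).
Hypothesis len_gt0 : forall e, 0 < len e.
Variables (q : E -> R -> R) (M : R).
Hypothesis mq : forall e, measurable_fun setT (q e).
Hypothesis qb : forall e x, 0 <= q e x <= M.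
Local Notation Y := (L2space len).
Implicit Types (u v w : Y) (e : E) (x : R).
Local Notation aform := (@aform R E len q).
Local Notation bform := (@bform R E len q).

Let len_ge0 e : 0 <= len e. Proof. exact: ltW. Qed.
Let L : R := 1 + \sum_e len e.
Let L_gt0 : 0 < L.
Proof. by rewrite /L ltr_pwDl// sumr_ge0. Qed.
Let len_L e : len e <= L.
Proof. by rewrite /L (bigD1 e)//= addrCA lerDl addr_ge0// sumr_ge0. Qed.

Lemma d1_bound : exists2 K, 0 < K &
  forall u e x, x \in `[0, len e] -> d1 u e x ^+ 2 <= K * nform u.
Proof.
exists (4 * L); first by rewrite mulr_gt0.
move=> u e x xl; apply: le_trans (dir1_bound (len_gt0 e) xl (L2spaceP u e)) _.
apply: ler_pM => //.
- by rewrite mulr_ge0.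
- by apply: int_ge0 => t _; exact: sqr_ge0.
- by apply: ler_wpM2l.
- exact: edge_le_nform.
Qed.

Lemma bform_le_nform : exists2 K, 0 < K & forall u, bform u u <= K * nform u.
Proof.
have [K K0 d1K] := d1_bound.
pose C := \sum_(e : E) (2 * M ^+ 2 * L ^+ 2 * (K * L)).
have C0 : 0 <= C.
  apply: sumr_ge0 => e _; apply: mulr_ge0; last by apply: mulr_ge0; exact: ltW.
  by apply: mulr_ge0 (sqr_ge0 _); rewrite mulr_ge0 ?sqr_ge0.
exists (2 + C); first by rewrite ltr_pwDl.
move=> u.
have n0 : 0 <= nform u.
  by apply: sumr_ge0 => e _; apply: int_ge0 => x _; exact: sqr_ge0.
rewrite mulrDl /C mulr_suml {1}/nform mulr_sumr -big_split/=.
apply: ler_sum => e _.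
have h1 := L2spaceP u e; have h2 := d0_L2 u e.
have h3 := (d1_L2 u e).2.
have i1 : int (len e) (fun x => d1 u e x ^+ 2) <= K * L * nform u.
  apply: (le_trans (y := int (len e) (fun _ => K * nform u))).
    apply: le_int; [exact: h3|exact: L1_cst|].
    by move=> x xl; apply: d1K; exact: subset_itv_oo_cc.
  rewrite int_cst// mulrAC; apply: ler_wpM2r => //; apply: ler_wpM2l => //; exact: ltW.
have i0 := d0_sqr_le len_gt0 u e.
apply: (le_trans (y := int (len e) (fun x => 2 * u e x ^+ 2 + 2 * M ^+ 2 * d0 u e x ^+ 2))).
  apply: le_int.
  - exact: (L2M (opS_L2 mq qb u e) (opS_L2 mq qb u e)).
  - by apply: (L1D (L1Z _ h1.2) (L1Z _ h2.2)).
  move=> x _; rewrite /opS; have /andP[q0 qM] := qb e x.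
  move: (u e x) (d0 u e x) => s d.
  have hq : (q e x * d) ^+ 2 <= M ^+ 2 * d ^+ 2.
    by rewrite exprMn; apply: ler_wpM2r; [exact: sqr_ge0|rewrite lerXn2r// ?nnegrE// (le_trans q0)].
  have := sqr_ge0 (s + q e x * d); nra.
rewrite (intD (L1Z _ h1.2) (L1Z _ h2.2)) (intZ _ h1.2) (intZ _ h2.2).
rewrite lerD2l [leRHS](_ : _ = 2 * M ^+ 2 * (L ^+ 2 * (K * L * nform u))); last first.
  by move: (nform u) L => n l'; ring.
have m0 : 0 <= 2 * M ^+ 2 by rewrite mulr_ge0// sqr_ge0.
apply: (ler_wpM2l m0).
apply: le_trans i0 _; rewrite -/L.
by apply: ler_wpM2l; [exact: sqr_ge0|].
Qed.

(** The norm of b is equivalent to the norm of the space of second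
derivatives, which is complete by [riesz_fischer]. *)
Lemma bform_complete : complete_form bform.
Proof.
move=> u rapid.
have [K K0 nK] := nform_le_bform len_gt0 mq qb.
have [K' K'0 bK'] := bform_le_nform.
have rf e : exists v : R -> R, L2 (len e) v /\ forall k,
    int (len e) (fun x => (u k e x - v x) ^+ 2) <= 4 * K * 4^-1 ^+ k.
  have [|v hv vP] := @riesz_fischer R (len e) (fun k => u k e) K (len_ge0 e)
    (fun k => L2spaceP (u k) e); last by exists v.
  move=> k; apply: le_trans (edge_le_nform (u k.+1 - u k) e) _.
  by apply: le_trans (nK _) _; apply: (ler_wpM2l (ltW K0)); exact: rapid.
have [v vP] := choice rf.
have vY : v \in L2fam len by rewrite inE => e; case: (vP e).
exists (MkL2space vY) => eps eps0.
have bk k : bform (u k - MkL2space vY) (u k - MkL2space vY)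
    <= K' * (\sum_(e : E) 4 * K) * 4^-1 ^+ k.
  apply: le_trans (bK' _) _; rewrite -mulrA; apply: (ler_wpM2l (ltW K'0)).
  by rewrite mulr_suml; apply: ler_sum => e _; case: (vP e) => _; apply.
set C := K' * _ in bk.
have C0 : 0 <= C.
  apply: mulr_ge0; first exact: ltW.
  by apply: sumr_ge0 => e _; apply: mulr_ge0 => //; exact: ltW.
have H : C * 4^-1 ^+ k @[k --> \oo] --> C * (0 : R).
  apply: cvgMr; apply: cvg_expr; rewrite ger0_norm ?invr_ge0//; lra.
rewrite mulr0 in H.
move/cvgrPdist_le : H => /(_ eps eps0)[N _ NP].
exists N => k Nk; apply: le_trans (bk k) _.
have := NP k Nk; rewrite sub0r normrN; apply: le_trans; exact: ler_norm.
Qed.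

(** Sampling u' on a mesh of N points per edge: the error is at most the mesh
size times the norm of the second derivative, which b controls. *)
Lemma aform_compact : compact_form aform bform.
Proof.
move=> eps eps0.
have [K K0 nK] := nform_le_bform len_gt0 mq qb.
have [K1 K10 d1K] := d1_bound.
pose B := 1 + `|M| * L ^+ 2.
have B0 : 0 < B by rewrite ltr_pwDl// mulr_ge0// sqr_ge0.
have aB u : aform u u <= \sum_e B * int (len e) (fun x => d1 u e x ^+ 2).
  apply: ler_sum => e _; have h1 := (d1_L2 u e).2; have h0 := (d0_L2 u e).2.
  apply: (le_trans (y := int (len e) (fun x => d1 u e x ^+ 2 + `|M| * d0 u e x ^+ 2))).
    apply: le_int.
    - exact: (L1D (L2M (d1_L2 u e) (d1_L2 u e)) (L2M (qd0_L2 mq qb u e) (d0_L2 u e))).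
    - exact: (L1D h1 (L1Z _ h0)).
    move=> x _; rewrite -expr2 lerD2l -mulrA -expr2; apply: ler_wpM2r; first exact: sqr_ge0.
    by have /andP[_ qM] := qb e x; apply: le_trans qM _; exact: ler_norm.
  rewrite (intD h1 (L1Z _ h0)) (intZ _ h0) /B mulrDl mul1r lerD2l -mulrA.
  by apply: ler_wpM2l => //; exact: d0_sqr_le.
pose N := (Num.truncn (2 * L ^+ 2 * B * K / eps)).+1.
have N0 : 0 < N%:R :> R by [].
have NP : 2 * L ^+ 2 * B * K / eps <= N%:R by rewrite ltW// truncnS_gt.
pose pt (e : E) (i : 'I_N) : R := i%:R * (len e / N%:R).
have ptP e i : pt e i \in `[0, len e].
  rewrite in_itv/= /pt; apply/andP; split; first by rewrite mulr_ge0// divr_ge0.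
  by rewrite mulrCA ler_piMr// ler_pdivrMr// mul1r ler_nat ltnW.
pose s : R := Num.sqrt (2 * L * B).
have LB0 : 0 <= 2 * L * B by apply: mulr_ge0; [rewrite mulr_ge0// ltW|exact: ltW].
have s2 : s ^+ 2 = 2 * L * B by rewrite sqr_sqrtr.
exists (E * 'I_N)%type, (fun p u => s * d1 u p.1 (pt p.1 p.2)), (2 * L * B * (K1 * K)); split.
- move=> [e i] k u v /=.
  have xl : pt e i <= len e by have := ptP e i; rewrite in_itv/= => /andP[].
  by rewrite d1_linear//; move: (d1 u e _) (d1 v e _) => *; ring.
- move=> [e i] u /=; rewrite exprMn s2 -[leRHS]mulrA; apply: (ler_wpM2l LB0).
  apply: le_trans (d1K u e _ (ptP e i)) _; rewrite -mulrA.
  by apply: ler_wpM2l; [exact: ltW|exact: nK].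
move=> u; apply: le_trans (aB u) _.
(* each point is within one mesh step of a mesh point, and u' is Hoelder
   continuous of exponent 1/2 *)
have key e : int (len e) (fun x => d1 u e x ^+ 2) <=
    2 * L * (\sum_i d1 u e (pt e i) ^+ 2) + 2 * L ^+ 2 / N%:R * int (len e) (fun x => u e x ^+ 2).
  set W := int (len e) (fun x => u e x ^+ 2); set S := \sum_i _.
  have W0 : 0 <= W by apply: int_ge0 => t _; exact: sqr_ge0.
  have S0 : 0 <= S by apply: sumr_ge0 => i _; exact: sqr_ge0.
  have lN0 : 0 < len e / N%:R by rewrite divr_gt0.
  apply: (le_trans (y := int (len e) (fun _ => 2 * S + 2 * (len e / N%:R * W)))).
    apply: le_int; [exact: (d1_L2 u e).2|exact: L1_cst|].
    move=> x xl; have xl' := subset_itv_oo_cc xl.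
    move: (xl); rewrite in_itv/= => /andP[x0 xl2].
    pose m := Num.truncn (x / (len e / N%:R)).
    have xd0 : 0 <= x / (len e / N%:R) by rewrite divr_ge0// ltW.
    have /andP[m1 m2] := truncn_itv xd0; rewrite -/m in m1 m2.
    have mN : (m < N)%N.
      rewrite -(ltr_nat R); apply: le_lt_trans m1 _.
      by rewrite ltr_pdivrMr// mulrC divfK// gt_eqF.
    rewrite ler_pdivlMr// in m1; rewrite ltr_pdivrMr// in m2.
    have := AC_holder (d1_AC u e) (ptP e (Ordinal mN)) xl'; rewrite -/W => h.
    have hx : `|x - pt e (Ordinal mN)| <= len e / N%:R.
      rewrite ger0_norm ?subr_ge0// /pt/= lerBlDl.
      by apply: ltW; apply: lt_le_trans m2 _; rewrite -natr1 mulrDl mul1r.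
    have h2 := le_trans h (ler_wpM2r W0 hx).
    have h3 : d1 u e (pt e (Ordinal mN)) ^+ 2 <= S.
      by rewrite /S (bigD1 (Ordinal mN))//= lerDl sumr_ge0// => i _; exact: sqr_ge0.
    move: h2 h3; move: (len e / N%:R * W) (d1 u e (pt e (Ordinal mN))) (d1 u e x) => z r p h2 h3.
    have := sqr_ge0 (p - 2 * r); nra.
  rewrite int_cst// mulrDl; apply: lerD.
    by rewrite mulrAC; apply: ler_wpM2r => //; apply: ler_wpM2l.
  rewrite [leLHS](_ : _ = 2 * len e ^+ 2 / N%:R * W); last by field; rewrite gt_eqF.
  apply: ler_wpM2r => //; rewrite ler_pM2r ?invr_gt0//.
  by apply: ler_wpM2l => //; rewrite lerXn2r// nnegrE// ltW.
apply: (le_trans (y := \sum_e B * (2 * L * (\sum_i d1 u e (pt e i) ^+ 2)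
   + 2 * L ^+ 2 / N%:R * int (len e) (fun x => u e x ^+ 2)))).
  by apply: ler_sum => e _; apply: ler_wpM2l; [exact: ltW|exact: key].
rewrite (_ : \sum_e B * _ = \sum_e (2 * L * B) * (\sum_i d1 u e (pt e i) ^+ 2)
    + (B * (2 * L ^+ 2 / N%:R)) * nform u); last first.
  rewrite /nform mulr_sumr -big_split/=; apply: eq_bigr => e _.
  by move: (int _ _) (N%:R^-1) (\sum_(i < N) _) => *; ring.
rewrite addrC; apply: lerD.
  have h : B * (2 * L ^+ 2 / N%:R) * K <= eps.
    rewrite [leLHS](_ : _ = 2 * L ^+ 2 * B * K / N%:R); last by move: (N%:R^-1) => *; ring.
    by rewrite ler_pdivrMr// [leRHS]mulrC -ler_pdivrMr.
  apply: (le_trans (y := B * (2 * L ^+ 2 / N%:R) * (K * bform u u))).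
    apply: ler_wpM2l; last exact: nK.
    by apply: mulr_ge0; [exact: ltW|rewrite divr_ge0// mulr_ge0// sqr_ge0].
  by rewrite mulrA; apply: ler_wpM2r => //; apply: psd_ge0; exact: bform_psd.
rewrite le_eqVlt; apply/orP; left; apply/eqP.
rewrite (eq_bigr (fun e => \sum_i (s * d1 u e (pt e i)) ^+ 2)).
  by rewrite pair_bigA.
by move=> e _; rewrite mulr_sumr; apply: eq_bigr => i _; rewrite exprMn s2.
Qed.

End FormsCompact.

(** * Prescribing end slopes *)

Section PrescribedSlopes.
Context {R : realType}.
Implicit Types (l x : R) (u w f g F G : R -> R).

Lemma AC_S l l' F f : l' <= l -> AC l F f -> AC l' F f.
Proof.
move=> ll [hf hF]; split; first exact: L2S hf.
move=> x xl; apply: hF; move: xl; rewrite !in_itv/= => /andP[-> xl]/=.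
exact: le_trans xl ll.
Qed.

Lemma AC_mul l F f G g : 0 <= l -> AC l F f -> AC l G g ->
  AC l (fun x => F x * G x) (fun x => f x * G x + F x * g x).
Proof.
move=> l0 hF hG.
have h1 : L2 l (fun x => f x * G x).
  have := L2_mulb (AC_mfun hG) (fun x xl => AC_bound hG (subset_itv_oo_cc xl)) (AC_L2 hF).
  by under eq_fun do rewrite mulrC.
have h2 : L2 l (fun x => F x * g x).
  exact: (L2_mulb (AC_mfun hF) (fun x xl => AC_bound hF (subset_itv_oo_cc xl)) (AC_L2 hG)).
split; first exact: L2D.
move=> x; rewrite in_itv/= => /andP[x0 xl].
rewrite (intD (L2_L1 (L2S xl h1)) (L2_L1 (L2S xl h2))).
by rewrite (AC_parts x0 (AC_S xl hF) (AC_S xl hG)) subrKC.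
Qed.

(** u = x (l - x) (A + B x) for suitable A and B. *)
Lemma exists_slopes l (a b : R) : 0 < l ->
  exists w, [/\ L2 l w, dir1 l w 0 = a & dir1 l w l = b].
Proof.
move=> l0; have l0' := ltW l0.
pose A := a / l; pose B := (- b / l - A) / l.
have X := AC_id 0 l0'.
have Z := ACZ (-1) (AC_id l l0').
have P := ACD (AC_cst l A) (ACZ B X).
have XZ := AC_mul l0' X Z.
have U := AC_mul l0' XZ P.
have U1 := ACD (AC_mul l0' (ACD (AC_mul l0' (AC_cst l 1) Z) (AC_mul l0' X (AC_cst l (-1 * 1)))) P)
  (AC_mul l0' XZ (AC_cst l (0 + B * 1))).
move: (dir_unique l0 U U1) => /(_ _ _)/wrap[]; [ring|ring|move=> D].
eexists; split; first exact: AC_L2 U1.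
- have [_ <-] := D 0 ltac:(by rewrite in_itv/= lexx).
  by rewrite /A; field; rewrite gt_eqF.
- have [_ <-] := D l ltac:(by rewrite in_itv/= lexx l0').
  by rewrite /B /A; field; rewrite gt_eqF.
Qed.

End PrescribedSlopes.

(** * Kirchhoff conditions and the adjoint of the minimal operator *)

Section RealGraph.
Context {R : realType} (E V : finType) (src tgt : E -> V) (len : E -> R).
Hypothesis len_gt0 : forall e, 0 < len e.
Variables (q : E -> R -> R) (M : R).
Hypothesis mq : forall e, measurable_fun setT (q e).
Hypothesis qb : forall e x, 0 <= q e x <= M.
Local Notation Y := (L2space len).
Implicit Types (u v w : Y) (e : E) (x : R) (p : E * bool) (g h : E -> R -> R).
Local Notation aform := (@aform R E len q).
Local Notation bform := (@bform R E len q).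
Local Notation opS := (@opS R E len q).

(** The pair (e, false) is the end 0 of the edge e, and (e, true) is its end
len e. *)
Definition site p : V := if p.2 then tgt p.1 else src p.1.
Definition slope w p : R := if p.2 then d1 w p.1 (len p.1) else - d1 w p.1 0.
(** The normal derivative of d0 w at the vertex z. *)
Definition kirchhoff (z : V) w : R := \sum_(p | site p == z) slope w p.
(** The domain of S, in terms of second derivatives: the functions d0 w vanish
at the vertices by construction. *)
Definition clamped : set Y := [set w | forall z, kirchhoff z w = 0].

Let len_ge0 e : 0 <= len e. Proof. exact: ltW. Qed.
Let z0 e : 0 \in `[0, len e]. Proof. by rewrite in_itv/= lexx len_ge0. Qed.
Let zl e : len e \in `[0, len e]. Proof. by rewrite in_itv/= len_ge0 lexx. Qed.

Lemma slope_scalar p : scalar (fun w : Y => slope w p).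
Proof.
case: p => e b k u v; rewrite /slope/=; case: b; rewrite d1_linear ?len_ge0//.
by move: (d1 u e 0) (d1 v e 0) => *; ring.
Qed.

Lemma kirchhoff_scalar z : scalar (kirchhoff z).
Proof.
move=> k u v; rewrite /kirchhoff mulr_sumr -big_split/=; apply: eq_bigr => p _.
exact: slope_scalar.
Qed.

Lemma slope_bound : exists2 K, 0 < K & forall p w, slope w p ^+ 2 <= K * bform w w.
Proof.
have [K K0 nK] := nform_le_bform len_gt0 mq qb.
have [K1 K10 d1K] := @d1_bound R E len len_gt0.
exists (K1 * K); first by rewrite mulr_gt0.
move=> [e b] w; rewrite -mulrA.
apply: (le_trans (y := K1 * nform w)); last by apply: ler_wpM2l; [exact: ltW|exact: nK].
by rewrite /slope; case: b => /=; rewrite ?sqrrN; apply: d1K.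
Qed.

Lemma kirchhoff_bound : exists K, forall z w, kirchhoff z w ^+ 2 <= K * bform w w.
Proof.
have [K K0 sK] := slope_bound.
pose n : R := #|{: E * bool}|%:R.
exists (n * n * K) => z w.
have b0 : 0 <= bform w w by apply: psd_ge0; exact: bform_psd.
have KB : 0 <= K * bform w w by rewrite mulr_ge0// ltW.
pose c := Num.sqrt (K * bform w w).
have c2 : c ^+ 2 = K * bform w w by rewrite sqr_sqrtr.
have c0 : 0 <= c by exact: sqrtr_ge0.
have : `|kirchhoff z w| <= n * c.
  apply: le_trans (ler_norm_sum _ _ _) _.
  apply: (le_trans (y := \sum_(p : E * bool) c)); last first.
    by rewrite sumr_const mulr_natl.
  rewrite big_mkcond/=; apply: ler_sum => p _; case: ifP => // _.
  rewrite -(@ler_pXn2r _ 2)// ?nnegrE// real_normK ?num_real// c2; exact: sK.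
move=> h; rewrite -mulrA -c2 -real_normK ?num_real//.
have n0 : 0 <= n by [].
apply: (le_trans (y := (n * c) ^+ 2)); first by rewrite lerXn2r// nnegrE// mulr_ge0.
by rewrite exprMn [n ^+ 2]expr2.
Qed.

(** The slopes at the ends of the edges can be prescribed independently, so
that Kirchhoff conditions of any shape can be tested. *)
Lemma exists_slope (s : E * bool -> R) : exists w, forall p, slope w p = s p.
Proof.
have [w wP] := choice (fun e => exists_slopes (- s (e, false)) (s (e, true)) (len_gt0 e)).
have wY : w \in L2fam len by rewrite inE => e; case: (wP e).
exists (MkL2space wY) => -[e [|]]; rewrite /slope/= /d1/=; case: (wP e) => _ h0 hl.
  by rewrite hl.
by rewrite h0 opprK.
Qed.

(** The pair (g, h) belongs to the graph of the adjoint of the real operator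
S. *)
Definition real_adjoint g h : Prop := forall w, clamped w ->
  \sum_e int (len e) (fun x => opS w e x * g e x) =
  \sum_e int (len e) (fun x => d0 w e x * h e x).

(** Test functions supported in one edge: all Kirchhoff conditions hold
because the slopes vanish. *)
Lemma edge_test e f f1 (y : R -> R) : AC (len e) f f1 -> AC (len e) f1 y ->
  f 0 = 0 -> f1 0 = 0 -> f (len e) = 0 -> f1 (len e) = 0 ->
  exists w, [/\ clamped w, w e = y,
    forall x, x \in `[0, len e] -> d0 w e x = f x &
    forall e', e' != e -> forall x, x \in `[0, len e'] -> w e' x = 0 /\ d0 w e' x = 0].
Proof.
move=> hf hf1 f0 f10 fl f1l.
pose w0 e' : R -> R := if e' == e then y else fun _ => 0.
have wY : w0 \in L2fam len.
  rewrite inE => e'; rewrite /w0; case: eqVneq => [->|_]; first exact: AC_L2 hf1.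
  exact: L2_cst.
have D := dir_unique (len_gt0 e) hf hf1 f0 fl.
pose w := MkL2space wY.
have we : w e = y by rewrite /w/= /w0 eqxx.
have wn e' : e' != e -> w e' = fun _ => 0 by move=> n; rewrite /w/= /w0 (negbTE n).
have Dn e' : e' != e -> forall x, x \in `[0, len e'] -> d0 w e' x = 0 /\ d1 w e' x = 0.
  move=> n x xl; have A := AC_cst (len e') (0 : R).
  have [h1 h2] := dir_unique (len_gt0 e') A A erefl erefl xl.
  by rewrite /d0 /d1 (wn e' n) -h1 -h2.
exists w; split => // [z|x xl|e' n x xl].
- rewrite /kirchhoff big1// => -[e' b] _; rewrite /slope/=.
  have [->|n] := eqVneq e' e.
    have [_ h1] := D 0 (z0 e); have [_ h2] := D (len e) (zl e).
    by rewrite /d1 we -h1 -h2 f10 f1l oppr0; case: b.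
  have [_ h1] := Dn e' n 0 (z0 e'); have [_ h2] := Dn e' n _ (zl e').
  by rewrite h1 h2 oppr0; case: b.
- by have [h _] := D x xl; rewrite /d0 we -h.
- by rewrite (wn e' n); case: (Dn e' n x xl).
Qed.

(** Testing with functions supported in e gives the regularity of g and the
differential equation on e. *)
Lemma real_adjoint_edge g h e : (forall e', L2 (len e') (g e')) ->
  (forall e', L2 (len e') (h e')) -> real_adjoint g h ->
  exists G G1, [/\ AC (len e) G G1, AC (len e) G1 (fun x => q e x * g e x - h e x)
    & raeq (len e) G (g e)].
Proof.
move=> hg hh adj.
have hqg := L2_mulq mq qb (hg e).
apply: (du_bois_reymond2 (len_gt0 e) (hg e) (L2B hqg (hh e))).
move=> y f f1 hf hf1 f0 f10 fl f1l.
have [w [cw we dw wn]] := edge_test hf hf1 f0 f10 fl f1l.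
have := adj w cw.
rewrite (bigD1 e)//= [X in _ + X = _]big1 ?addr0; last first.
  move=> e' n; rewrite (@eq_int _ _ _ (fun _ => 0)) ?int_cst ?mul0r//.
  move=> x xl; have [h1 h2] := wn e' n x (subset_itv_oo_cc xl).
  by rewrite /opS h1 h2 mulr0 oppr0 addr0 mul0r.
rewrite [RHS](bigD1 e)//= [X in _ = _ + X]big1 ?addr0; last first.
  move=> e' n; rewrite (@eq_int _ _ _ (fun _ => 0)) ?int_cst ?mul0r//.
  by move=> x xl; have [h1 h2] := wn e' n x (subset_itv_oo_cc xl); rewrite h2 mul0r.
have hfL := AC_L2F hf; have hyL := AC_L2 hf1.
rewrite (@eq_int _ _ _ (fun x => f x * (q e x * g e x) - y x * g e x)); last first.
  move=> x xl; rewrite /opS we dw; last exact: subset_itv_oo_cc.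
  by move: (y x) (f x) (q e x) (g e x) => *; ring.
rewrite [RHS](@eq_int _ _ _ (fun x => f x * h e x)); last first.
  by move=> x xl; rewrite dw//; exact: subset_itv_oo_cc.
rewrite (intB (L2M hfL hqg) (L2M hyL (hg e))) => P.
rewrite [RHS](@eq_int _ _ _ (fun x => f x * (q e x * g e x) - f x * h e x)); last first.
  by move=> x _; rewrite mulrBr.
rewrite (intB (L2M hfL hqg) (L2M hfL (hh e))).
by move: P; move: (int _ _) (int _ _) (int _ _) => *; lra.
Qed.

(** Density of dom S: if h is orthogonal to it then S* 0 = h, which reads 0''
= - h on each edge. *)
Lemma clamped_dense h : (forall e, L2 (len e) (h e)) ->
  (forall w, clamped w -> \sum_e int (len e) (fun x => d0 w e x * h e x) = 0) ->
  forall e, raeq (len e) (h e) (fun _ => 0).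
Proof.
move=> hh ort e.
have adj : real_adjoint (fun _ _ => 0) h.
  move=> w cw; rewrite ort// big1// => e' _.
  by rewrite (@eq_int _ _ _ (fun _ => 0)) ?int_cst ?mul0r// => x _; rewrite mulr0.
have [G [G1 [hG hG1 Gg]]] := real_adjoint_edge e (fun e' => L2_cst (len e') 0) hh adj.
have [_ G10] := AC_unique (len_gt0 e) hG (AC_cst (len e) 0) Gg.
have [_ m0] := AC_unique (len_gt0 e) hG1 (AC_cst (len e) 0) G10.
by apply: ae_imp m0 => x hx xl; have := hx xl; rewrite mulr0 sub0r => /eqP; rewrite oppr_eq0 => /eqP.
Qed.

(** Green's formula for a solution G of G'' = q G. *)
Lemma green w (G G1 : E -> R -> R) :
  (forall e, AC (len e) (G e) (G1 e)) ->
  (forall e, AC (len e) (G1 e) (fun x => q e x * G e x)) ->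
  \sum_e int (len e) (fun x => opS w e x * G e x)
  = - \sum_(p : E * bool) slope w p * (if p.2 then G p.1 (len p.1) else G p.1 0).
Proof.
move=> hG hG1.
have -> : \sum_(p : E * bool) slope w p * (if p.2 then G p.1 (len p.1) else G p.1 0)
   = \sum_e (d1 w e (len e) * G e (len e) - d1 w e 0 * G e 0).
  rewrite -(pair_bigA _ (fun e b => slope w (e, b) * (if b then G e (len e) else G e 0)))/=.
  by apply: eq_bigr => e _; rewrite big_bool /slope/= mulNr.
rewrite -sumrN; apply: eq_bigr => e _.
have P1 := AC_parts (len_ge0 e) (d1_AC w e) (hG e).
have P2 := AC_parts (len_ge0 e) (d0_AC w e) (hG1 e).
rewrite /d0 dir0_0 (dir0_l (len_gt0 e) (L2spaceP w e)) !mul0r subr0 -/(d0 w e) in P2.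
have h1 := L2M (L2spaceP w e) (AC_L2F (hG e)).
have h2 := L2M (d0_L2 w e) (AC_L2 (hG1 e)).
rewrite (@eq_int _ _ _ (fun x => d0 w e x * (q e x * G e x) - w e x * G e x)); last first.
  by move=> x _; rewrite /opS; move: (w e x) (q e x) (d0 w e x) (G e x) => *; ring.
rewrite (intB h2 h1); move: P1 P2.
move: (int _ _) (int _ _) (int _ _) (d1 w e (len e) * G e (len e)) (d1 w e 0 * G e 0) => *.
lra.
Qed.

End RealGraph.

(** * The kernel of the adjoint *)

Section Kernel.
Context {R : realType} (E V : finType) (src tgt : E -> V) (len : E -> R).
Hypothesis len_gt0 : forall e, 0 < len e.
Variables (q : E -> R -> R) (M : R).
Hypothesis mq : forall e, measurable_fun setT (q e).
Hypothesis qb : forall e x, 0 <= q e x <= M.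
Local Notation Y := (L2space len).
Implicit Types (u v w : Y) (e : E) (x : R) (p : E * bool) (g h G : E -> R -> R).
Local Notation opS := (@opS R E len q).
Local Notation site := (@site E V src tgt).
Local Notation clamped := (@clamped R E V src tgt len).
Local Notation real_adjoint := (@real_adjoint R E V src tgt len q).

Let len_ge0 e : 0 <= len e. Proof. exact: ltW. Qed.

Definition endval G p : R := if p.2 then G p.1 (len p.1) else G p.1 0.

(** Edgewise solutions of G'' = q G, without conditions at the vertices. *)
Definition solution G : Prop := exists G1 : E -> R -> R, forall e,
  AC (len e) (G e) (G1 e) /\ AC (len e) (G1 e) (fun x => q e x * G e x).

Lemma solution_L2 G e : solution G -> L2 (len e) (G e).
Proof. by move=> [G1 /(_ e)[h _]]; exact: AC_L2F h. Qed.

Lemma solution_linear k G H : solution G -> solution H ->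
  solution (fun e x => k * G e x + H e x).
Proof.
move=> [G1 hG] [H1 hH]; exists (fun e x => k * G1 e x + H1 e x) => e.
have [h1 h2] := hG e; have [h3 h4] := hH e; split; first exact: (ACD (ACZ k h1) h3).
have := ACD (ACZ k h2) h4; congr AC; apply/funext => x.
by move: (q e x) (G e x) (H e x) => *; ring.
Qed.

Lemma endval_linear k G H p :
  endval (fun e x => k * G e x + H e x) p = k * endval G p + endval H p.
Proof. by case: p => e [|]. Qed.

Lemma solution_raeq G H : solution G -> solution H ->
  (forall e, raeq (len e) (G e) (H e)) -> forall p, endval G p = endval H p.
Proof.
move=> [G1 hG] [H1 hH] GH [e b]; have [h1 _] := hG e; have [h2 _] := hH e.
have [D _] := AC_unique (len_gt0 e) h1 h2 (GH e).
by rewrite /endval/=; case: b; apply: D; rewrite in_itv/= ?lexx len_ge0.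
Qed.

Lemma exists_solution (s : E * bool -> R) :
  exists2 G, solution G & forall p, endval G p = s p.
Proof.
have bvp e : exists GG : (R -> R) * (R -> R), [/\ AC (len e) GG.1 GG.2,
    AC (len e) GG.2 (fun x => q e x * GG.1 x), GG.1 0 = s (e, false) & GG.1 (len e) = s (e, true)].
  have [g [g1 H]] := boundary_value_problem (len_gt0 e) (@mfun_q R E len q mq e)
     (qb e) (s (e, false)) (s (e, true)).
  by exists (g, g1).
have [GG GP] := choice bvp.
exists (fun e => (GG e).1).
  by exists (fun e => (GG e).2) => e; case: (GP e).
by move=> [e [|]]; rewrite /endval/=; case: (GP e).
Qed.

Lemma solution_unique G : solution G -> (forall p, endval G p = 0) ->
  forall e, raeq (len e) (G e) (fun _ => 0).
Proof.
move=> [G1 hG] G0 e; have [h1 h2] := hG e; apply: raeq_eq => x xl.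
apply: (boundary_value_unique (len_gt0 e) (qb e) h1 h2).
- exact: (G0 (e, false)).
- exact: (G0 (e, true)).
- exact: subset_itv_oo_cc.
Qed.

Lemma real_adjoint_raeq g h g' h' : (forall e, L2 (len e) (g e)) ->
  (forall e, L2 (len e) (h e)) -> (forall e, L2 (len e) (g' e)) ->
  (forall e, L2 (len e) (h' e)) ->
  (forall e, raeq (len e) (g e) (g' e)) -> (forall e, raeq (len e) (h e) (h' e)) ->
  real_adjoint g h -> real_adjoint g' h'.
Proof.
move=> hg hh hg' hh' gg hh2 adj w cw.
transitivity (\sum_e int (len e) (fun x => opS w e x * g e x)).
  apply: eq_bigr => e _; apply: raeq_int; last by apply: raeqM; [exact: raeq_refl|exact: raeq_sym].
    exact: (mfunM (opS_L2 mq qb w e).1 (hg' e).1).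
  exact: (mfunM (opS_L2 mq qb w e).1 (hg e).1).
rewrite adj//; apply: eq_bigr => e _; apply: raeq_int; last by apply: raeqM; [exact: raeq_refl|].
  exact: (mfunM (d0_L2 w e).1 (hh e).1).
exact: (mfunM (d0_L2 w e).1 (hh' e).1).
Qed.

Let int00 e (f : R -> R) : int (len e) (fun x => f x * 0) = 0.
Proof. by rewrite (@eq_int _ _ _ (fun _ => 0)) ?int_cst ?mul0r// => x _; rewrite mulr0. Qed.

(** In Green's formula the boundary terms at a vertex add up to the common
value of G times the Kirchhoff sum of w, which is zero. *)
Lemma solution_real_adjoint (c : V -> R) G : solution G ->
  (forall p, endval G p = c (site p)) -> real_adjoint G (fun _ _ => 0).
Proof.
move=> [G1 hG] Gc w cw.
rewrite (green len_gt0 w (fun e => (hG e).1) (fun e => (hG e).2)).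
rewrite [RHS]big1 => [|e _]; last exact: int00.
rewrite (partition_big (fun p => site p) xpredT)//= big1 ?oppr0// => z _.
rewrite (eq_bigr (fun p => slope w p * c z)) => [|p /eqP <-]; last by rewrite -Gc.
by rewrite -mulr_suml -/(kirchhoff src tgt z w) cw mul0r.
Qed.

Hypothesis no_isolated : forall z : V, exists p, site p = z.

(** On each edge the adjoint equation holds, and continuity at a vertex
follows by testing with slopes 1 and -1 at two edge ends there. *)
Lemma real_adjoint_solution g : (forall e, L2 (len e) (g e)) ->
  real_adjoint g (fun _ _ => 0) ->
  exists c G, [/\ solution G, forall p, endval G p = c (site p) &
    forall e, raeq (len e) (G e) (g e)].
Proof.
move=> hg adj.
have reg e : exists GG : (R -> R) * (R -> R), [/\ AC (len e) GG.1 GG.2,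
    AC (len e) GG.2 (fun x => q e x * GG.1 x) & raeq (len e) GG.1 (g e)].
  have [G [G1 [h1 h2 h3]]] := real_adjoint_edge len_gt0 mq qb e hg (fun e' => L2_cst (len e') 0) adj.
  exists (G, G1); split=> //=; apply: AC_raeq h2.
    exact: (L2_mulq mq qb (AC_L2F h1)).1.
  by apply: ae_imp h3 => x h xl; rewrite subr0 h.
have [GG GP] := choice reg.
pose G e := (GG e).1.
have sG : solution G by exists (fun e => (GG e).2) => e; case: (GP e).
have Gg e : raeq (len e) (G e) (g e) by case: (GP e).
have adjG : real_adjoint G (fun _ _ => 0).
  apply: real_adjoint_raeq adj => //.
  - by move=> e; exact: L2_cst.
  - by move=> e; exact: solution_L2.
  - by move=> e; exact: L2_cst.
  - by move=> e; exact: raeq_sym.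
  - by move=> e; exact: raeq_refl.
have ort w : clamped w -> \sum_(p : E * bool) slope w p * endval G p = 0.
  move=> cw; have := adjG w cw.
  have hG1 e : AC (len e) (G e) (GG e).2 by case: (GP e).
  have hG2 e : AC (len e) (GG e).2 (fun x => q e x * G e x) by case: (GP e).
  rewrite (green len_gt0 w hG1 hG2).
  rewrite [X in _ = X]big1 => [|e _]; last exact: int00.
  by move/eqP; rewrite oppr_eq0 => /eqP.
have cont p p' : site p = site p' -> endval G p = endval G p'.
  move=> pp; have [->//|npp] := eqVneq p p'.
  have [w wP] := exists_slope len_gt0 (fun r => (r == p)%:R - (r == p')%:R).
  have E1 (F : E * bool -> R) : \sum_r ((r == p)%:R - (r == p')%:R) * F r = F p - F p'.
    under eq_bigr do rewrite mulrBl.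
    rewrite sumrB (bigD1 p)//= eqxx mul1r big1 ?addr0; last first.
      by move=> r /negbTE ->; rewrite mul0r.
    rewrite (bigD1 p')//= eqxx mul1r big1 ?addr0//.
    by move=> r /negbTE ->; rewrite mul0r.
  have cw : clamped w.
    move=> z; rewrite /kirchhoff; under eq_bigr do rewrite wP.
    rewrite big_mkcond/= (eq_bigr (fun r => ((r == p)%:R - (r == p')%:R) * (site r == z)%:R)).
      by rewrite E1 pp subrr.
    by move=> r _; case: (site r == z); rewrite ?mulr1 ?mulr0.
  have := ort w cw; under eq_bigr do rewrite wP.
  by rewrite E1 => /eqP; rewrite subr_eq0 => /eqP.
have [pz pzP] := choice no_isolated.
by exists (fun z => endval G (pz z)), G; split=> // p; apply: cont; rewrite pzP.
Qed.

End Kernel.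

(** * The minimal operator through real and imaginary parts *)

Section ComplexGraph.
Context {R : realType} (G : metric_graph R).
Variables (q : edge G -> R -> R) (M : R).
Hypothesis mq : forall e, measurable_fun setT (q e).
Hypothesis qb : forall e x, 0 <= q e x <= M.
Local Notation E := (edge G).
Local Notation V := (vertex G).
Local Notation Y := (L2space (@len R G)).
Implicit Types (w : Y) (e : E) (f h g k : gfun G) (u : E -> R -> R).
Local Notation opS := (@opS R E (@len R G) q).
Local Notation clamped := (@clamped R E V (@src R G) (@tgt R G) (@len R G)).
Local Notation real_adjoint := (@real_adjoint R E V (@src R G) (@tgt R G) (@len R G) q).
Local Notation T := (minimal_operator q).

Let len_gt0' e : 0 < len e. Proof. exact: len_gt0. Qed.
Let z0 e : 0 \in `[0, len e]. Proof. by rewrite in_itv/= lexx ltW. Qed.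
Let zl e : len e \in `[0, len e]. Proof. by rewrite in_itv/= lexx andbT ltW. Qed.

Definition reG f : E -> R -> R := fun e => re (f e).
Definition imG f : E -> R -> R := fun e => im (f e).
Definition L2real u : Prop := forall e, L2 (len e) (u e).
Definition raeqG u u' : Prop := forall e, raeq (len e) (u e) (u' e).

Lemma L2_graphP f : L2_graph f <-> L2real (reG f) /\ L2real (imG f).
Proof.
split=> [h|[h1 h2] e]; last by apply/in_L2P; split; [exact: h1|exact: h2].
by split=> e; case/in_L2P: (h e).
Qed.

Lemma gaeqP f g : gaeq f g <-> raeqG (reG f) (reG g) /\ raeqG (imG f) (imG g).
Proof.
split=> [h|[h1 h2] e]; last by apply/aeqP; split; [exact: h1|exact: h2].
by split=> e; case/aeqP: (h e).
Qed.

Lemma ReD (a b : R[i]) : complex.Re (a + b) = complex.Re a + complex.Re b.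
Proof. by case: a b => [? ?] []. Qed.
Lemma ImD (a b : R[i]) : complex.Im (a + b) = complex.Im a + complex.Im b.
Proof. by case: a b => [? ?] []. Qed.
Lemma ReN (a : R[i]) : complex.Re (- a) = - complex.Re a.
Proof. by case: a. Qed.
Lemma ImN (a : R[i]) : complex.Im (- a) = - complex.Im a.
Proof. by case: a. Qed.

Lemma Re_sum (I : Type) (r : seq I) (P : pred I) (F : I -> R[i]) :
  complex.Re (\sum_(i <- r | P i) F i) = \sum_(i <- r | P i) complex.Re (F i).
Proof. by apply: (big_morph (@complex.Re R)) => // -[? ?] [? ?]. Qed.
Lemma Im_sum (I : Type) (r : seq I) (P : pred I) (F : I -> R[i]) :
  complex.Im (\sum_(i <- r | P i) F i) = \sum_(i <- r | P i) complex.Im (F i).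
Proof. by apply: (big_morph (@complex.Im R)) => // -[? ?] [? ?]. Qed.

Lemma kirchhoffE z w : kirchhoff (@src R G) (@tgt R G) z w =
  \sum_(e | tgt e == z) d1 w e (len e) - \sum_(e | src e == z) d1 w e 0.
Proof.
rewrite /kirchhoff big_mkcond/=.
rewrite -(pair_bigA _ (fun e b => if site (@src R G) (@tgt R G) (e, b) == z
   then slope w (e, b) else 0))/=.
rewrite [X in _ = X - _]big_mkcond [X in _ = _ - X]big_mkcond -sumrB/=.
apply: eq_bigr => e _.
rewrite big_bool /site /slope/=.
by case: (tgt e == z); case: (src e == z); rewrite /= ?subr0 ?sub0r ?add0r ?addr0.
Qed.

(** The real operator S, in terms of second derivatives. *)
Definition real_minimal u u' : Prop := exists w, [/\ clamped w, raeqG u (d0 w) & raeqG u' (opS w)].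

(** Common to real and imaginary parts: phi stands for either projection. *)
Lemma minimal_operator_part (phi : R[i] -> R) f h :
  (forall a b, phi (a + b) = phi a + phi b) ->
  (forall (a : R) z, phi (a%:C * z) = a * phi z) ->
  (forall (l : R) (F F1 : R -> R[i]), cAC l F F1 ->
     AC l (fun x => phi (F x)) (fun x => phi (F1 x))) ->
  T f h -> real_minimal (fun e x => phi (f e x)) (fun e x => phi (h e x)).
Proof.
move=> phiD phiM phiAC [fH2 _ fv hL2 hE].
have phiN a : phi (- a) = - phi a.
  by rewrite -[RHS]mulN1r -phiM raddfN/= mulN1r.
have phi0 : phi 0 = 0 by rewrite -[0 in LHS](mul0r 0) -[X in phi (X * _)]/(0%:C) phiM mul0r.
have rep e : exists FFw : ((R -> R[i]) * (R -> R[i])) * (R -> R[i]),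
    H2rep (len e) (f e) FFw.1.1 FFw.1.2 FFw.2.
  by have [_ [F [F1 [w H]]]] := in_H2_rep (len_gt0' e) (fH2 e); exists (F, F1, w).
have [FF FP] := choice rep.
have FA e : cAC (len e) (FF e).1.1 (FF e).1.2 by case: (FP e).
have FA1 e : cAC (len e) (FF e).1.2 (FF e).2 by case: (FP e).
have Ff e : aeq (len e) (FF e).1.1 (f e) by case: (FP e).
have fL2 e : in_L2 (len e) (f e) by case: (in_H2_rep (len_gt0' e) (fH2 e)).
have tr e x := H2rep_trace (len_gt0' e) (fL2 e) (FP e) (x := x).
have dd e := H2rep_derivative (len_gt0' e) (fL2 e) (FP e).
have F0 e : (FF e).1.1 0 = 0.
  have [h1 _] := tr e 0 (z0 e); rewrite -h1.
  by have [vv _] := fv (src e); case: (vv e) => + _; apply.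
have Fl e : (FF e).1.1 (len e) = 0.
  have [h1 _] := tr e (len e) (zl e); rewrite -h1.
  by have [vv _] := fv (tgt e); case: (vv e) => _; apply.
have nd z : \sum_(e | tgt e == z) (FF e).1.2 (len e) - \sum_(e | src e == z) (FF e).1.2 0 = 0.
  rewrite -[RHS](fv z).2 /normal_derivative; congr (_ - _); apply: eq_bigr => e _.
    by have [_ ->] := tr e (len e) (zl e).
  by have [_ ->] := tr e 0 (z0 e).
have wY : (fun e x => phi ((FF e).2 x)) \in L2fam (@len R G).
  by rewrite inE => e; exact: AC_L2 (phiAC _ _ _ (FA1 e)).
pose w := MkL2space wY.
have D e : forall x, x \in `[0, len e] ->
    phi ((FF e).1.1 x) = d0 w e x /\ phi ((FF e).1.2 x) = d1 w e x.
  by apply: (dir_unique (len_gt0' e) (phiAC _ _ _ (FA e)) (phiAC _ _ _ (FA1 e)));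
    rewrite ?F0 ?Fl phi0.
exists w; split.
- move=> z; rewrite kirchhoffE.
  have := congr1 phi (nd z); rewrite phiD phiN !(big_morph phi phiD phi0) phi0 => H.
  rewrite -[RHS]H; congr (_ - _); apply: eq_bigr => e _.
    by case: (D e _ (zl e)) => _ <-.
  by case: (D e _ (z0 e)) => _ <-.
- move=> e; apply: ae_imp (Ff e) => x h1 xl; rewrite -h1//.
  by case: (D e x (subset_itv_oo_cc xl)) => <-.
- move=> e; case: (dd e) => _ _ hw.
  have H := filterI (Ff e) hw.
  apply: ae_imp2 (hE e) (ae_imp2 _ (Ff e) hw) => [x h1 h2 xl|x h1 h2]; last exact: (conj h1 h2).
  have [h3 h4] := h2; rewrite h1// h4// -h3// phiD phiN phiM /opS /w/=.
  by case: (D e x (subset_itv_oo_cc xl)) => -> _.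
Qed.

Lemma minimal_operator_real f h : T f h ->
  real_minimal (reG f) (reG h) /\ real_minimal (imG f) (imG h).
Proof.
move=> Tfh; split; apply: minimal_operator_part Tfh.
- by move=> [? ?] [? ?].
- exact: ReM.
- by move=> l F F1 [].
- by move=> [? ?] [? ?].
- exact: ImM.
- by move=> l F F1 [].
Qed.

Lemma real_minimal_operator f h : L2_graph f -> L2_graph h ->
  real_minimal (reG f) (reG h) -> real_minimal (imG f) (imG h) -> T f h.
Proof.
move=> fL2 hL2 [w [cw fw hw]] [v [cv fv hv]].
pose F e x := d0 w e x +i* d0 v e x.
pose F1 e x := d1 w e x +i* d1 v e x.
pose W e x := w e x +i* v e x.
have rep e : H2rep (len e) (f e) (F e) (F1 e) (W e).
  split; [by split; exact: d0_AC|by split; exact: d1_AC|].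
  by apply/aeqP; split; [exact: raeq_sym (fw e)|exact: raeq_sym (fv e)].
have tr e x := H2rep_trace (len_gt0' e) (fL2 e) (rep e) (x := x).
have dd e := H2rep_derivative (len_gt0' e) (fL2 e) (rep e).
have D0 (y : Y) e : d0 y e 0 = 0 by exact: dir0_0.
have Dl (y : Y) e : d0 y e (len e) = 0 by exact: (dir0_l (len_gt0' e) (L2spaceP y e)).
have vv z : vertex_value f z 0.
  move=> e; split=> _.
    by have [-> _] := tr e 0 (z0 e); rewrite /F !D0.
  by have [-> _] := tr e (len e) (zl e); rewrite /F !Dl.
split=> //.
- by move=> e; case: (dd e).
- split; first by move=> e; case: (dd e) => -[].
  by move=> z; exists 0.
- move=> z; split=> //.
  rewrite /normal_derivative.
  rewrite (eq_bigr (fun e => F1 e (len e))); last by move=> e _; case: (tr e _ (zl e)).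
  rewrite [X in _ - X](eq_bigr (fun e => F1 e 0)); last by move=> e _; case: (tr e _ (z0 e)).
  have := cw z; have := cv z; rewrite !kirchhoffE => h1 h2.
  by apply: complexP; rewrite ?ReD ?ImD ?ReN ?ImN ?Re_sum ?Im_sum.
- move=> e; case: (dd e) => _ _ hWW.
  have H := ae_imp2 (fun x => @conj _ _) (fw e) (fv e).
  have H' := ae_imp2 (fun x => @conj _ _) (hw e) (hv e).
  apply: ae_imp2 (ae_imp2 (fun x => @conj _ _) H H') hWW => x [[h1 h2] [h3 h4]] h5 xl.
  rewrite h5//; apply: complexP; rewrite ?ReD ?ImD ?ReN ?ImN ?ReM ?ImM.
    by have := h3 xl; rewrite /reG /re => ->; have := h1 xl; rewrite /reG /re => ->.
  by have := h4 xl; rewrite /imG /im => ->; have := h2 xl; rewrite /imG /im => ->.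
Qed.

End ComplexGraph.

(** * Eigenfunctions of the Krein Laplacian *)

Section Adjoint.
Context {R : realType} (G : metric_graph R).
Variables (q : edge G -> R -> R) (M : R).
Hypothesis mq : forall e, measurable_fun setT (q e).
Hypothesis qb : forall e x, 0 <= q e x <= M.
Local Notation E := (edge G).
Local Notation V := (vertex G).
Local Notation Y := (L2space (@len R G)).
Implicit Types (w v : Y) (e : E) (f h g : gfun G) (u : E -> R -> R).
Local Notation opS := (@opS R E (@len R G) q).
Local Notation aform := (@aform R E (@len R G) q).
Local Notation bform := (@bform R E (@len R G) q).
Local Notation clamped := (@clamped R E V (@src R G) (@tgt R G) (@len R G)).
Local Notation real_adjoint := (@real_adjoint R E V (@src R G) (@tgt R G) (@len R G) q).
Local Notation T := (minimal_operator q).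

Let len_gt0' e : 0 < len e. Proof. exact: len_gt0. Qed.
Let pa : psd_form aform := @aform_psd R E _ q M mq qb.
Let pb : psd_form bform := @bform_psd R E _ q M mq qb.

Definition pairing u u' : R := \sum_e int (len e) (fun x => u e x * u' e x).

Lemma pairingC u u' : pairing u u' = pairing u' u.
Proof. by apply: eq_bigr => e _; apply: eq_int => x _; rewrite mulrC. Qed.

Lemma pairing_raeq u1 u2 u3 u4 : L2real u1 -> L2real u2 -> L2real u3 -> L2real u4 ->
  raeqG u1 u3 -> raeqG u2 u4 -> pairing u1 u2 = pairing u3 u4.
Proof.
move=> h1 h2 h3 h4 e1 e2; apply: eq_bigr => e _; apply: raeq_int.
- exact: (mfunM (h1 e).1 (h2 e).1).
- exact: (mfunM (h3 e).1 (h4 e).1).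
- exact: raeqM.
Qed.

Lemma pairing_linear (c : R) u u1 u2 : L2real u -> L2real u1 -> L2real u2 ->
  pairing u (fun e x => c * u1 e x + u2 e x) = c * pairing u u1 + pairing u u2.
Proof.
move=> h h1 h2; rewrite /pairing mulr_sumr -big_split/=; apply: eq_bigr => e _.
have i1 := L2M (h e) (h1 e); have i2 := L2M (h e) (h2 e).
rewrite -(intZ c i1) -(intD (L1Z c i1) i2); apply: eq_int => x _.
by rewrite mulrDr mulrCA.
Qed.

Lemma pairingZ (c : R) u u1 : L2real u -> L2real u1 ->
  pairing u (fun e x => c * u1 e x) = c * pairing u u1.
Proof.
move=> h h1; rewrite /pairing mulr_sumr; apply: eq_bigr => e _.
by rewrite -(intZ c (L2M (h e) (h1 e))); apply: eq_int => x _; rewrite mulrCA.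
Qed.

Lemma pairing0 u : pairing u (fun _ _ => 0) = 0.
Proof.
rewrite /pairing big1// => e _; rewrite (@eq_int _ _ _ (fun _ => 0)) ?int_cst ?mul0r ?ltW//.
by move=> x _; rewrite mulr0.
Qed.

Lemma L2_opS w : L2real (opS w). Proof. by move=> e; exact: (opS_L2 mq qb). Qed.
Lemma L2_d0 w : L2real (d0 w). Proof. by move=> e; exact: d0_L2. Qed.
Lemma L2real0 : L2real (fun (_ : E) _ => 0 : R). Proof. by move=> e; exact: L2_cst. Qed.
Lemma L2realD (c : R) u u' : L2real u -> L2real u' -> L2real (fun e x => c * u e x + u' e x).
Proof. by move=> h h' e; apply: L2D; [exact: L2Z|exact: h']. Qed.

Lemma pairing_opS_d0 w v : pairing (opS w) (d0 v) = aform w v.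
Proof. by rewrite (aformE len_gt0' mq qb). Qed.

Lemma inner_Re f g : L2_graph f -> L2_graph g -> complex.Re (inner f g) =
  pairing (reG f) (reG g) + pairing (imG f) (imG g).
Proof.
move=> /L2_graphP[f1 f2] /L2_graphP[g1 g2].
rewrite /inner Re_sum /pairing -big_split/=; apply: eq_bigr => e _.
rewrite -(intD (L2M (f1 e) (g1 e)) (L2M (f2 e) (g2 e))); apply: eq_int => x _.
by rewrite /reG /imG /re /im; case: (f e x) (g e x) => a b [c d] /=; ring.
Qed.

Lemma inner_Im f g : L2_graph f -> L2_graph g -> complex.Im (inner f g) =
  pairing (imG f) (reG g) - pairing (reG f) (imG g).
Proof.
move=> /L2_graphP[f1 f2] /L2_graphP[g1 g2].
rewrite /inner Im_sum /pairing -sumrB/=; apply: eq_bigr => e _.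
rewrite -(intB (L2M (f2 e) (g1 e)) (L2M (f1 e) (g2 e))); apply: eq_int => x _.
by rewrite /reG /imG /re /im; case: (f e x) (g e x) => a b [c d] /=; ring.
Qed.

Definition cplx u : gfun G := fun e x => (u e x)%:C.

Lemma L2_cplx u : L2real u -> L2_graph (cplx u).
Proof. by move=> hu; apply/L2_graphP; split=> //; exact: L2real0. Qed.

Lemma real_minimal_d0 w : clamped w -> real_minimal q (d0 w) (opS w).
Proof. by move=> cw; exists w; split=> // e; exact: raeq_refl. Qed.

Lemma clamped0 : clamped 0.
Proof. by move=> z; apply: scalar_form0; exact: kirchhoff_scalar. Qed.

Lemma d00 e x : x \in `[0, len e] -> d0 (0 : Y) e x = 0.
Proof.
rewrite in_itv/= => /andP[_ xl].
have := d0_linear 1 (0 : Y) 0 xl; rewrite scaler0 addr0 mul1r.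
by move: (d0 0 e x) => *; lra.
Qed.

Lemma real_minimal00 : real_minimal q (fun _ _ => 0) (fun _ _ => 0).
Proof.
exists 0; split; first exact: clamped0.
  by move=> e; apply: raeq_eq => x xl; rewrite d00//; exact: subset_itv_oo_cc.
move=> e; apply: raeq_eq => x xl.
by rewrite /opS d00 ?mulr0 ?addr0 ?oppr0//; exact: subset_itv_oo_cc.
Qed.

Lemma minimal_operator_cplx w : clamped w -> T (cplx (d0 w)) (cplx (opS w)).
Proof.
move=> cw; apply: real_minimal_operator.
- exact/L2_cplx/L2_d0.
- exact/L2_cplx/L2_opS.
- exact: real_minimal_d0.
- exact: real_minimal00.
Qed.

(** Since q is real, S commutes with conjugation; testing with real functions
separates the two parts. *)
Lemma adjointP g h : adjoint T g h <->
  [/\ L2_graph g, L2_graph h, real_adjoint (reG g) (reG h) & real_adjoint (imG g) (imG h)].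
Proof.
split=> [[hg hh adj]|[hg hh ar ai]].
  have {}adj (w : Y) (cw : clamped w) : inner (cplx (opS w)) g = inner (cplx (d0 w)) h.
    exact: (adj _ _ (minimal_operator_cplx cw)).
  have im0 u : imG (cplx u) = fun _ _ => 0 by [].
  have re0 u : reG (cplx u) = u by [].
  have p0 u : pairing (fun _ _ => 0) u = 0 by rewrite pairingC pairing0.
  split=> // w cw.
    have := congr1 (@complex.Re R) (adj w cw).
    rewrite !inner_Re//; try exact/L2_cplx/L2_d0; try exact/L2_cplx/L2_opS.
    by rewrite !im0 !re0 !p0 !addr0.
  have := congr1 (@complex.Im R) (adj w cw).
  rewrite !inner_Im//; try exact/L2_cplx/L2_d0; try exact/L2_cplx/L2_opS.
  by rewrite !im0 !re0 !p0 !sub0r => /oppr_inj.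
split=> // f k Tfk.
have [[w [cw fw kw]] [v [cv fv kv]]] := minimal_operator_real Tfk.
have fL : L2_graph f.
  case: Tfk => fH2 _ _ _ _ e.
  by have [] := in_H2_rep (len_gt0' e) (fH2 e).
have kL : L2_graph k by case: Tfk.
have [f1 f2] := (L2_graphP f).1 fL; have [k1 k2] := (L2_graphP k).1 kL.
have [g1 g2] := (L2_graphP g).1 hg; have [h1 h2] := (L2_graphP h).1 hh.
have Ef1 u : L2real u -> pairing (reG f) u = pairing (d0 w) u.
  move=> hu; apply: pairing_raeq => //; first exact: L2_d0.
  by move=> e; exact: raeq_refl.
have Ef2 u : L2real u -> pairing (imG f) u = pairing (d0 v) u.
  move=> hu; apply: pairing_raeq => //; first exact: L2_d0.
  by move=> e; exact: raeq_refl.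
have Ek1 u : L2real u -> pairing (reG k) u = pairing (opS w) u.
  move=> hu; apply: pairing_raeq => //; first exact: L2_opS.
  by move=> e; exact: raeq_refl.
have Ek2 u : L2real u -> pairing (imG k) u = pairing (opS v) u.
  move=> hu; apply: pairing_raeq => //; first exact: L2_opS.
  by move=> e; exact: raeq_refl.
have A1 : pairing (opS w) (reG g) = pairing (d0 w) (reG h) := ar w cw.
have A2 : pairing (opS w) (imG g) = pairing (d0 w) (imG h) := ai w cw.
have A3 : pairing (opS v) (reG g) = pairing (d0 v) (reG h) := ar v cv.
have A4 : pairing (opS v) (imG g) = pairing (d0 v) (imG h) := ai v cv.
have C1 := etrans (Ek1 _ g1) (etrans A1 (esym (Ef1 _ h1))).
have C2 := etrans (Ek2 _ g2) (etrans A4 (esym (Ef2 _ h2))).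
have C3 := etrans (Ek2 _ g1) (etrans A3 (esym (Ef2 _ h1))).
have C4 := etrans (Ek1 _ g2) (etrans A2 (esym (Ef1 _ h2))).
apply: complexP.
  exact: etrans (inner_Re kL hg) (etrans (congr2 +%R C1 C2) (esym (inner_Re fL hh))).
exact: etrans (inner_Im kL hg) (etrans (congr2 (fun x y => x - y) C3 C4) (esym (inner_Im fL hh))).
Qed.

(** t u = S w for an eigenvector w of the pencil; the function u is the real
eigenfunction of S* that corresponds to w. *)
Definition real_eigenfunction (t : R) u : Prop := L2real u /\ exists w, [/\ clamped w,
  raeqG (fun e x => t * u e x) (opS w) &
  forall v, clamped v -> bform w v = t * aform w v].

(** For u = w + k with S* k = 0, pairing with S v shows that t u - S w is
orthogonal to dom S, hence zero by density. *)
Lemma real_adjoint_eigenfunction (t : R) u (k : E -> R -> R) w : L2real u -> L2real k -> clamped w ->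
  real_adjoint u (fun e x => t * u e x) -> real_adjoint k (fun _ _ => 0) ->
  raeqG u (fun e x => d0 w e x + k e x) -> real_eigenfunction t u.
Proof.
move=> hu hk cw au ak uwk; split=> //; exists w.
have htu : L2real (fun e x => t * u e x) by move=> e; exact: L2Z.
have Pk v : clamped v -> pairing (opS v) k = 0 by move=> cv; rewrite -(pairing0 (d0 v)); exact: ak.
have Pu v : clamped v -> pairing (opS v) u = aform v w.
  move=> cv; rewrite (@pairing_raeq _ _ (opS v) (fun e x => 1 * d0 w e x + k e x)).
  - by rewrite (pairing_linear 1 (L2_opS v) (L2_d0 w) hk) Pk// addr0 mul1r pairing_opS_d0.
  - exact: L2_opS.
  - exact: hu.
  - exact: L2_opS.
  - exact: (L2realD 1 (L2_d0 w) hk).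
  - by move=> e; exact: raeq_refl.
  - by move=> e; apply: ae_imp (uwk e) => x h xl; rewrite h// mul1r.
have tuw : raeqG (fun e x => t * u e x) (opS w).
  have D := clamped_dense len_gt0' mq qb (h := fun e x => (-1) * opS w e x + t * u e x)
    (src := @src R G) (tgt := @tgt R G).
  have hL := L2realD (-1) (L2_opS w) htu.
  have {}D e : raeq (len e) (fun x => -1 * opS w e x + t * u e x) (fun _ => 0).
    apply: D => // v cv.
    change (pairing (d0 v) (fun e x => -1 * opS w e x + t * u e x) = 0).
    rewrite (pairing_linear (-1) (L2_d0 v) (L2_opS w) htu).
    rewrite (pairingC _ (opS w)) pairing_opS_d0.
    have <- : pairing (opS v) u = pairing (d0 v) (fun e x => t * u e x) := au v cv.
    rewrite Pu//.
    by rewrite (psdC pa) mulN1r addNr.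
  by move=> e; apply: ae_imp (D e) => x h xl; have := h xl; lra.
split=> // v cv.
have -> : bform w v = pairing (opS v) (opS w) by rewrite (psdC pb).
have <- : pairing (opS v) (fun e x => t * u e x) = pairing (opS v) (opS w).
  apply: (pairing_raeq (L2_opS v) htu (L2_opS v) (L2_opS w) _ tuw).
  by move=> e; exact: raeq_refl.
by rewrite pairingZ// ?Pu ?(psdC pa w)//; exact: L2_opS.
Qed.

(** Conversely k = u - d0 w is killed by S*, since <S v, u> = <S w, S v> / t =
<S w, v>. *)
Lemma eigenfunction_real_adjoint (t : R) u : t != 0 -> real_eigenfunction t u -> exists w k, [/\ clamped w, L2real k,
  real_adjoint u (fun e x => t * u e x), real_adjoint k (fun _ _ => 0) &
  raeqG u (fun e x => d0 w e x + k e x)].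
Proof.
move=> t0 [hu [w [cw uw ev]]].
have htu : L2real (fun e x => t * u e x) by move=> e; exact: L2Z.
have Pu v : clamped v -> pairing (opS v) u = aform v w.
  move=> cv; apply: (mulfI t0).
  rewrite (psdC pa) -ev// (psdC pb) -pairingZ//; last exact: L2_opS.
  change (pairing (opS v) (fun e x => t * u e x) = pairing (opS v) (opS w)).
  apply: (pairing_raeq (L2_opS v) htu (L2_opS v) (L2_opS w) _ uw).
  by move=> e; exact: raeq_refl.
exists w, (fun e x => (-1) * d0 w e x + u e x); split=> //.
- exact: (L2realD (-1) (L2_d0 w) hu).
- move=> v cv; change (pairing (opS v) u = pairing (d0 v) (fun e x => t * u e x)).
  rewrite Pu// (psdC pa).
  rewrite -(pairing_opS_d0 w v) pairingC; apply: pairing_raeq => //.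
  - exact: L2_d0.
  - exact: L2_opS.
  - exact: L2_d0.
  - by move=> e; exact: raeq_refl.
  - by move=> e; exact: raeq_sym.
- move=> v cv; change (pairing (opS v) (fun e x => -1 * d0 w e x + u e x)
    = pairing (d0 v) (fun _ _ => 0)).
  rewrite pairing0.
  rewrite (pairing_linear (-1) (L2_opS v) (L2_d0 w) hu) Pu// pairing_opS_d0.
  by rewrite mulN1r addNr.
- by move=> e; apply: raeq_eq => x _; rewrite mulN1r addrA subrr add0r.
Qed.

Local Notation K := (krein_laplacian q).

Lemma reG_scale (t : R) f : reG (fun e x => t%:C * f e x) = fun e x => t * reG f e x.
Proof. by apply/funext => e; apply/funext => x; exact: ReM. Qed.
Lemma imG_scale (t : R) f : imG (fun e x => t%:C * f e x) = fun e x => t * imG f e x.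
Proof. by apply/funext => e; apply/funext => x; exact: ImM. Qed.

(** The buckling problem: for t <> 0 the eigenspace consists of the S w / t
with w an eigenvector of the pencil, in real and imaginary parts. *)
Lemma eigenspaceP (t : R) f : t != 0 ->
  eigenspace K t f <-> real_eigenfunction t (reG f) /\ real_eigenfunction t (imG f).
Proof.
move=> t0; split.
  move=> [/adjointP[fL _ ar ai] [f0 [g [[h0 Tf0] kg fg]]]].
  have /adjointP[gL _ gr gi] := kg.
  have [[w [cw fw _]] [v [cv fv _]]] := minimal_operator_real Tf0.
  have [f1 f2] := (L2_graphP f).1 fL; have [g1 g2] := (L2_graphP g).1 gL.
  have /gaeqP[e1 e2] := fg.
  rewrite reG_scale in ar; rewrite imG_scale in ai.
  split.
    apply: (real_adjoint_eigenfunction f1 g1 cw ar gr) => e.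
    by apply: ae_imp2 (e1 e) (fw e) => x h1 h2 xl; rewrite h1// -h2// /reG /re ReD.
  apply: (real_adjoint_eigenfunction f2 g2 cv ai gi) => e.
  by apply: ae_imp2 (e2 e) (fv e) => x h1 h2 xl; rewrite h1// -h2// /imG /im ImD.
move=> [rr ri]; have f1 := rr.1; have f2 := ri.1.
have [w [k [cw hk ar kr ew]]] := eigenfunction_real_adjoint t0 rr.
have [v [l [cv hl ai ki ev]]] := eigenfunction_real_adjoint t0 ri.
have fL : L2_graph f by apply/L2_graphP.
split.
  apply/adjointP; split=> //.
  - by apply/L2_graphP; rewrite reG_scale imG_scale; split=> e; exact: L2Z.
  - by rewrite reG_scale.
  - by rewrite imG_scale.
exists (fun e x => d0 w e x +i* d0 v e x), (fun e x => k e x +i* l e x); split.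
- exists (fun e x => opS w e x +i* opS v e x); apply: real_minimal_operator.
  + by apply/L2_graphP; split; exact: L2_d0.
  + by apply/L2_graphP; split; exact: L2_opS.
  + exact: real_minimal_d0.
  + exact: real_minimal_d0.
- apply/adjointP; split=> //.
  + by apply/L2_graphP.
  + by apply/L2_graphP; split; exact: L2real0.
- by apply/gaeqP; split; [exact: ew|exact: ev].
Qed.

(** In the Krein-von Neumann extension every element of ker S* is in the
domain, with dom S component zero. *)
Lemma eigenspace0P f : eigenspace K 0 f <->
  [/\ L2_graph f, real_adjoint (reG f) (fun _ _ => 0) & real_adjoint (imG f) (fun _ _ => 0)].
Proof.
have z1 : reG (fun e x => 0%:C * f e x) = fun _ _ => 0.
  by rewrite reG_scale; apply/funext => e; apply/funext => x; rewrite mul0r.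
have z2 : imG (fun e x => 0%:C * f e x) = fun _ _ => 0.
  by rewrite imG_scale; apply/funext => e; apply/funext => x; rewrite mul0r.
split=> [[/adjointP[h1 _ h2 h3] _]|[h1 h2 h3]].
  by rewrite z1 in h2; rewrite z2 in h3.
have L0 : L2_graph (fun (_ : E) _ => 0 : R[i]).
  by apply/L2_graphP; split; exact: L2real0.
split.
  apply/adjointP; split=> //; rewrite ?z1 ?z2//.
  by apply/L2_graphP; rewrite z1 z2; split; exact: L2real0.
exists (fun _ _ => 0), f; split.
- exists (fun _ _ => 0); apply: real_minimal_operator => //; exact: real_minimal00.
- by apply/adjointP; split.
- by move=> e; apply: aeW => x _; rewrite add0r.
Qed.

End Adjoint.

(** * Dimensions and the ground states *)

Section Dimension.
Context {R : realType} (G : metric_graph R).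
Implicit Types (f : gfun G) (P : set (gfun G)) (m n : nat).

Lemma gaeq_comb m (f g : 'I_m -> gfun G) (c : 'I_m -> R[i]) :
  (forall i, gaeq (f i) (g i)) ->
  gaeq (fun e x => \sum_i c i * f i e x) (fun e x => \sum_i c i * g i e x).
Proof.
move=> fg e.
have h := @filter_forall _ _ (fun i x => x \in `]0, len e[ -> f i e x = g i e x)
  _ (ae_filter_ringOfSetsType (@lebesgue_measure R)) (fun i => fg i e).
by apply: ae_imp h => x h xl; apply: eq_bigr => i _; rewrite (h i).
Qed.

Lemma independent_le_dim P n m (b : 'I_m -> gfun G) : has_dim P n ->
  (forall i, P (b i)) ->
  (forall c : 'I_m -> R[i], gaeq (fun e x => \sum_i c i * b i e x) (fun _ _ => 0) ->
     forall i, c i = 0) ->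
  (m <= n)%N.
Proof.
move=> [b' [_ _ span]] Pb ind; rewrite leqNgt; apply/negP => nm.
have [M bM] := choice (fun i => span _ (Pb i)).
have [c [i ci] c0] := @exists_annihilating_combination R[i] m n M nm.
move: ci; rewrite ind ?eqxx// => e.
have := gaeq_comb c bM e.
apply: ae_imp => x h xl; rewrite h//.
under eq_bigr do rewrite mulr_sumr.
rewrite exchange_big/= big1// => j _.
under eq_bigr do rewrite mulrA.
by rewrite -mulr_suml c0 mul0r.
Qed.

Lemma has_dim_unique P n m : has_dim P n -> has_dim P m -> n = m.
Proof.
move=> Pn Pm; have [b [Pb bi _]] := Pn; have [b' [Pb' bi' _]] := Pm.
apply/eqP; rewrite eqn_leq (independent_le_dim Pm Pb bi).
exact: (independent_le_dim Pn Pb' bi').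
Qed.

Lemma reG_comb m (c : 'I_m -> R[i]) (u : 'I_m -> edge G -> R -> R) :
  reG (fun e x => \sum_i c i * cplx (u i) e x) =
  fun e x => \sum_i complex.Re (c i) * u i e x.
Proof.
apply/funext => e; apply/funext => x; rewrite /reG /re Re_sum.
by apply: eq_bigr => i _; rewrite /cplx; case: (c i) => p r /=; rewrite mulr0 subr0.
Qed.

Lemma imG_comb m (c : 'I_m -> R[i]) (u : 'I_m -> edge G -> R -> R) :
  imG (fun e x => \sum_i c i * cplx (u i) e x) =
  fun e x => \sum_i complex.Im (c i) * u i e x.
Proof.
apply/funext => e; apply/funext => x; rewrite /imG /im Im_sum.
by apply: eq_bigr => i _; rewrite /cplx; case: (c i) => p r /=; rewrite mulr0 add0r.
Qed.

(** Transfers a real basis to a complex one: real functions that span the real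
and imaginary parts over the reals span the functions over the complex
numbers. *)
Lemma cplx_has_dim P m (u : 'I_m -> edge G -> R -> R) :
  (forall i, P (cplx (u i))) ->
  (forall c : 'I_m -> R, raeqG (fun e x => \sum_i c i * u i e x) (fun _ _ => 0) ->
     forall i, c i = 0) ->
  (forall f, P f -> (exists c : 'I_m -> R, raeqG (reG f) (fun e x => \sum_i c i * u i e x)) /\
                    (exists c : 'I_m -> R, raeqG (imG f) (fun e x => \sum_i c i * u i e x))) ->
  has_dim P m.
Proof.
move=> Pu ind span; exists (fun i => cplx (u i)); split=> //.
  move=> c /gaeqP[]; rewrite reG_comb imG_comb => h1 h2 i.
  by apply: complexP => /=; [exact: (ind _ h1)|exact: (ind _ h2)].
move=> f /span[[c hc] [d hd]]; exists (fun i => c i +i* d i).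
by apply/gaeqP; rewrite reG_comb imG_comb.
Qed.

End Dimension.

Section KernelDimension.
Context {R : realType} (G : metric_graph R).
Variables (q : edge G -> R -> R) (M : R).
Hypothesis mq : forall e, measurable_fun setT (q e).
Hypothesis qb : forall e x, 0 <= q e x <= M.
Local Notation E := (edge G).
Local Notation V := (vertex G).
Local Notation len := (@len R G).
Local Notation site := (@site E V (@src R G) (@tgt R G)).
Local Notation real_adjoint := (@real_adjoint R E V (@src R G) (@tgt R G) len q).
Local Notation solution := (@solution R E len q).
Hypothesis no_isolated : forall z : V, exists p, site p = z.

Let len_gt0' e : 0 < len e. Proof. exact: len_gt0. Qed.

Lemma solution_comb m (c : 'I_m -> R) (u : 'I_m -> E -> R -> R) :
  (forall i, solution (u i)) -> solution (fun e x => \sum_i c i * u i e x).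
Proof.
move=> su; elim: (index_enum 'I_m) => [|i r [G1 ih]].
  exists (fun _ _ => 0) => e.
  have -> : (fun x : R => \sum_(i <- [::]) c i * u i e x) = fun _ => 0.
    by apply/funext => x; rewrite big_nil.
  have -> : (fun x : R => q e x * \sum_(i <- [::]) c i * u i e x) = fun _ => 0.
    by apply/funext => x; rewrite big_nil mulr0.
  by split; exact: AC_cst.
have := solution_linear (c i) (su i) (ex_intro _ G1 ih : solution _).
congr solution; apply/funext => e; apply/funext => x; by rewrite big_cons.
Qed.

(** The solutions with value 1 at one vertex and 0 at the others form a basis;
independence is read off from the vertex values, which needs an edge at every
vertex. *)
Lemma kernel_dim : has_dim (eigenspace (krein_laplacian q) 0) #|V|.
Proof.
have [S HS] := choice (fun v => let: ex_intro2 g h1 h2 :=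
  exists_solution len_gt0' mq qb (fun p => (v == site p)%:R : R) in
  ex_intro (fun g => solution g /\ forall p, endval len g p = (v == site p)%:R) g (conj h1 h2)).
pose u (i : 'I_#|V|) := S (enum_val i).
have su i : solution (u i) by case: (HS (enum_val i)).
have eu (c : 'I_#|V| -> R) p : endval len (fun e x => \sum_i c i * u i e x) p = c (enum_rank (site p)).
  transitivity (\sum_i c i * endval len (u i) p); first by case: p => e [|].
  rewrite (bigD1 (enum_rank (site p)))//= (HS _).2 enum_rankK eqxx mulr1.
  rewrite big1 ?addr0// => i ip; rewrite (HS _).2 -(can_eq enum_rankK) enum_valK.
  by rewrite (negbTE ip) mulr0.
apply: (@cplx_has_dim _ _ _ _ u).
- move=> i; apply/(eigenspace0P mq qb); split.
  + by apply: L2_cplx => e; exact: solution_L2 (su i).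
  + apply: (solution_real_adjoint len_gt0' (c := fun z => (enum_val i == z)%:R) (su i)).
    by move=> p; exact: (HS _).2.
  + move=> w cw; apply: eq_bigr => e _; apply: eq_int => x _.
    by rewrite !mulr0.
- move=> c hc i; have [p pi] := no_isolated (enum_val i).
  have s0 : solution (fun _ _ => 0).
    have := solution_comb (fun _ => 0) su; congr solution.
    by apply/funext => e; apply/funext => x; rewrite big1// => j _; rewrite mul0r.
  have := solution_raeq len_gt0' (solution_comb c su) s0 hc p.
  rewrite eu pi enum_valK => ->; by case: (p) => e [|].
- have real_span g : L2real g -> real_adjoint g (fun _ _ => 0) ->
      exists c : 'I_#|V| -> R, raeqG g (fun e x => \sum_i c i * u i e x).
    move=> hg ag.
    have [c [H [sH eH Hg]]] := real_adjoint_solution len_gt0' mq qb no_isolated hg ag.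
    pose d (i : 'I_#|V|) := c (enum_val i); exists d => e.
    have sD := solution_linear (-1) (solution_comb d su) sH.
    have := solution_unique len_gt0' qb sD _ e.
    move=> /(_ _)/wrap[p|D].
      by rewrite endval_linear eu eH /d enum_rankK mulN1r addNr.
    apply: ae_imp2 D (Hg e) => x h1 h2 xl; rewrite -h2//.
    by have := h1 xl; move: (H e x) (\sum_i _) => *; lra.
  by move=> f /(eigenspace0P mq qb)[/L2_graphP[f1 f2] ar ai]; split; apply: real_span.
Qed.

End KernelDimension.

(** * Real bases of the eigenspaces *)

Section MaximalFamily.
Context {R : realType} {Y : lmodType R}.
Variables a b : Y -> Y -> R.
Hypotheses (pa : psd_form a) (pb : psd_form b).

(** A family of maximal size is spanning modulo null vectors. *)
Lemma exists_maximal_family (P : Y -> Prop) n :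
  (forall m (W : 'I_m -> Y), (forall i, P (W i)) -> independent_mod a W -> (m <= n)%N) ->
  exists m, exists W : 'I_m -> Y, [/\ forall i, P (W i), independent_mod a W &
    forall y, P y -> exists c : 'I_m -> R,
      a (y - \sum_i c i *: W i) (y - \sum_i c i *: W i) = 0].
Proof.
move=> bound.
pose p m := `[< exists W : 'I_m -> Y, (forall i, P (W i)) /\ independent_mod a W >].
have p0 : exists m, p m.
  by exists 0%N; apply/asboolP; exists (fun _ => 0); split=> [[]//|c _ []].
have pn m : p m -> (m <= n)%N by move/asboolP => [W [WP Wi]]; exact: bound WP Wi.
case: (ex_maxnP p0 pn) => m /asboolP[W [WP Wi]] mmax; exists m, W; split=> // y Py.
apply: contrapT => ns.
suff /mmax : p m.+1 by rewrite ltnn.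
apply/asboolP; exists (fun i => if unlift ord0 i is Some j then W j else y); split.
  by move=> i; case: unlift.
move=> c; rewrite big_ord_recl unlift_none.
under eq_bigr do rewrite liftK.
move=> c0; have [z|nz] := eqVneq (c ord0) 0.
  move=> i; case: (unliftP ord0 i) => [j|] ->//.
  by apply: (Wi (fun j => c (lift ord0 j))); move: c0; rewrite z scale0r add0r.
case: ns; exists (fun j => - (c (lift ord0 j) / c ord0)).
have -> : y - \sum_i (- (c (lift ord0 i) / c ord0)) *: W i =
   (c ord0)^-1 *: (c ord0 *: y + \sum_(i < m) c (lift ord0 i) *: W i).
  rewrite scalerDr scalerA mulVf// scale1r scaler_sumr -sumrN; congr (_ + _).
  by apply: eq_bigr => i _; rewrite scalerA scaleNr opprK mulrC.
by rewrite (psdZl pa) (psdZr pa) c0 !mulr0.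
Qed.

Variable D : set Y.
Hypothesis D0 : D 0.
Hypothesis DL : forall (k : R) u v, D u -> D v -> D (k *: u + v).

Lemma eigenvector_linear t k u v :
  eigenvector a b D t u -> eigenvector a b D t v -> eigenvector a b D t (k *: u + v).
Proof.
move=> [Du hu] [Dv hv]; split=> [|w Dw]; first exact: DL.
rewrite (psdDl pb) (psdZl pb) (psdDl pa) (psdZl pa) hu// hv//.
by rewrite mulrDr mulrCA.
Qed.

Lemma eigenvector0 t : eigenvector a b D t 0.
Proof. by split=> // v _; rewrite -(scale0r 0) (psdZl pb) (psdZl pa) !mul0r mulr0. Qed.

Lemma eigenvector_comb t (I : Type) (r : seq I) (p : pred I) (c : I -> R) (W : I -> Y) :
  (forall i, p i -> eigenvector a b D t (W i)) ->
  eigenvector a b D t (\sum_(i <- r | p i) c i *: W i).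
Proof.
move=> hW; elim/big_rec: _ => [|i y pi hy]; first exact: eigenvector0.
by apply: eigenvector_linear => //; exact: hW.
Qed.

End MaximalFamily.

Section EigenspaceBasis.
Context {R : realType} (G : metric_graph R).
Variables (q : edge G -> R -> R) (M : R).
Hypothesis mq : forall e, measurable_fun setT (q e).
Hypothesis qb : forall e x, 0 <= q e x <= M.
Local Notation E := (edge G).
Local Notation V := (vertex G).
Local Notation len := (@len R G).
Local Notation Y := (L2space len).
Implicit Types (w v : Y) (e : E).
Local Notation opS := (@opS R E len q).
Local Notation aform := (@aform R E len q).
Local Notation bform := (@bform R E len q).
Local Notation clamped := (@clamped R E V (@src R G) (@tgt R G) len).

Let len_gt0' e : 0 < len e. Proof. exact: len_gt0. Qed.
Let pa : psd_form aform := @aform_psd R E _ q M mq qb.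
Let pb : psd_form bform := @bform_psd R E _ q M mq qb.

Lemma clamped_linear (k : R) w v : clamped w -> clamped v -> clamped (k *: w + v).
Proof.
move=> cw cv z; rewrite (kirchhoff_scalar _ _ len_gt0')/=.
by rewrite (cw z) (cv z) mulr0 addr0.
Qed.

Lemma opS0 e x : x \in `]0, len e[ -> opS 0 e x = 0.
Proof.
move=> xl; have xl' : x <= len e by exact: itv_le xl.
have := opS_linear q 1 (0 : Y) 0 xl'; rewrite scaler0 addr0 mul1r.
by move: (opS 0 e x) => *; lra.
Qed.

Lemma opS_comb m (c : 'I_m -> R) (W : 'I_m -> Y) e x : x \in `]0, len e[ ->
  opS (\sum_i c i *: W i) e x = \sum_i c i * opS (W i) e x.
Proof.
move=> xl; elim: (index_enum 'I_m) => [|i r ih]; first by rewrite !big_nil opS0.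
by rewrite !big_cons (opS_linear q _ _ _ (itv_le xl)) ih.
Qed.

(** Null vectors of b are those with S w = 0 almost everywhere, so they are
null for a as well ([raeq_bform_eq0]). *)
Lemma bform_eq0 w : bform w w = 0 -> raeqG (opS w) (fun _ _ => 0).
Proof.
move=> b0 e; apply: L2_int_sqr_eq0; first exact: (opS_L2 mq qb).
apply/eqP; rewrite eq_le int_ge0 ?andbT; last by move=> x _; exact: sqr_ge0.
rewrite -b0 /bform (bigD1 e)//= lerDl sumr_ge0// => e' _.
by apply: int_ge0 => x _; rewrite -expr2 sqr_ge0.
Qed.

Lemma raeq_bform_eq0 w : raeqG (opS w) (fun _ _ => 0) -> aform w w = 0.
Proof.
move=> w0; apply/eqP; rewrite eq_le (psd_ge0 pa) andbT.
apply: le_trans (aform_le_bform len_gt0' mq qb w) _.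
suff -> : bform w w = 0 by rewrite mulr0.
rewrite /bform big1// => e _.
have m1 := (opS_L2 mq qb w e).1.
transitivity (int (len e) (fun _ : R => 0)).
  apply: raeq_int; [exact: (mfunM m1 m1)|exact: (L2_cst (len e) 0).1|].
  by apply: ae_imp (w0 e) => x h xl; rewrite h// mulr0.
by rewrite int_cst ?mul0r// ltW.
Qed.

Lemma eigenvector_eigenfunction (t : R) w : eigenvector aform bform clamped t w -> real_eigenfunction q t (opS w).
Proof.
move=> [cw hw]; split; first exact: (L2_opS mq qb).
exists (t *: w); split.
- by have := clamped_linear t cw (clamped0 (G := G)); rewrite addr0.
- move=> e; apply: raeq_eq => x xl.
  by have := opS_linear q t w 0 (itv_le xl); rewrite addr0 opS0// addr0 => ->.
- by move=> v cv; rewrite (psdZl pb) (psdZl pa) hw.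
Qed.

(** For t < 0 the identity b w w = t * a w w forces b w w = 0. *)
Lemma negative_eigenspace (t : R) n : t < 0 ->
  has_dim (eigenspace (krein_laplacian q) t) n -> n = 0%N.
Proof.
move=> t0 [f [fE fi _]]; have t0' : t != 0 by rewrite lt_eqF.
have u0 u : real_eigenfunction q t u -> raeqG u (fun _ _ => 0).
  move=> [hu [w [cw uw hw]]] e.
  have b0 : bform w w = 0.
    apply/eqP; rewrite eq_le (psd_ge0 pb) andbT hw//.
    by apply: mulr_le0_ge0; [exact: ltW|exact: (psd_ge0 pa)].
  apply: ae_imp2 (uw e) (bform_eq0 b0 e) => x h1 h2 xl.
  by apply: (mulfI t0'); rewrite mulr0 h1// h2.
case: n f fE fi => // n f fE fi.
suff : (1 : R[i]) = 0 by move/eqP; rewrite oner_eq0.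
apply: (fi (fun i => (i == ord0)%:R) _ ord0) => e.
have h : gaeq (f ord0) (fun _ _ => 0).
  have [h1 h2] := (eigenspaceP mq qb (f ord0) t0').1 (fE ord0).
  by apply/gaeqP; split; exact: u0.
apply: ae_imp (h e) => x h3 xl.
rewrite big_ord_recl h3// mulr0 add0r big1// => i _.
by rewrite mul0r.
Qed.

(** A maximal independent family of eigenvectors of the pencil has at most n
members, as these give complex independent eigenfunctions. Being maximal it
spans, so the eigenfunctions form a basis, and uniqueness of the dimension
makes its size n. *)
Lemma eigenspace_basis (t : R) n : 0 < t ->
  has_dim (eigenspace (krein_laplacian q) t) n ->
  exists W : 'I_n -> Y, [/\ forall i, eigenvector aform bform clamped t (W i),
    independent_mod aform W &
    forall y, eigenvector aform bform clamped t y ->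
      (forall i, aform y (W i) = 0) -> aform y y = 0].
Proof.
move=> t0 dn; have t0' : t != 0 by rewrite gt_eqF.
have mem w : eigenvector aform bform clamped t w ->
    eigenspace (krein_laplacian q) t (cplx (opS w)).
  move=> hw; apply/(eigenspaceP mq qb _ t0'); split; first exact: eigenvector_eigenfunction.
  split; first exact: L2real0.
  exists 0; split; first exact: clamped0.
    by move=> e; apply: raeq_eq => x xl; rewrite opS0// mulr0.
  by move=> v _; rewrite -(scale0r 0) (psdZl pb) (psdZl pa) !mul0r mulr0.
have rind m (W : 'I_m -> Y) : independent_mod aform W -> forall c : 'I_m -> R,
    raeqG (fun e x => \sum_i c i * opS (W i) e x) (fun _ _ => 0) -> forall i, c i = 0.
  move=> Wi c hc; apply: Wi; apply: raeq_bform_eq0 => e.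
  by apply: ae_imp (hc e) => x h xl; rewrite opS_comb// h.
have bound m (W : 'I_m -> Y) : (forall i, eigenvector aform bform clamped t (W i)) ->
    independent_mod aform W -> (m <= n)%N.
  move=> We Wi; apply: (independent_le_dim dn (fun i => mem _ (We i))).
  move=> c /gaeqP[]; rewrite reG_comb imG_comb => h1 h2 i.
  by apply: complexP => /=; [exact: (rind _ _ Wi _ h1)|exact: (rind _ _ Wi _ h2)].
have [m [W [We Wi span]]] := exists_maximal_family pa bound.
have dm : has_dim (eigenspace (krein_laplacian q) t) m.
  apply: (@cplx_has_dim _ _ _ _ (fun i => opS (W i))).
  - by move=> i; exact: mem.
  - exact: rind.
  have rspan u : real_eigenfunction q t u -> exists c : 'I_m -> R, raeqG u (fun e x => \sum_i c i * opS (W i) e x).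
    move=> [hu [w [cw uw hw]]].
    have [c hc] := span w (conj cw hw).
    exists (fun i => t^-1 * c i) => e.
    have ev : eigenvector aform bform clamped t (w - \sum_i c i *: W i).
      have := @eigenvector_linear _ _ _ _ pa pb _ clamped_linear t (-1) _ _
        (eigenvector_comb pa pb (clamped0 (G := G)) clamped_linear (index_enum 'I_m) c
        (p := xpredT) (fun i _ => We i)) (conj cw hw).
      by rewrite scaleN1r addrC.
    have b0 : bform (w - \sum_i c i *: W i) (w - \sum_i c i *: W i) = 0.
      by rewrite ev.2 ?hc ?mulr0//; exact: ev.1.
    apply: ae_imp2 (bform_eq0 b0 e) (uw e) => x h1 h2 xl.
    apply: (mulfI t0'); rewrite h2// mulr_sumr.
    under eq_bigr do rewrite !mulrA mulfV// mul1r.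
    rewrite -(opS_comb c W xl); move: (h1 xl).
    rewrite -scaleN1r addrC (opS_linear q _ _ _ (itv_le xl)).
    by rewrite mulN1r addrC => /eqP; rewrite subr_eq0 => /eqP.
  move=> f /(eigenspaceP mq qb _ t0')[h1 h2]; split; exact: rspan.
rewrite (has_dim_unique dn dm); exists W; split=> // y ye ort.
have [c hc] := span y ye.
have : aform y (y - \sum_i c i *: W i) = 0.
  exact: (psd_diag0r pa).
rewrite (psdBr pa) (psd_sumr pa) big1 => [|i _]; first by rewrite subr0.
by rewrite (psdZr pa) ort mulr0.
Qed.

End EigenspaceBasis.

(** * From counted eigenvalues to enumerated eigenvectors *)

Local Open Scope card_scope.

Section Enumeration.
Context {R : realType} {Y : lmodType R}.
Variables a b : Y -> Y -> R.
Hypotheses (pa : psd_form a) (pb : psd_form b).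

(** Transports a family along a bijection of its index set with a set S of
positions in a list. *)
Lemma enumerate_family (S : set nat) n (W : 'I_n -> Y) :
  S #= `I_n -> independent_mod a W ->
  exists phi : nat -> Y, [/\ forall j, S j -> exists i, phi j = W i,
    forall i, exists2 j, S j & phi j = W i &
    forall m (c : 'I_m -> R), let y := \sum_(i < m | i.+1 \in S) c i *: phi i.+1 in
      a y y = 0 -> forall i : 'I_m, i.+1 \in S -> c i = 0].
Proof.
move=> /card_set_bijP[f [fS fi fs]] Wi.
exists (fun j => if insub (f j) is Some i then W i else 0); split.
- move=> j Sj; have fj : (f j < n)%N by exact: fS.
  by exists (Ordinal fj); rewrite insubT.
- move=> i; have [j Sj fj] := fs i (ltn_ord i).
  exists j => //; have lt : (f j < n)%N by rewrite fj.
  by rewrite insubT; congr W; exact/val_inj.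
move=> m c y ay i0 Si0.
have fn (i : 'I_m) : i.+1 \in S -> (f i.+1 < n)%N by rewrite inE => /fS.
pose g (i : 'I_m) : 'I_n := insubd (Ordinal (fn _ Si0)) (f i.+1).
have gE (i : 'I_m) : i.+1 \in S -> val (g i) = f i.+1.
  by move=> Si; rewrite val_insubd fn.
have yE : y = \sum_l (\sum_(i < m | (i.+1 \in S) && (g i == l)) c i) *: W l.
  rewrite /y (partition_big g xpredT)//=; apply: eq_bigr => l _.
  rewrite scaler_suml; apply: eq_bigr => i /andP[Si /eqP <-].
  rewrite (insubT (fun p => p < n)%N (fn _ Si)); congr (_ *: W _).
  by apply: val_inj; rewrite /= gE.
rewrite yE in ay; have := Wi _ ay (g i0).
rewrite (big_pred1 i0)// => i; apply/andP/eqP => [[Si /eqP gi]|->//].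
have : f i.+1 = f i0.+1 by rewrite -!gE// gi.
by move=> /fi h; apply/val_inj; case: (h Si Si0).
Qed.

Variable D : set Y.
Hypothesis D0 : D 0.

(** The bases of the eigenspaces are placed at the positions of their
eigenvalues. Joint independence reduces to independence at one level, since
the component of a null combination at one level is orthogonal to the other
components. *)
Lemma eigen_enumeration_exists (lam : nat -> R) :
  (forall j, (0 < j)%N -> 0 < lam j) ->
  (forall t, 0 < t -> exists n,
     (exists W : 'I_n -> Y, [/\ forall i, eigenvector a b D t (W i),
        independent_mod a W &
        forall y, eigenvector a b D t y -> (forall i, a y (W i) = 0) -> a y y = 0]) /\
     [set j | (0 < j)%N /\ lam j = t] #= `I_n) ->
  exists phi, eigen_enumeration a b D lam phi.
Proof.
move=> lam0 bases.
have level t : exists phi : nat -> Y, 0 < t ->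
    [/\ forall j, (0 < j)%N -> lam j = t -> eigenvector a b D t (phi j),
     forall m (c : 'I_m -> R), let y := \sum_(i < m | i.+1 \in [set j | (0 < j)%N /\ lam j = t]) c i *: phi i.+1 in
      a y y = 0 -> forall i : 'I_m, lam i.+1 = t -> c i = 0 &
     forall y, eigenvector a b D t y -> (forall j, (0 < j)%N -> lam j = t -> a y (phi j) = 0) ->
       a y y = 0].
  have [t0|] := boolP (0 < t); last by move=> _; exists (fun _ => 0).
  have [n [[W [We Wi Wf]] Sn]] := bases t t0.
  have [phi [h1 h2 h3]] := enumerate_family Sn Wi; exists phi => _; split.
  - by move=> j j0 jt; have [i ->] := h1 j (conj j0 jt).
  - by move=> m c y ay i it; apply: (h3 m c ay); rewrite inE.
  - by move=> y ye ort; apply: Wf => // i; have [j [j0 jt] <-] := h2 i; exact: ort.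
have [Phi HPhi] := choice level.
exists (fun j => Phi (lam j) j); split.
- by move=> j j0; have [h _ _] := HPhi _ (lam0 j j0); exact: h.
- move=> m c; set y := \sum_i _ => ay i0.
  set t := lam i0.+1; have t0 : 0 < t by exact: lam0.
  have [ev ind _] := HPhi t t0.
  apply: (ind m c _ i0 erefl); set z := \sum_(i | _) _.
  have <- : a y z = a z z.
    apply/eqP; rewrite -subr_eq0 -(psdBl pa) /y (bigID (fun i : 'I_m => i.+1 \in [set j | (0 < j)%N /\ lam j = t]))/=.
    set z' := \sum_(i < m | i.+1 \in _) _; have -> : z' = z.
      by apply: eq_bigr => i; rewrite inE => -[_ ->].
    rewrite addrAC subrr add0r big_mkcond (psd_suml pa) big1// => i _.
    case: ifPn => [ni|_]; last by rewrite -(scale0r 0) (psdZl pa) mul0r.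
    rewrite (psdZl pa) /z big_mkcond (psd_sumr pa) big1 ?mulr0// => j _.
    case: ifPn => [|_]; last by rewrite -(scale0r 0) (psdZr pa) mul0r.
    rewrite inE => -[_ jt]; rewrite (psdZr pa).
    have it : lam i.+1 != t by apply: contra ni => /eqP it; rewrite inE.
    have [evi _ _] := HPhi _ (lam0 i.+1 isT).
    by rewrite (eigenvectors_orthogonal pa pb it (evi i.+1 isT erefl) (ev j.+1 isT jt)) mulr0.
  exact: (psd_diag0l pa).
- move=> t y t0 ye ort; have [_ _ full] := HPhi t t0.
  by apply: full => // j j0 jt; rewrite -jt; exact: ort.
Qed.

End Enumeration.

(** * Gluing vertices *)

Section Gluing.
Context {R : realType} (G : metric_graph R) (A : {set vertex G}).
Variables (q : edge G -> R -> R) (M : R).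
Hypothesis mq : forall e, measurable_fun setT (q e).
Hypothesis qb : forall e x, 0 <= q e x <= M.
Local Notation E := (edge G).
Local Notation V := (vertex G).
Local Notation len := (@len R G).
Local Notation Y := (L2space len).
Local Notation H := (glue_vertices A).
Implicit Types (w v : Y) (e : E) (z : V).
Local Notation aform := (@aform R E len q).
Local Notation bform := (@bform R E len q).
Local Notation kirchhoffG := (@kirchhoff R E V (@src R G) (@tgt R G) len).
Local Notation kirchhoffH := (@kirchhoff R E (vertex H) (@src R H) (@tgt R H) len).

Let len_gt0' e : 0 < len e. Proof. exact: len_gt0. Qed.
Let pa : psd_form aform := @aform_psd R E _ q M mq qb.
Let pb : psd_form bform := @bform_psd R E _ q M mq qb.

Lemma site_glue p : site (@src R H) (@tgt R H) p = insub (site (@src R G) (@tgt R G) p).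
Proof. by case: p => e []. Qed.

Lemma kirchhoff_old (u : {v | v \notin A}) w : kirchhoffH (Some u) w = kirchhoffG (val u) w.
Proof.
apply: eq_bigl => p; rewrite site_glue; apply/eqP/eqP => [pu|->]; last exact: valK.
by case: insubP pu => // u' _ <- [->].
Qed.

(** The edge ends at the new vertex are those at the glued vertices. *)
Lemma kirchhoff_new w : kirchhoffH None w = \sum_(z in A) kirchhoffG z w.
Proof.
rewrite /kirchhoff (exchange_big_dep xpredT)//= big_mkcond/=; apply: eq_bigr => p _.
rewrite site_glue; case: insubP => [u uA us|]; last rewrite negbK => sA.
  by rewrite big_pred0// => z; apply/andP => -[zA /eqP pz]; case/negP: uA; rewrite pz.
rewrite eqxx (big_pred1 (site (@src R G) (@tgt R G) p))// => z /=.
by rewrite eq_sym; case: eqP => [->|_]; rewrite ?sA ?andbF.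
Qed.

(** Once the sum of the k + 1 functionals vanishes, k of them vanishing forces
the last one to vanish. *)
Lemma clamped_glue (k : nat) : #|A| = k.+1 -> exists h : 'I_k -> V,
  @clamped R E V (@src R G) (@tgt R G) len =
  [set w | @clamped R E (vertex H) (@src R H) (@tgt R H) len w /\ forall i, kirchhoffG (h i) w = 0].
Proof.
move=> cA; pose a (i : 'I_k.+1) : V := enum_val (cast_ord (esym cA) i).
have sumA w : \sum_(z in A) kirchhoffG z w = \sum_i kirchhoffG (a i) w.
  rewrite big_enum_val/= (reindex (cast_ord (esym cA)))//=.
  by exists (cast_ord cA) => i _; rewrite ?cast_ordK ?cast_ordKV.
exists (fun i => a (lift ord0 i)); apply/seteqP; split=> w.
  move=> cw; split=> [[u|]|i]; last exact: cw.
    by rewrite kirchhoff_old; exact: cw.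
  by rewrite kirchhoff_new big1.
move=> [cw hw] z; have [zA|zA] := boolP (z \in A); last first.
  by have := cw (insub z); rewrite insubT kirchhoff_old.
have -> : z = a (cast_ord cA (enum_rank_in zA z)).
  by rewrite /a cast_ordK enum_rankK_in.
case: (unliftP ord0 (cast_ord cA (enum_rank_in zA z))) => [i|] ->; first exact: hw.
have := cw None; rewrite kirchhoff_new sumA big_ord_recl big1 ?addr0//.
Qed.

End Gluing.

Section PositiveEigenvalues.
Context {R : realType} (G : metric_graph R).
Variables (q : edge G -> R -> R) (M : R).
Hypothesis mq : forall e, measurable_fun setT (q e).
Hypothesis qb : forall e x, 0 <= q e x <= M.

Lemma positive_eigen_enumeration (lam : nat -> R) :
  lists_positive_eigenvalues (krein_laplacian q) lam ->
  exists phi, eigen_enumeration (@aform R _ (@len R G) q) (@bform R _ (@len R G) q)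
    (@clamped R _ _ (@src R G) (@tgt R G) (@len R G)) lam phi.
Proof.
move=> [mono lam0 mult]; apply: (eigen_enumeration_exists (aform_psd _ mq qb) (bform_psd _ mq qb) lam0).
move=> t t0; have [n [dn cn]] := mult t t0; exists n; split=> //.
exact: (eigenspace_basis mq qb t0 dn).
Qed.

End PositiveEigenvalues.

Section Interlacing.
Context {R : realType} (G : metric_graph R).
Variables (q : edge G -> R -> R) (M : R).
Hypothesis mq : forall e, measurable_fun setT (q e).
Hypothesis qb : forall e x, 0 <= q e x <= M.

Theorem positive_interlacing (A : {set vertex G}) (k : nat) (lam lam' : nat -> R) :
  #|A| = k.+1 ->
  lists_positive_eigenvalues (krein_laplacian q) lam ->
  lists_positive_eigenvalues (krein_laplacian (G := glue_vertices A) q) lam' ->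
  forall j, (0 < j)%N ->
    [/\ lam' j <= lam j, lam j <= lam' (j + k)%N & lam' (j + k)%N <= lam (j + k)%N].
Proof.
move=> cA hl hl' j j0.
have [phi ephi] := positive_eigen_enumeration mq qb hl.
have len_gt0' (e : edge G) : 0 < len e by exact: len_gt0.
have [phi' ephi'] : exists phi, eigen_enumeration (@aform R _ (@len R G) q)
    (@bform R _ (@len R G) q)
    (@clamped R _ _ (@src R (glue_vertices A)) (@tgt R (glue_vertices A)) (@len R G)) lam' phi.
  exact: (@positive_eigen_enumeration R (glue_vertices A) q M mq qb lam' hl').
have [h hE] := clamped_glue cA.
have ab : exists2 C, 0 < C & forall u : L2space (@len R G), aform q u u <= C * bform q u u.
  exists ((1 + \sum_e (@len R G) e) ^+ 2); last exact: (aform_le_bform len_gt0' mq qb).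
  by rewrite exprn_gt0// ltr_pwDl// sumr_ge0// => e _; exact: ltW.
have pa := @aform_psd R _ (@len R G) q M mq qb.
have pb := @bform_psd R _ (@len R G) q M mq qb.
apply: (eigenvalue_interlacing pa pb ab (aform_compact len_gt0' mq qb)
   (bform_complete len_gt0' mq qb)
   (kirchhoff_scalar _ _ len_gt0') (kirchhoff_bound _ _ len_gt0' mq qb)
   (kirchhoff_scalar _ _ len_gt0') (kirchhoff_bound _ _ len_gt0' mq qb)
   (fun i => kirchhoff_scalar _ _ len_gt0' (h i)) hE _ _ ephi ephi') => //.
- by case: hl.
- by case: hl'.
Qed.

End Interlacing.

(** * Counting ground states and the theorem *)

Section Counting.
Context {R : realType}.
Implicit Types (lam : nat -> R).

(** The zeros form an initial segment because the list is nondecreasing and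
nonnegative, and its length is their number. *)
Lemma zero_level lam N : (forall i j, (0 < i <= j)%N -> lam i <= lam j) ->
  (forall j, (0 < j)%N -> 0 <= lam j) ->
  [set j | (0 < j)%N /\ lam j = 0] #= `I_N ->
  forall j, (0 < j)%N -> (lam j == 0) = (j <= N)%N.
Proof.
move=> mono lam0; set S := [set j | _]; move=> SN.
have cI n : [set p.+1 | p in `I_n] #= `I_n by apply: inj_card_eq => ? ? _ _ [].
have /card_eqPle[SN1 SN2] := SN.
have cI1 n : [set p.+1 | p in `I_n] #<= `I_n by have /card_eqPle[] := cI n.
have cI2 n : `I_n #<= [set p.+1 | p in `I_n] by have /card_eqPle[] := cI n.
move=> j j0; apply/eqP/idP => [lj|jN].
  rewrite -card_le_II; apply: card_le_trans SN1; apply: card_le_trans (cI2 j) _.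
  apply: subset_card_le => _ [p /= pj <-]; split=> //.
  by apply/eqP; rewrite eq_le lam0// andbT -lj mono.
apply: contrapT => lj; have : (N <= j.-1)%N.
  rewrite -card_le_II; apply: card_le_trans SN2 _.
  apply: card_le_trans (cI1 j.-1); apply: subset_card_le => p [p0 lp]; exists p.-1; rewrite ?prednK//=.
  rewrite -ltnS !prednK// ltnNge; apply/negP => jp.
  by apply: lj; apply/eqP; rewrite eq_le lam0// andbT -lp mono// j0.
by rewrite leqNgt; case: j j0 jN {lj} => //= j _ ->.
Qed.

(** Dropping the zeros leaves the positions of every positive eigenvalue
unchanged up to translation. *)
Lemma lists_positive_shift (G : metric_graph R) (T : operator G) lam N :
  lists_eigenvalues T lam -> (forall j, (0 < j)%N -> 0 <= lam j) ->
  (forall j, (0 < j)%N -> (lam j == 0) = (j <= N)%N) ->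
  lists_positive_eigenvalues T (fun j => lam (N + j)%N).
Proof.
move=> [mono _ mult] lam0 lamN; split.
- by move=> i j /andP[i0 ij]; apply: mono; rewrite leq_add2l ij andbT ltn_addl.
- move=> j j0 /=; rewrite lt_def lam0 ?lamN ?andbT ?ltn_addl//.
  by rewrite -ltnNge -[X in (X < _)%N]addn0 ltn_add2l.
move=> t t0; have [n [dn cn]] := mult t I; exists n; split=> //.
apply: card_eq_trans cn; apply: card_esym.
have -> : [set j | (0 < j)%N /\ lam j = t] =
    [set (N + j)%N | j in [set j | (0 < j)%N /\ lam (N + j)%N = t]].
  apply/seteqP; split=> j /=; last first.
    by move=> [p [p0 pt] <-]; rewrite ltn_addl.
  move=> [j0 jt]; have Nj : (N < j)%N.
    by rewrite ltnNge -lamN// jt gt_eqF.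
  by exists (j - N)%N; rewrite ?subnKC ?subn_gt0// ltnW.
by apply: inj_card_eq => ? ? _ _ /addnI.
Qed.

End Counting.

Section Vertices.
Context {R : realType} (G : metric_graph R).

(** The first edge of a path to an end of some edge; a vertex from which the
path is trivial is such an end itself. *)
Lemma connected_no_isolated : connected_graph G ->
  forall z : vertex G, exists p, site (@src R G) (@tgt R G) p = z.
Proof.
move=> conn z; have /card_gt0P[e0 _] := edge_gt0 G.
have /connectP[[|w p] /=] := conn z (src e0).
  by move=> _ <-; exists (e0, false).
by case/andP => /existsP[e /orP[]/andP[/eqP h1 /eqP h2]] _ _;
  [exists (e, false)|exists (e, true)].
Qed.

Lemma glue_no_isolated (A : {set vertex G}) : (0 < #|A|)%N ->
  (forall z : vertex G, exists p, site (@src R G) (@tgt R G) p = z) ->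
  forall z : vertex (glue_vertices A),
    exists p, site (@src R (glue_vertices A)) (@tgt R (glue_vertices A)) p = z.
Proof.
move=> /card_gt0P[a aA] iso [u|].
  by have [p pu] := iso (val u); exists p; rewrite site_glue pu valK.
by have [p pa] := iso a; exists p; rewrite site_glue pa insubN// negbK.
Qed.

Lemma card_glue (A : {set vertex G}) (k : nat) : #|A| = k.+1 ->
  #|vertex (glue_vertices A)| = (#|vertex G| - k)%N.
Proof.
move=> cA; rewrite card_option card_sig -(cardsC A) cA.
rewrite addSn subSn ?leq_addr// addKn; congr _.+1; apply: eq_card => z.
by rewrite !inE.
Qed.

End Vertices.

Section AllEigenvalues.
Context {R : realType} (G : metric_graph R).
Variables (q : edge G -> R -> R) (M : R).
Hypothesis mq : forall e, measurable_fun setT (q e).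
Hypothesis qb : forall e x, 0 <= q e x <= M.
Hypothesis no_isolated : forall z : vertex G, exists p, site (@src R G) (@tgt R G) p = z.

Lemma eigenvalues_structure (lam : nat -> R) :
  lists_eigenvalues (krein_laplacian q) lam ->
  [/\ forall j, (0 < j)%N -> 0 <= lam j,
      forall j, (0 < j)%N -> (lam j == 0) = (j <= #|vertex G|)%N &
      lists_positive_eigenvalues (krein_laplacian q) (fun j => lam (#|vertex G| + j)%N)].
Proof.
move=> hl; have [mono _ mult] := hl.
have lam0 j : (0 < j)%N -> 0 <= lam j.
  move=> j0; rewrite leNgt; apply/negP => lj.
  have [n [dn cn]] := mult (lam j) I.
  rewrite (negative_eigenspace mq qb lj dn) II0 card_eq0 in cn.
  move/eqP: cn => cn; suff : (set0 : set nat) j by [].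
  by rewrite -cn.
have lamN : forall j, (0 < j)%N -> (lam j == 0) = (j <= #|vertex G|)%N.
  have [n [dn cn]] := mult 0 I.
  rewrite (has_dim_unique dn (kernel_dim mq qb no_isolated)) in cn.
  exact: zero_level mono lam0 cn.
by split=> //; exact: lists_positive_shift.
Qed.

End AllEigenvalues.

Section BorelPotential.
Context {R : realType} (G : metric_graph R).
Variables (q : edge G -> R -> R) (M : R).
Hypothesis mq : forall e, measurable_fun setT (q e).
Hypothesis qb : forall e x, 0 <= q e x <= M.

(** Both lists start with zeros, V of them and V - k of them. Beyond these,
lam (V + i) and lam' (V - k + i) are the i-th positive eigenvalues, so a
comparison of positive eigenvalues at index i becomes one of all eigenvalues
with the shift k moved to the other side. *)
Lemma interlacing (A : {set vertex G}) (k : nat) (lam lam' : nat -> R) :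
  connected_graph G -> #|A| = k.+1 ->
  lists_eigenvalues (krein_laplacian q) lam ->
  lists_eigenvalues (krein_laplacian (G := glue_vertices A) q) lam' ->
  (forall j, (0 < j)%N ->
    [/\ lam j <= lam' j, lam' j <= lam (j + k)%N & lam (j + k)%N <= lam' (j + k)%N]) /\
  (0 = lam #|vertex G| /\ lam #|vertex G| < lam' (#|vertex G| - k + 1)%N).
Proof.
move=> conn cA hl hl'.
have iso := connected_no_isolated conn.
have iso' : forall z, exists p, site (@src R (glue_vertices A)) (@tgt R (glue_vertices A)) p = z.
  by apply: glue_no_isolated => //; rewrite cA.
have [lam0 lamN hlp] := eigenvalues_structure mq qb iso hl.
have [lam'0 lam'N hlp'] := @eigenvalues_structure R (glue_vertices A) q M mq qb iso' lam' hl'.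
rewrite (card_glue cA) in lam'N hlp'.
have kV : (k < #|vertex G|)%N by rewrite -cA max_card.
have pos := positive_interlacing mq qb cA hlp hlp'.
move: #|vertex G| kV lamN lam'N pos {hlp hlp'} => N kN lamN lam'N pos.
have z j : (0 < j <= N)%N -> lam j = 0 by case/andP => j0 jN; apply/eqP; rewrite lamN.
have z' j : (0 < j <= N - k)%N -> lam' j = 0 by case/andP => j0 jN; apply/eqP; rewrite lam'N.
have le1 j : (0 < j)%N -> lam j <= lam' j.
  move=> j0; have [jN|Nj] := leqP j N; first by rewrite z ?j0// lam'0.
  have i0 : (0 < j - N)%N by rewrite subn_gt0.
  have [_ + _] := pos _ i0; rewrite subnKC ?(ltnW Nj)//.
  by congr (_ <= lam' _); lia.
have le2 j : (0 < j)%N -> lam' j <= lam (j + k)%N.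
  move=> j0; have [jN|Nj] := leqP j (N - k).
    by rewrite z' ?j0// lam0// addn_gt0 j0.
  have i0 : (0 < j - (N - k))%N by rewrite subn_gt0.
  have [+ _ _] := pos _ i0; rewrite subnKC ?(ltnW Nj)//.
  by congr (_ <= lam _); lia.
split; first by move=> j j0; split; [exact: le1|exact: le2|apply: le1; rewrite addn_gt0 j0].
have N0 : (0 < N)%N by case: N kN {lamN lam'N pos z z' le1 le2}.
rewrite z ?N0 ?leqnn//; split=> //.
by rewrite lt_def lam'0 ?lam'N ?addn1// ltnn.
Qed.

End BorelPotential.

Section PotentialClass.
Context {R : realType} (G : metric_graph R).

Lemma minimal_operator_raeq (q q' : edge G -> R -> R) :
  (forall e, raeq (len e) (q e) (q' e)) -> minimal_operator q = minimal_operator q'.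
Proof.
move=> qq; apply/funext => f; apply/funext => h; apply/propext.
split=> -[h1 h2 h3 h4 h5]; split=> // e;
  apply: ae_imp2 (h5 e) (qq e) => x h6 h7 xl; rewrite h6//.
  by rewrite h7.
by rewrite -h7.
Qed.

Lemma exists_borel_potential (q : edge G -> R -> R) :
  measurable_potential q -> bounded_potential q -> ae_nonneg_potential q ->
  exists M, exists q' : edge G -> R -> R, [/\ forall e, measurable_fun setT (q' e),
    forall e x, 0 <= q' e x <= M & forall e, raeq (len e) (q e) (q' e)].
Proof.
move=> qm [M qM] q0; exists `|M|.
have /choice[q' Hq'] (e : edge G) : exists q1 : R -> R, [/\ measurable_fun setT q1,
    forall x, 0 <= q1 x <= `|M| & raeq (len e) (q e) q1].
  have [x xl|q1 [h1 h2] h3] := borel_version (M := `|M|) (qm e) _ (q0 e) (normr_ge0 _).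
    exact: le_trans (qM e x xl) (ler_norm M).
  by exists q1.
by exists q'; split=> e; case: (Hq' e).
Qed.

End PotentialClass.

Theorem theorem4p2 (R : realType) (G : metric_graph R)
    (Gconn : connected_graph G) (q : edge G -> R -> R)
    (qmeas : measurable_potential q) (qbnd : bounded_potential q)
    (qge0 : ae_nonneg_potential q)
    (k : nat) (A : {set vertex G}) (cardA : #|A| = k.+1) :
  (forall lamp lamtp : nat -> R,
     lists_positive_eigenvalues (krein_laplacian q) lamp ->
     lists_positive_eigenvalues (krein_laplacian (G := glue_vertices A) q) lamtp ->
     forall j : nat, (0 < j)%N ->
       [/\ lamtp j <= lamp j, lamp j <= lamtp (j + k)%N
         & lamtp (j + k)%N <= lamp (j + k)%N])
  /\
  (forall lam lamt : nat -> R,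
     lists_eigenvalues (krein_laplacian q) lam ->
     lists_eigenvalues (krein_laplacian (G := glue_vertices A) q) lamt ->
     (forall j : nat, (0 < j)%N ->
       [/\ lam j <= lamt j, lamt j <= lam (j + k)%N
         & lam (j + k)%N <= lamt (j + k)%N])
     /\
     (0 = lam #|vertex G| /\ lam #|vertex G| < lamt (#|vertex G| - k + 1)%N)).
Proof.
have [M [q' [mq' q'b qq']]] := exists_borel_potential qmeas qbnd qge0.
rewrite /krein_laplacian (minimal_operator_raeq qq').
rewrite (@minimal_operator_raeq R (glue_vertices A) q q' qq').
split=> lam lam' hl hl'; first exact: (positive_interlacing mq' q'b cardA hl hl').
exact: (interlacing mq' q'b Gconn cardA hl hl').
Qed.
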